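(* Let $\mathbb B$ be the open quaternionic unit ball and let $f:\mathbb B\to\mathbb B$ be slice regular with $f(0)=0$. Suppose $q_0\in\mathbb B$ and set $\alpha_f(q_0):=\frac{1-|f(q_0)|^2}{1-|q_0|^2}$. Then $$|f^h(q_0)|\le\begin{cases}\alpha_f(q_0)^{-1}&\text{if }|q_0|\le\sqrt2-1,\\[4pt] \alpha_f(q_0)^{-1}\dfrac{(1+|q_0|^2)^2}{4|q_0|(1-|q_0|^2)}&\text{if }\sqrt2-1<|q_0|<1,\end{cases}$$ where $f^h(q_0)$ is the hyperbolic derivative of $f$ at $q_0$.
   Context: $\mathbb H$ is the skew-field of quaternions, $\mathbb B=\{q\in\mathbb H:|q|<1\}$, $\mathbb S=\{I\in\mathbb H:I^2=-1\}$, $\mathbb C_I=\mathbb R+\mathbb RI$. A function $f:\mathbb B\to\mathbb H$ is slice regular if it has continuous partial derivatives and $\frac12(\partial_x+I\partial_y)f(x+yI)=0$ on $\mathbb B\cap\mathbb C_I$ for every $I\in\mathbb S$; equivalently $f(q)=\sum_{m\ge0}q^ma_m$ with $a_m\in\mathbb H$, converging on $\mathbb B$. For $f=\sum q^ma_m$, $g=\sum q^mb_m$: $f\ast g=\sum_m q^m\sum_{\ell=0}^m a_{m-\ell}b_\ell$ (constants are regarded as constant functions), $f^c=\sum q^m\overline{a_m}$, $f^s=f\ast f^c$, $f^{-\ast}(q)=f^s(q)^{-1}f^c(q)$, slice regular off the zero set of $f^s$. Hyperbolic difference quotient: for slice regular $f:\mathbb B\to\mathbb B$ and $p\in\mathbb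 B$, let $\mathcal R_{f,p}$ be the unique slice regular function on $\mathbb B$ with $f(q)=f(p)+(q-p)\ast\mathcal R_{f,p}(q)$. Then $f^\star_p(q):=(1-q\overline p)\ast\mathcal R_{f,p}(q)\ast(1-\overline{f(p)}\ast f(q))^{-\ast}$. The hyperbolic derivative of $f$ at $p$ is $f^h(p):=f^\star_p(p)$. *)

(* Defs.v *)
From Stdlib Require Import Reals ClassicalEpsilon.
From Coquelicot Require Import Coquelicot.

Open Scope R_scope.

(** * Quaternions *)

(* [((a, b), (c, d))] stands for [a + b i + c j + d k].  Coquelicot's product
   instances make [quat] a normed module over [R] with the componentwise vector
   structure and the Euclidean topology, so that [plus], [opp], [minus],
   [scal], [is_derive], [continuous] and [is_series] apply to it. *)
Definition quat : Type := ((R * R) * (R * R))%type.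

Definition qreal (x : R) : quat := ((x, 0), (0, 0)).

Definition qmul (p q : quat) : quat :=
  let '((a1, b1), (c1, d1)) := p in
  let '((a2, b2), (c2, d2)) := q in
  ((a1 * a2 - b1 * b2 - c1 * c2 - d1 * d2,
    a1 * b2 + b1 * a2 + c1 * d2 - d1 * c2),
   (a1 * c2 - b1 * d2 + c1 * a2 + d1 * b2,
    a1 * d2 + b1 * c2 - c1 * b2 + d1 * a2)).

Definition qconj (q : quat) : quat :=
  let '((a, b), (c, d)) := q in ((a, - b), (- c, - d)).

Definition qnorm (q : quat) : R :=
  let '((a, b), (c, d)) := q in sqrt (a ^ 2 + b ^ 2 + c ^ 2 + d ^ 2).

Declare Scope quat_scope.
Delimit Scope quat_scope with quat.
Bind Scope quat_scope with quat.
Notation "p + q" := (plus (p : quat) (q : quat) : quat) : quat_scope.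
Notation "p - q" := (minus (p : quat) (q : quat) : quat) : quat_scope.
Notation "- q" := (opp (q : quat) : quat) : quat_scope.
Notation "p * q" := (qmul p q) : quat_scope.

(* Total inverse: it is the two-sided inverse of [q] for [q <> 0], while the
   value at [0] carries no meaning. *)
Definition qinv (q : quat) : quat := scal (/ qnorm q ^ 2) (qconj q).

Fixpoint qpow (q : quat) (n : nat) : quat :=
  match n with
  | O => qreal 1
  | S n' => (q * qpow q n')%quat
  end.

Definition unit_ball (q : quat) : Prop := qnorm q < 1.

Definition imag_unit (I : quat) : Prop := (I * I = qreal (-1))%quat.

(** * Slice regular functions on the unit ball *)

(* Functions on the ball are represented by total functions [quat -> quat];
   only their values on the ball matter. *)

(* The point [x + y I] of the slice [C_I]. *)
Definition slice_point (I : quat) (x y : R) : quat :=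
  (qreal x + qreal y * I)%quat.

(* The partial derivatives are those of the restriction of [f] to each slice,
   in the real coordinates [(x, y)] of the slice. *)
Definition slice_regular (f : quat -> quat) : Prop :=
  forall I : quat, imag_unit I ->
  exists dx dy : R * R -> quat,
  forall x y : R, unit_ball (slice_point I x y) ->
    is_derive (fun t : R => f (slice_point I t y)) x (dx (x, y)) /\
    is_derive (fun t : R => f (slice_point I x t)) y (dy (x, y)) /\
    continuous dx (x, y) /\
    continuous dy (x, y) /\
    (qreal (1 / 2) * (dx (x, y) + I * dy (x, y)) = qreal 0)%quat.

(** * Power series and the star product *)

Definition is_qseries (a : nat -> quat) (q l : quat) : Prop :=
  is_series (fun m : nat => (qpow q m * a m)%quat) l.

(* The sum of [q^m a_m] where this series converges. *)
Definition qseries (a : nat -> quat) (q : quat) : quat :=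
  epsilon (inhabits (qreal 0)) (is_qseries a q).

(* The coefficients [a_m] with [f q] equal to the sum of [q^m a_m] on the ball;
   they exist and are unique as soon as [f] is slice regular. *)
Definition coeffs (f : quat -> quat) : nat -> quat :=
  epsilon (inhabits (fun _ : nat => qreal 0))
    (fun a => forall q : quat, unit_ball q -> is_qseries a q (f q)).

Definition star (f g : quat -> quat) : quat -> quat :=
  qseries (fun m : nat =>
    sum_n (fun l : nat => (coeffs f (m - l) * coeffs g l)%quat) m).

Definition regular_conj (f : quat -> quat) : quat -> quat :=
  qseries (fun m : nat => qconj (coeffs f m)).

Definition symmetrization (f : quat -> quat) : quat -> quat :=
  star f (regular_conj f).

(* Meaningful at the points where [symmetrization f] does not vanish. *)
Definition star_inv (f : quat -> quat) (q : quat) : quat :=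
  (qinv (symmetrization f q) * regular_conj f q)%quat.

(** * Hyperbolic difference quotient and hyperbolic derivative *)

(* The unique slice regular [g] with [f(q) = f(p) + (q - p) * g(q)] on the
   ball, the product being the star product. *)
Definition diff_quotient (f : quat -> quat) (p : quat) : quat -> quat :=
  epsilon (inhabits (fun _ : quat => qreal 0))
    (fun g => slice_regular g /\
       forall q : quat, unit_ball q ->
         f q = (f p + star (fun z => z - p) g q)%quat).

Definition hyp_diff_quotient (f : quat -> quat) (p : quat) : quat -> quat :=
  star
    (star (fun q => qreal 1 - q * qconj p)%quat (diff_quotient f p))
    (star_inv (fun q => qreal 1 - star (fun _ => qconj (f p)) f q)%quat).

Definition hyp_derivative (f : quat -> quat) (p : quat) : quat :=
  hyp_diff_quotient f p p.

Definition alpha (f : quat -> quat) (q : quat) : R :=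
  (1 - qnorm (f q) ^ 2) / (1 - qnorm q ^ 2).

(* Main.v *)
Require Import Defs.
From Stdlib Require Import Reals Lra Lia.
From Stdlib Require Import ClassicalEpsilon FunctionalExtensionality.
From Coquelicot Require Import Coquelicot.

(** Everything is read off the coefficients of power series, for which the star
    product is the convolution [conv].  A slice regular function is the sum of
    its power series ([slice_regular_has_coeffs]): on each slice this is
    Cauchy's formula, and the coefficients do not depend on the slice because
    the real points determine them.

    Call a sequence a Schur sequence when convolution by it does not increase
    the sum of the squared norms, on any initial segment.  The coefficients of
    a slice regular self-map of the ball form one ([self_map_schur]).  Indeed,
    on the sphere through [x + y i] one has [f(x + y J) = b + J s] with [b]
    and [s] independent of [J]; in the complexified quaternions, where the
    star product is the pointwise product of the functions [b + i s], left
    multiplication by [b + i s] has as its norm exactly the maximum of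
    [|b + J s|] over [J].  Parseval's identity on a circle then turns the bound
    [|f| < 1] into the statement on coefficients.

    Let [g] be the hyperbolic difference quotient of [f] at [p], and [R] the
    difference quotient.  For any input [d], the sequences [(f - f(p)) * d] and
    [(1 - conj(f(p)) f) * d] satisfy the identity behind Moebius maps
    ([moebius_sqsum]), so the former has the smaller norm.  The former equals
    [(q - p) * R * d], which has the same norm as [(1 - q conj(p)) * R * d],
    because [q - p] and [1 - q conj(p)] have equal modulus on the boundary
    ([blaschke_sqsum]).  Hence [g] is again a Schur sequence
    ([quotient_schur]).

    A Schur sequence satisfies the growth estimate
    [|g(p)| <= (|g(0)| + |p|) / (1 + |g(0)| |p|)] ([schur_growth]), which is
    the Nevanlinna-Pick condition for the two points [0] and [p].  When
    [f(0) = 0], evaluating [f(q) = f(p) + (q - p) * R(q)] at [0] shows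
    [|g(0)| = |f(p)| / |p|].  With [r = |p|] and [s = |f(p)| / |p|] the bound
    becomes [|g(p)| <= (s + r) / (1 + s r)], whereas
    [1 / alpha = (1 - r^2) / (1 - s^2 r^2)].  It remains to maximize
    [(s + r) (1 - s r)] over [0 <= s <= 1]: the maximum is at [s = 1] as long
    as [r <= sqrt 2 - 1], and at the vertex of the parabola beyond. *)

Open Scope R_scope.

(** * Quaternion algebra *)

Definition qnsq (q : quat) : R :=
  let '((a, b), (c, d)) := q in a ^ 2 + b ^ 2 + c ^ 2 + d ^ 2.

Definition qdot (p q : quat) : R :=
  let '((a1, b1), (c1, d1)) := p in
  let '((a2, b2), (c2, d2)) := q in
  a1 * a2 + b1 * b2 + c1 * c2 + d1 * d2.

(** The real operations are kept folded, so that [ring] recognizes them. *)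
Ltac qreduce :=
  cbv -[Rplus Rmult Ropp Rminus Rinv Rdiv sqrt Rabs pow IZR cos sin].

(** Identities between quaternions, by comparison of real components.  A value
    [u m] of a sequence is first generalized, since unfolding it would destroy
    the components. *)
Ltac qring :=
  intros;
  repeat match goal with
    | |- context [?f ?m] =>
        match type of m with nat =>
          match type of (f m) with quat => generalize (f m); intro end end
    end;
  repeat match goal with q : quat |- _ => destruct q as [[? ?] [? ?]] end;
  qreduce;
  try match goal with |- @eq R _ _ => ring end;
  repeat match goal with |- (_, _) = (_, _) => f_equal end; ring.

Lemma qplus_comm (p q : quat) : (p + q = q + p)%quat.
Proof. qring. Qed.

Lemma qmul_assoc (p q r : quat) : (p * (q * r) = p * q * r)%quat.
Proof. qring. Qed.

Lemma qmul_1l (p : quat) : (qreal 1 * p = p)%quat.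
Proof. qring. Qed.

Lemma qmul_1r (p : quat) : (p * qreal 1 = p)%quat.
Proof. qring. Qed.

Lemma qmul_0l (p : quat) : (qreal 0 * p = qreal 0)%quat.
Proof. qring. Qed.

Lemma qmul_0r (p : quat) : (p * qreal 0 = qreal 0)%quat.
Proof. qring. Qed.

Lemma qmul_plus_l (p q r : quat) : ((p + q) * r = p * r + q * r)%quat.
Proof. qring. Qed.

Lemma qmul_plus_r (p q r : quat) : (p * (q + r) = p * q + p * r)%quat.
Proof. qring. Qed.

Lemma qmul_minus_l (p q r : quat) : ((p - q) * r = p * r - q * r)%quat.
Proof. qring. Qed.

Lemma qmul_minus_r (p q r : quat) : (p * (q - r) = p * q - p * r)%quat.
Proof. qring. Qed.

Lemma qmul_real (x : R) (p : quat) : (p * qreal x = qreal x * p)%quat.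
Proof. qring. Qed.

Lemma scal_qreal (x : R) (p : quat) : scal x p = (qreal x * p)%quat.
Proof. qring. Qed.

Lemma qreal_mul (x y : R) : (qreal x * qreal y = qreal (x * y))%quat.
Proof. qring. Qed.

Lemma qreal_plus (x y : R) : (qreal x + qreal y = qreal (x + y))%quat.
Proof. qring. Qed.

Lemma qconj_mul (p q : quat) : qconj (p * q) = (qconj q * qconj p)%quat.
Proof. qring. Qed.

Lemma qconj_plus (p q : quat) : qconj (p + q)%quat = (qconj p + qconj q)%quat.
Proof. qring. Qed.

Lemma qconj_real (x : R) : qconj (qreal x) = qreal x.
Proof. qring. Qed.

Lemma qconj_invol (p : quat) : qconj (qconj p) = p.
Proof. qring. Qed.

Lemma qmul_conj_r (p : quat) : (p * qconj p = qreal (qnsq p))%quat.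
Proof. qring. Qed.

Lemma qmul_conj_l (p : quat) : (qconj p * p = qreal (qnsq p))%quat.
Proof. qring. Qed.

Lemma qnsq_mul (p q : quat) : qnsq (p * q) = qnsq p * qnsq q.
Proof. qring. Qed.

Lemma qnsq_conj (p : quat) : qnsq (qconj p) = qnsq p.
Proof. qring. Qed.

Lemma qnsq_real (x : R) : qnsq (qreal x) = x ^ 2.
Proof. qring. Qed.

Lemma qnsq_ge0 (p : quat) : 0 <= qnsq p.
Proof. destruct p as [[a b] [c d]]; cbn; nra. Qed.

Lemma qnorm_qnsq (p : quat) : qnorm p = sqrt (qnsq p).
Proof. destruct p as [[a b] [c d]]; reflexivity. Qed.

Lemma qnorm_ge0 (p : quat) : 0 <= qnorm p.
Proof. rewrite qnorm_qnsq; apply sqrt_pos. Qed.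

Lemma qnorm_sq (p : quat) : qnorm p ^ 2 = qnsq p.
Proof. rewrite qnorm_qnsq; apply pow2_sqrt, qnsq_ge0. Qed.

Lemma qnorm_mul (p q : quat) : qnorm (p * q) = qnorm p * qnorm q.
Proof. rewrite !qnorm_qnsq, qnsq_mul; apply sqrt_mult; apply qnsq_ge0. Qed.

Lemma qnorm_conj (p : quat) : qnorm (qconj p) = qnorm p.
Proof. now rewrite !qnorm_qnsq, qnsq_conj. Qed.

Lemma qnorm_real (x : R) : qnorm (qreal x) = Rabs x.
Proof. rewrite qnorm_qnsq, qnsq_real. now rewrite <- sqrt_Rsqr_abs, Rsqr_pow2. Qed.

(** The normed module structure that unification does not always find from [quat]. *)
Definition qmodule : NormedModule R_AbsRing :=
  prod_NormedModule _
    (prod_NormedModule _ R_NormedModule R_NormedModule)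
    (prod_NormedModule _ R_NormedModule R_NormedModule).

Lemma qnorm_norm (p : quat) : norm p = qnorm p.
Proof.
  destruct p as [[a b] [c d]]. unfold norm; cbn. unfold prod_norm; cbn.
  unfold norm; cbn. unfold prod_norm; cbn. unfold norm; cbn. unfold abs; cbn.
  f_equal. rewrite !Rmult_1_r.
  rewrite !sqrt_sqrt; try (rewrite <- !Rabs_mult).
  - rewrite !Rabs_pos_eq by nra. ring.
  - generalize (Rabs_pos (c * c)) (Rabs_pos (d * d)); lra.
  - generalize (Rabs_pos (a * a)) (Rabs_pos (b * b)); lra.
Qed.

Lemma qnorm_triangle (p q : quat) : qnorm (p + q)%quat <= qnorm p + qnorm q.
Proof. rewrite <- !qnorm_norm. apply (@norm_triangle _ qmodule). Qed.

Lemma qnorm_opp (p : quat) : qnorm (- p)%quat = qnorm p.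
Proof. rewrite <- !qnorm_norm. apply (@norm_opp _ qmodule). Qed.

Lemma qnorm_minus (p q : quat) : qnorm (p - q)%quat <= qnorm p + qnorm q.
Proof. unfold minus; rewrite <- (qnorm_opp q). apply qnorm_triangle. Qed.

Lemma qnsq_eq0 (p : quat) : qnsq p = 0 -> p = qreal 0.
Proof.
  destruct p as [[a b] [c d]]; cbn; intros H. unfold qreal.
  repeat f_equal; nra.
Qed.

Lemma qnorm_eq0 (p : quat) : qnorm p = 0 -> p = qreal 0.
Proof. intros H; apply qnsq_eq0; rewrite <- qnorm_sq, H; ring. Qed.

Lemma qnorm_pow (q : quat) (n : nat) : qnorm (qpow q n) = qnorm q ^ n.
Proof.
  induction n as [|n IH]; cbn [qpow pow].
  - rewrite qnorm_real; apply Rabs_R1.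
  - now rewrite qnorm_mul, IH.
Qed.

Lemma unit_ball_qnsq (p : quat) : unit_ball p -> 0 <= qnsq p < 1.
Proof.
  unfold unit_ball. intros H. split; [apply qnsq_ge0|].
  rewrite <- qnorm_sq. generalize (qnorm_ge0 p). nra.
Qed.

Lemma qinv_l (q : quat) : q <> qreal 0 -> (qinv q * q = qreal 1)%quat.
Proof.
  intros Hq. unfold qinv. rewrite scal_qreal, <- qmul_assoc, qmul_conj_l, qreal_mul.
  rewrite qnorm_sq. f_equal. apply Rinv_l. intros H; apply Hq, qnsq_eq0, H.
Qed.

(** The real part of [conj(p) q] has absolute value at most [|conj(p) q|]. *)
Lemma qdot_bound (p q : quat) : Rabs (qdot p q) <= qnorm p * qnorm q.
Proof.
  rewrite <- (qnorm_conj p), <- qnorm_mul.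
  set (r := (qconj p * q)%quat).
  assert (Hr : qdot p q = fst (fst r)) by (unfold r; clear r; qring).
  rewrite Hr, qnorm_qnsq, <- sqrt_Rsqr_abs. apply sqrt_le_1_alt.
  destruct r as [[a b] [c d]]; cbn; unfold Rsqr; nra.
Qed.

(** Real-valued calculus applies to quaternionic functions through the functionals
    [qdot c]. *)
Lemma qdot_ext (p q : quat) : (forall c, qdot c p = qdot c q) -> p = q.
Proof.
  intros H. destruct p as [[a b] [c d]], q as [[a' b'] [c' d']].
  generalize (H ((1,0),(0,0))) (H ((0,1),(0,0))) (H ((0,0),(1,0))) (H ((0,0),(0,1))).
  cbn; intros. repeat f_equal; lra.
Qed.

(** * Convolution *)

(** The carrier is fixed to [quat], so that rewriting does not depend on the
    algebraic structure that was inferred for the sum. *)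
Definition qsum (u : nat -> quat) (n : nat) : quat := sum_n u n.

Lemma qsum_0 (u : nat -> quat) : qsum u 0 = u 0%nat.
Proof. apply sum_O. Qed.

Lemma qsum_S (u : nat -> quat) (n : nat) : qsum u (S n) = (qsum u n + u (S n))%quat.
Proof. apply sum_Sn. Qed.

Lemma qsum_ext (u v : nat -> quat) (n : nat) :
  (forall k, (k <= n)%nat -> u k = v k) -> qsum u n = qsum v n.
Proof. apply sum_n_ext_loc. Qed.

Lemma qsum_mul_l (c : quat) (u : nat -> quat) (n : nat) :
  qsum (fun k => c * u k)%quat n = (c * qsum u n)%quat.
Proof.
  induction n as [|n IH]; [now rewrite !qsum_0|].
  now rewrite !qsum_S, IH, qmul_plus_r.
Qed.

Lemma qsum_mul_r (c : quat) (u : nat -> quat) (n : nat) :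
  qsum (fun k => u k * c)%quat n = (qsum u n * c)%quat.
Proof.
  induction n as [|n IH]; [now rewrite !qsum_0|].
  now rewrite !qsum_S, IH, qmul_plus_l.
Qed.

Lemma qsum_plus (u v : nat -> quat) (n : nat) :
  qsum (fun k => u k + v k)%quat n = (qsum u n + qsum v n)%quat.
Proof. apply sum_n_plus. Qed.

Lemma qsum_S_first (u : nat -> quat) (n : nat) :
  qsum u (S n) = (u 0%nat + qsum (fun k => u (S k)) n)%quat.
Proof.
  induction n as [|n IH].
  - now rewrite qsum_S, !qsum_0.
  - rewrite qsum_S, IH, qsum_S. qring.
Qed.

Definition rsum (u : nat -> R) (n : nat) : R := sum_n u n.

Lemma rsum_0 (u : nat -> R) : rsum u 0 = u 0%nat.
Proof. apply (sum_O u). Qed.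

Lemma rsum_S (u : nat -> R) (n : nat) : rsum u (S n) = rsum u n + u (S n).
Proof. apply (sum_Sn u). Qed.

Lemma rsum_ext (u v : nat -> R) (n : nat) :
  (forall k, (k <= n)%nat -> u k = v k) -> rsum u n = rsum v n.
Proof. apply (@sum_n_ext_loc R_AbelianMonoid). Qed.

Lemma rsum_le (u v : nat -> R) (n : nat) :
  (forall k, (k <= n)%nat -> u k <= v k) -> rsum u n <= rsum v n.
Proof.
  induction n as [|n IH]; intros H.
  - rewrite !rsum_0. now apply H.
  - rewrite !rsum_S. apply Rplus_le_compat; [apply IH; intros; apply H; lia|now apply H].
Qed.

Lemma rsum_ge0 (u : nat -> R) (n : nat) : (forall k, 0 <= u k) -> 0 <= rsum u n.
Proof.
  intros H. induction n as [|n IH]; [rewrite rsum_0; apply H|].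
  rewrite rsum_S. generalize (H (S n)); lra.
Qed.

Lemma rsum_mul_l (c : R) (u : nat -> R) (n : nat) :
  rsum (fun k => c * u k) n = c * rsum u n.
Proof.
  induction n as [|n IH]; [now rewrite !rsum_0|]. rewrite !rsum_S, IH. ring.
Qed.

Lemma rsum_plus (u v : nat -> R) (n : nat) :
  rsum (fun k => u k + v k) n = rsum u n + rsum v n.
Proof.
  induction n as [|n IH]; [now rewrite !rsum_0|]. rewrite !rsum_S, IH. ring.
Qed.

Lemma qnorm_qsum (u : nat -> quat) (n : nat) :
  qnorm (qsum u n) <= rsum (fun k => qnorm (u k)) n.
Proof.
  induction n as [|n IH].
  - rewrite qsum_0, rsum_0; lra.
  - rewrite qsum_S, rsum_S. eapply Rle_trans; [apply qnorm_triangle|]. lra.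
Qed.

(** The coefficients of a star product. *)
Definition conv (a b : nat -> quat) (m : nat) : quat :=
  qsum (fun l => a (m - l)%nat * b l)%quat m.

Definition shift (a : nat -> quat) (m : nat) : quat := a (S m).

(** The coefficients of [c + q d]. *)
Definition affine (c d : quat) (m : nat) : quat :=
  match m with O => c | S O => d | _ => qreal 0 end.

Definition const (c : quat) : nat -> quat := affine c (qreal 0).

Definition conjs (a : nat -> quat) (m : nat) : quat := qconj (a m).

Lemma conv_0 (a b : nat -> quat) : conv a b 0 = (a 0%nat * b 0%nat)%quat.
Proof. apply qsum_0. Qed.

(** With [conv_S_l], this makes algebraic identities for convolutions provable by
    induction on the index, without reindexing double sums. *)
Lemma conv_S_r (a b : nat -> quat) (m : nat) :
  conv a b (S m) = (a (S m) * b 0%nat + conv a (shift b) m)%quat.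
Proof.
  unfold conv. rewrite qsum_S_first. f_equal.
Qed.

Lemma conv_S_l (a b : nat -> quat) (m : nat) :
  conv a b (S m) = (conv (shift a) b m + a 0%nat * b (S m))%quat.
Proof.
  unfold conv. rewrite qsum_S. rewrite Nat.sub_diag. f_equal.
  apply qsum_ext. intros k Hk. unfold shift. now rewrite Nat.sub_succ_l.
Qed.

Lemma conv_ext_le (a b a' b' : nat -> quat) (m : nat) :
  (forall k, (k <= m)%nat -> a k = a' k) -> (forall k, (k <= m)%nat -> b k = b' k) ->
  conv a b m = conv a' b' m.
Proof.
  intros Ha Hb. apply qsum_ext. intros k Hk. rewrite Ha, Hb by lia. reflexivity.
Qed.

Lemma conv_mul_l (c : quat) (a b : nat -> quat) (m : nat) :
  conv (fun k => c * a k)%quat b m = (c * conv a b m)%quat.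
Proof.
  unfold conv. rewrite <- qsum_mul_l. apply qsum_ext. intros; now rewrite qmul_assoc.
Qed.

Lemma conv_mul_r (c : quat) (a b : nat -> quat) (m : nat) :
  conv a (fun k => b k * c)%quat m = (conv a b m * c)%quat.
Proof.
  unfold conv. rewrite <- qsum_mul_r. apply qsum_ext. intros; now rewrite qmul_assoc.
Qed.

Lemma conv_plus_r (a b c : nat -> quat) (m : nat) :
  conv a (fun k => b k + c k)%quat m = (conv a b m + conv a c m)%quat.
Proof.
  unfold conv. rewrite <- qsum_plus. apply qsum_ext. intros; now rewrite qmul_plus_r.
Qed.

Lemma conv_plus_l (a b c : nat -> quat) (m : nat) :
  conv (fun k => a k + b k)%quat c m = (conv a c m + conv b c m)%quat.
Proof.
  unfold conv. rewrite <- qsum_plus. apply qsum_ext. intros; now rewrite qmul_plus_l.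
Qed.

Lemma conv_assoc (a b c : nat -> quat) : conv (conv a b) c = conv a (conv b c).
Proof.
  apply functional_extensionality; intro m. revert a b c.
  induction m as [|m IH]; intros a b c.
  - now rewrite !conv_0, qmul_assoc.
  - rewrite (conv_S_r (conv a b)), (conv_S_r a (conv b c)), conv_S_r, IH, conv_0.
    replace (shift (conv b c)) with
      (fun k => shift b k * c 0%nat + conv b (shift c) k)%quat
      by (apply functional_extensionality; intro k; symmetry; apply conv_S_r).
    rewrite conv_plus_r, conv_mul_r, qmul_plus_l, !qmul_assoc.
    set (x := (_ * _ * _)%quat); set (y := (_ * _)%quat); set (z := conv _ _ _).
    clearbody x y z. clear. qring.
Qed.

Lemma conv_zero_l (b : nat -> quat) (m : nat) : conv (fun _ => qreal 0) b m = qreal 0.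
Proof.
  induction m as [|m IH].
  - now rewrite conv_0, qmul_0l.
  - rewrite conv_S_l. unfold shift at 1. rewrite IH, qmul_0l. qring.
Qed.

Lemma shift_const (c : quat) : shift (const c) = (fun _ => qreal 0).
Proof. apply functional_extensionality; now intros [|m]. Qed.

Lemma shift_affine (c d : quat) : shift (affine c d) = const d.
Proof. apply functional_extensionality; now intros [|[|m]]. Qed.

Lemma conv_const_l (c : quat) (b : nat -> quat) :
  conv (const c) b = (fun m => c * b m)%quat.
Proof.
  apply functional_extensionality; intros [|m].
  - apply conv_0.
  - rewrite conv_S_l, shift_const, conv_zero_l. cbn. qring.
Qed.

Lemma conv_affine_S (c d : quat) (b : nat -> quat) (m : nat) :
  conv (affine c d) b (S m) = (c * b (S m) + d * b m)%quat.
Proof.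
  rewrite conv_S_l, shift_affine, conv_const_l. apply qplus_comm.
Qed.

(** Conjugation reverses star products. *)
Lemma conv_conj (a b : nat -> quat) : conjs (conv a b) = conv (conjs b) (conjs a).
Proof.
  apply functional_extensionality; intro m. revert a b.
  induction m as [|m IH]; intros a b; unfold conjs at 1.
  - rewrite !conv_0. apply qconj_mul.
  - rewrite conv_S_r, conv_S_l, qconj_plus, qconj_mul.
    change (qconj (conv a (shift b) m)) with (conjs (conv a (shift b)) m).
    rewrite IH. apply qplus_comm.
Qed.

Lemma conv_const_r (c : quat) (a : nat -> quat) :
  conv a (const c) = (fun m => a m * c)%quat.
Proof.
  replace (conv a (const c)) with (conjs (conv (const (qconj c)) (conjs a))).
  - rewrite conv_const_l. apply functional_extensionality; intro m.
    unfold conjs. now rewrite qconj_mul, !qconj_invol.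
  - rewrite conv_conj. f_equal; apply functional_extensionality; intro m; unfold conjs.
    + apply qconj_invol.
    + destruct m as [|[|m]]; cbn; qring.
Qed.

Definition delta : nat -> quat := const (qreal 1).

Lemma conv_delta_l (b : nat -> quat) : conv delta b = b.
Proof. unfold delta; rewrite conv_const_l. apply functional_extensionality; intro; apply qmul_1l. Qed.

Lemma conv_delta_r (b : nat -> quat) : conv b delta = b.
Proof. unfold delta; rewrite conv_const_r. apply functional_extensionality; intro; apply qmul_1r. Qed.

(** * Inverses *)

Fixpoint geom_iter (b : nat -> quat) (k : nat) : nat -> quat :=
  match k with
  | O => delta
  | S k' => fun m => (delta m + conv b (geom_iter b k') m)%quat
  end.

(** The inverse of [1 - b] for sequences with [b 0 = 0]: the iterates of
    [x |-> 1 + b * x] are stationary at each index, the [m]-th one being already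
    correct at index [m]. *)
Definition geom (b : nat -> quat) (m : nat) : quat := geom_iter b m m.

Lemma conv_null_ext (b x y : nat -> quat) (m : nat) :
  b 0%nat = qreal 0 -> (forall k, (k < m)%nat -> x k = y k) ->
  conv b x m = conv b y m.
Proof.
  intros Hb Hxy. destruct m as [|m].
  - now rewrite !conv_0, Hb, !qmul_0l.
  - rewrite !conv_S_l, Hb, !qmul_0l. f_equal. apply conv_ext_le; [easy|].
    intros; apply Hxy; lia.
Qed.

Lemma geom_iter_stable (b : nat -> quat) : b 0%nat = qreal 0 ->
  forall k m, (m <= k)%nat -> geom_iter b k m = geom_iter b (S k) m.
Proof.
  intros Hb. induction k as [|k IH]; intros m Hm.
  - replace m with 0%nat by lia. cbn [geom_iter]. rewrite conv_0, Hb, qmul_0l. qring.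
  - cbn [geom_iter]. f_equal. apply (conv_null_ext b); [easy|].
    intros j Hj. apply IH; lia.
Qed.

Lemma geom_iter_geom (b : nat -> quat) (k m : nat) :
  b 0%nat = qreal 0 -> (m <= k)%nat -> geom_iter b k m = geom b m.
Proof.
  intros Hb. induction k as [|k IH]; intros Hm.
  - now replace m with 0%nat by lia.
  - destruct (Nat.eq_dec m (S k)) as [->|Hne]; [reflexivity|].
    rewrite <- geom_iter_stable by (easy || lia). apply IH; lia.
Qed.

Lemma geom_eq (b : nat -> quat) : b 0%nat = qreal 0 ->
  geom b = (fun m => delta m + conv b (geom b) m)%quat.
Proof.
  intros Hb. apply functional_extensionality; intro m. unfold geom at 1.
  rewrite geom_iter_stable by easy. cbn [geom_iter]. f_equal.
  apply conv_null_ext; [easy|]. intros k Hk. apply geom_iter_geom; [easy|lia].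
Qed.

Lemma geom_inv_r (b : nat -> quat) : b 0%nat = qreal 0 ->
  conv (fun m => delta m - b m)%quat (geom b) = delta.
Proof.
  intros Hb. apply functional_extensionality; intro m.
  transitivity (conv delta (geom b) m + conv (fun k => qreal (-1) * b k)%quat (geom b) m)%quat.
  - rewrite <- conv_plus_l. f_equal. apply functional_extensionality; intro k. qring.
  - rewrite conv_delta_l, conv_mul_l. 
    generalize (equal_f (geom_eq b Hb) m). cbv beta.
    generalize (geom b m) (conv b (geom b) m) (delta m). intros x y z ->. qring.
Qed.

(** The inverse [e] of [1 - b] also starts with [1], so it has a right inverse
    too; associativity forces that right inverse to be [1 - b]. *)
Lemma geom_inv_l (b : nat -> quat) : b 0%nat = qreal 0 ->
  conv (geom b) (fun m => delta m - b m)%quat = delta.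
Proof.
  intros Hb. set (e := geom b). set (G := (fun m => delta m - b m)%quat).
  assert (HGe : conv G e = delta) by now apply geom_inv_r.
  set (b' := (fun m => delta m - e m)%quat).
  assert (Hb' : b' 0%nat = qreal 0).
  { unfold b'. change (e 0%nat) with (delta 0%nat). qring. }
  assert (He : conv e (geom b') = delta).
  { rewrite <- (geom_inv_r b' Hb'). f_equal. apply functional_extensionality; intro k.
    unfold b'. qring. }
  replace G with (geom b'); [easy|].
  rewrite <- (conv_delta_l (geom b')), <- HGe, conv_assoc, He. apply conv_delta_r.
Qed.

(** * Limits *)

Definition qlim (u : nat -> quat) (l : quat) : Prop :=
  is_lim_seq (fun n => qnorm (u n - l)%quat) 0.

Lemma is_series_qlim (u : nat -> quat) (l : quat) : is_series u l <-> qlim (qsum u) l.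
Proof.
  unfold is_series, qlim.
  rewrite (@filterlim_locally_ball_norm R_AbsRing nat qmodule eventually _ (sum_n u) l).
  rewrite <- is_lim_seq_spec. unfold is_lim_seq', ball_norm.
  assert (E : forall n, norm (minus (sum_n u n : qmodule) l) = Rabs (qnorm (qsum u n - l)%quat - 0)).
  { intro n. rewrite Rminus_0_r, Rabs_pos_eq by apply qnorm_ge0. apply qnorm_norm. }
  split; intros H eps; destruct (H eps) as [N HN]; exists N; intros n Hn;
    specialize (HN n Hn).
  - now rewrite <- E.
  - now rewrite E.
Qed.

Lemma is_lim_seq_squeeze0 (u v : nat -> R) :
  (forall n, 0 <= u n <= v n) -> is_lim_seq v 0 -> is_lim_seq u 0.
Proof.
  intros H Hv. apply (is_lim_seq_le_le (fun _ => 0) u v); auto. apply is_lim_seq_const.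
Qed.

Lemma qlim_unique (u : nat -> quat) (l l' : quat) : qlim u l -> qlim u l' -> l = l'.
Proof.
  intros H H'.
  assert (E : qnorm (l - l')%quat = 0).
  { assert (L : is_lim_seq (fun _ => qnorm (l - l')%quat) 0).
    { apply (is_lim_seq_squeeze0 _ (fun n => qnorm (u n - l)%quat + qnorm (u n - l')%quat)).
      - intro n; split; [apply qnorm_ge0|].
        replace (l - l')%quat with ((u n - l') - (u n - l))%quat by qring.
        eapply Rle_trans; [apply qnorm_minus|]. lra.
      - replace (Finite 0) with (Finite (0 + 0)) by (f_equal; ring).
        now apply is_lim_seq_plus'. }
    apply is_lim_seq_unique in L. rewrite Lim_seq_const in L. now injection L. }
  apply qnorm_eq0 in E.
  transitivity ((l - l') + l')%quat; [qring|rewrite E; qring].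
Qed.

Lemma qlim_ext (u v : nat -> quat) (l : quat) :
  (forall n, u n = v n) -> qlim u l -> qlim v l.
Proof. intros E. apply functional_extensionality in E. now subst. Qed.

Lemma qlim_const (l : quat) : qlim (fun _ => l) l.
Proof.
  unfold qlim. apply is_lim_seq_ext with (fun _ => 0); [|apply is_lim_seq_const].
  intros _. replace (l - l)%quat with (qreal 0) by qring. rewrite qnorm_real, Rabs_R0. reflexivity.
Qed.

Lemma qlim_near (u v : nat -> quat) (l : quat) :
  is_lim_seq (fun n => qnorm (u n - v n)%quat) 0 -> qlim u l -> qlim v l.
Proof.
  intros H Hu. apply (is_lim_seq_squeeze0 _ (fun n => qnorm (u n - l)%quat + qnorm (u n - v n)%quat)).
  - intro n; split; [apply qnorm_ge0|].
    replace (v n - l)%quat with ((u n - l) - (u n - v n))%quat by qring. apply qnorm_minus.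
  - replace (Finite 0) with (Finite (0 + 0)) by (f_equal; ring). now apply is_lim_seq_plus'.
Qed.

Lemma qlim_mul_l (c : quat) (u : nat -> quat) (l : quat) :
  qlim u l -> qlim (fun n => c * u n)%quat (c * l)%quat.
Proof.
  intros H. unfold qlim.
  apply is_lim_seq_ext with (fun n => qnorm c * qnorm (u n - l)%quat).
  - intro n. now rewrite <- qmul_minus_r, qnorm_mul.
  - replace (Finite 0) with (Rbar_mult (qnorm c) 0) by (cbn; f_equal; ring).
    now apply is_lim_seq_scal_l.
Qed.

Lemma qlim_mul_r (c : quat) (u : nat -> quat) (l : quat) :
  qlim u l -> qlim (fun n => u n * c)%quat (l * c)%quat.
Proof.
  intros H. unfold qlim.
  apply is_lim_seq_ext with (fun n => qnorm c * qnorm (u n - l)%quat).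
  - intro n. rewrite <- qmul_minus_l, qnorm_mul. ring.
  - replace (Finite 0) with (Rbar_mult (qnorm c) 0) by (cbn; f_equal; ring).
    now apply is_lim_seq_scal_l.
Qed.

Lemma qlim_plus (u v : nat -> quat) (l l' : quat) :
  qlim u l -> qlim v l' -> qlim (fun n => u n + v n)%quat (l + l')%quat.
Proof.
  intros H H'.
  apply (is_lim_seq_squeeze0 _ (fun n => qnorm (u n - l)%quat + qnorm (v n - l')%quat)).
  - intro n; split; [apply qnorm_ge0|].
    replace (u n + v n - (l + l'))%quat with ((u n - l) + (v n - l'))%quat by qring.
    apply qnorm_triangle.
  - replace (Finite 0) with (Finite (0 + 0)) by (f_equal; ring). now apply is_lim_seq_plus'.
Qed.

Lemma qlim_qdot (c : quat) (u : nat -> quat) (l : quat) :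
  qlim u l -> is_lim_seq (fun n => qdot c (u n)) (qdot c l).
Proof.
  intros H.
  assert (H0 : is_lim_seq (fun n => qdot c (u n) - qdot c l) 0).
  { apply <- is_lim_seq_abs_0.
    apply (is_lim_seq_squeeze0 _ (fun n => qnorm c * qnorm (u n - l)%quat)).
    - intro n; split; [apply Rabs_pos|].
      replace (qdot c (u n) - qdot c l) with (qdot c (u n - l)%quat) by qring.
      apply qdot_bound.
    - replace (Finite 0) with (Rbar_mult (qnorm c) 0) by (cbn; f_equal; ring).
      now apply is_lim_seq_scal_l. }
  apply is_lim_seq_ext with (fun n => (qdot c (u n) - qdot c l) + qdot c l).
  - intro n; ring.
  - replace (Finite (qdot c l)) with (Finite (0 + qdot c l)) by (f_equal; ring).
    apply is_lim_seq_plus'; [easy|apply is_lim_seq_const].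
Qed.

Lemma qlim_bound (u : nat -> quat) (l : quat) (B : nat -> R) (b : R) :
  qlim u l -> is_lim_seq B b -> (exists N, forall n, (N <= n)%nat -> qnorm (u n) <= B n) ->
  qnorm l <= b.
Proof.
  intros H HB [N HN].
  assert (HL : is_lim_seq (fun n => qnorm (u n - l)%quat + B n) b).
  { replace (Finite b) with (Finite (0 + b)) by (f_equal; ring). now apply is_lim_seq_plus'. }
  apply (is_lim_seq_le_loc (fun _ => qnorm l) (fun n => qnorm (u n - l)%quat + B n) (qnorm l) b);
    [|apply is_lim_seq_const|easy].
  exists N; intros n Hn. specialize (HN n Hn).
  replace l with (u n - (u n - l))%quat at 1 by qring.
  eapply Rle_trans; [apply qnorm_minus|]. lra.
Qed.

Lemma qdot_qsum (c : quat) (u : nat -> quat) (n : nat) :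
  qdot c (qsum u n) = rsum (fun k => qdot c (u k)) n.
Proof.
  induction n as [|n IH]; [now rewrite qsum_0, rsum_0|].
  rewrite qsum_S, rsum_S, <- IH. generalize (qsum u n) (u (S n)); qring.
Qed.

Lemma is_series_qdot (c : quat) (u : nat -> quat) (l : quat) :
  is_series u l -> is_series (fun n => qdot c (u n)) (qdot c l).
Proof.
  intros H. apply is_series_qlim in H. apply (qlim_qdot c) in H.
  apply (is_lim_seq_ext _ (sum_n (fun n => qdot c (u n)))) in H; [exact H|].
  intro n. apply qdot_qsum.
Qed.

Lemma qnorm_le_components (q : quat) :
  qnorm q <= Rabs (qdot ((1, 0), (0, 0)) q) + Rabs (qdot ((0, 1), (0, 0)) q) +
             Rabs (qdot ((0, 0), (1, 0)) q) + Rabs (qdot ((0, 0), (0, 1)) q).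
Proof.
  destruct q as [[a b] [c d]].
  replace (qdot (1, 0, (0, 0)) (a, b, (c, d))) with a by (cbn; ring).
  replace (qdot (0, 1, (0, 0)) (a, b, (c, d))) with b by (cbn; ring).
  replace (qdot (0, 0, (1, 0)) (a, b, (c, d))) with c by (cbn; ring).
  replace (qdot (0, 0, (0, 1)) (a, b, (c, d))) with d by (cbn; ring).
  assert (Pa := Rabs_pos a). assert (Pb := Rabs_pos b).
  assert (Pc := Rabs_pos c). assert (Pd := Rabs_pos d). unfold qnorm.
  set (t := Rabs a + Rabs b + Rabs c + Rabs d).
  rewrite <- (sqrt_Rsqr t) by (unfold t; lra). apply sqrt_le_1_alt.
  rewrite <- (pow2_abs a), <- (pow2_abs b), <- (pow2_abs c), <- (pow2_abs d).
  unfold t, Rsqr. nra.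
Qed.

(** Completeness is inherited from the four real components. *)
Lemma ex_series_qnorm (u : nat -> quat) :
  ex_series (fun n => qnorm (u n)) -> exists l : quat, is_series u l.
Proof.
  intros H.
  assert (Hc : forall c, qnorm c = 1 -> ex_series (fun n => qdot c (u n))).
  { intros c Hc. apply (ex_series_le (V := R_CompleteNormedModule) _ (fun n => qnorm (u n))); [|easy].
    intro n. unfold norm; cbn; unfold abs; cbn.
    eapply Rle_trans; [apply qdot_bound|]. rewrite Hc; lra. }
  set (e1 := ((1,0),(0,0)) : quat). set (e2 := ((0,1),(0,0)) : quat).
  set (e3 := ((0,0),(1,0)) : quat). set (e4 := ((0,0),(0,1)) : quat).
  assert (He : forall e, e = e1 \/ e = e2 \/ e = e3 \/ e = e4 -> qnorm e = 1).
  { intros e [-> | [-> | [-> | ->]]]; rewrite qnorm_qnsq;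
    (replace (qnsq _) with 1 by (cbn; ring)); apply sqrt_1. }
  destruct (Hc e1) as [l1 H1]; [apply He; tauto|].
  destruct (Hc e2) as [l2 H2]; [apply He; tauto|].
  destruct (Hc e3) as [l3 H3]; [apply He; tauto|].
  destruct (Hc e4) as [l4 H4]; [apply He; tauto|].
  exists ((l1, l2), (l3, l4)). apply is_series_qlim.
  assert (L : forall c l, is_series (fun n => qdot c (u n)) l ->
    is_lim_seq (fun n => Rabs (qdot c (qsum u n) - l)) 0).
  { intros c l Hl. apply -> is_lim_seq_abs_0.
    replace (Finite 0) with (Finite (l - l)) by (f_equal; ring).
    apply is_lim_seq_minus'; [|apply is_lim_seq_const].
    apply (is_lim_seq_ext (sum_n (fun n => qdot c (u n)))); [|exact Hl].
    intro n. symmetry. apply qdot_qsum. }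
  apply L in H1; apply L in H2; apply L in H3; apply L in H4.
  apply (is_lim_seq_squeeze0 _ (fun n => Rabs (qdot e1 (qsum u n) - l1) + Rabs (qdot e2 (qsum u n) - l2)
    + (Rabs (qdot e3 (qsum u n) - l3) + Rabs (qdot e4 (qsum u n) - l4)))).
  - intro n; split; [apply qnorm_ge0|].
    eapply Rle_trans; [apply qnorm_le_components|]. fold e1 e2 e3 e4.
    assert (M : forall e (x y : quat), qdot e (x - y)%quat = qdot e x - qdot e y) by qring.
    rewrite !M.
    assert (M1 : forall a b c d, qdot e1 ((a, b), (c, d)) = a) by (intros; cbn; ring).
    assert (M2 : forall a b c d, qdot e2 ((a, b), (c, d)) = b) by (intros; cbn; ring).
    assert (M3 : forall a b c d, qdot e3 ((a, b), (c, d)) = c) by (intros; cbn; ring).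
    assert (M4 : forall a b c d, qdot e4 ((a, b), (c, d)) = d) by (intros; cbn; ring).
    rewrite M1, M2, M3, M4.
    lra.
  - replace (Finite 0) with (Finite (0 + 0 + (0 + 0))) by (f_equal; ring).
    repeat apply is_lim_seq_plus'; easy.
Qed.

(** * Power series *)

(** Absolute convergence of the power series throughout the unit ball. *)
Definition summable (a : nat -> quat) : Prop :=
  forall r, 0 <= r < 1 -> ex_series (fun m => qnorm (a m) * r ^ m).

Lemma summable_abs (a : nat -> quat) (q : quat) :
  summable a -> unit_ball q -> ex_series (fun m => qnorm (qpow q m * a m)%quat).
Proof.
  intros Ha Hq. eapply ex_series_ext; [|apply (Ha (qnorm q))].
  - intro m. cbn beta. rewrite qnorm_mul, qnorm_pow. apply Rmult_comm.
  - split; [apply qnorm_ge0|exact Hq].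
Qed.

Lemma summable_ex (a : nat -> quat) (q : quat) :
  summable a -> unit_ball q -> exists l, is_qseries a q l.
Proof. intros Ha Hq. apply ex_series_qnorm. now apply summable_abs. Qed.

Lemma is_qseries_unique (a : nat -> quat) (q l : quat) :
  is_qseries a q l -> qseries a q = l.
Proof.
  intros H. unfold qseries.
  assert (H' := epsilon_spec (inhabits (qreal 0)) (is_qseries a q) (ex_intro _ l H)).
  apply is_series_qlim in H, H'. eapply qlim_unique; eassumption.
Qed.

Lemma qseries_correct (a : nat -> quat) (q : quat) :
  summable a -> unit_ball q -> is_qseries a q (qseries a q).
Proof.
  intros Ha Hq. destruct (summable_ex a q Ha Hq) as [l Hl].
  now rewrite (is_qseries_unique _ _ _ Hl).
Qed.

Lemma unit_ball_real (x : R) : Rabs x < 1 -> unit_ball (qreal x).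
Proof. unfold unit_ball. now rewrite qnorm_real. Qed.

Lemma qpow_real (x : R) (n : nat) : qpow (qreal x) n = qreal (x ^ n).
Proof.
  induction n as [|n IH]; [reflexivity|]. cbn [qpow pow]. now rewrite IH, qreal_mul.
Qed.

Lemma qdot_real_mul (c : quat) (x : R) (q : quat) : qdot c (qreal x * q) = x * qdot c q.
Proof. qring. Qed.

Lemma is_series_terms_bounded (u : nat -> quat) (l : quat) :
  is_series u l -> exists C, forall n, qnorm (u n) <= C.
Proof.
  intros H. 
  assert (Hc : forall c, exists C, forall n, Rabs (qdot c (u n)) <= C).
  { intro c. apply (is_series_qdot c) in H.
    assert (E : ex_series (fun n => qdot c (u n))) by (eexists; exact H).
    apply ex_series_lim_0 in E.
    destruct (filterlim_bounded (fun n => qdot c (u n))) as [C HC].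
    { exists 0. exact E. }
    exists C. exact HC. }
  destruct (Hc ((1,0),(0,0))) as [C1 H1], (Hc ((0,1),(0,0))) as [C2 H2],
   (Hc ((0,0),(1,0))) as [C3 H3], (Hc ((0,0),(0,1))) as [C4 H4].
  exists (C1 + C2 + C3 + C4). intro n.
  specialize (H1 n); specialize (H2 n); specialize (H3 n); specialize (H4 n).
  eapply Rle_trans; [apply qnorm_le_components|]. lra.
Qed.

(** Passing from [r] to the larger radius [(1 + r) / 2] leaves a convergent
    geometric factor. *)
Lemma summable_of_bounded (a : nat -> quat) :
  (forall r, 0 <= r < 1 -> exists C, forall m, qnorm (a m) * r ^ m <= C) -> summable a.
Proof.
  intros H r Hr. set (s := (1 + r) / 2).
  destruct (H s) as [C HC]; [unfold s; lra|].
  assert (Hs : 0 < s < 1) by (unfold s; lra).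
  apply (ex_series_le (V := R_CompleteNormedModule) _ (fun m => C * (r / s) ^ m)).
  - intro m. unfold norm; cbn; unfold abs; cbn.
    rewrite Rabs_pos_eq by (apply Rmult_le_pos; [apply qnorm_ge0|apply pow_le; lra]).
    replace (qnorm (a m) * r ^ m) with ((qnorm (a m) * s ^ m) * (r / s) ^ m).
    + apply Rmult_le_compat_r; [|apply HC]. apply pow_le, Rdiv_le_0_compat; lra.
    + rewrite Rmult_assoc, <- Rpow_mult_distr. do 2 f_equal. field. lra.
  - apply (ex_series_scal_l (V := R_NormedModule) C). apply ex_series_geom.
    rewrite Rabs_pos_eq by (apply Rdiv_le_0_compat; lra).
    apply (Rmult_lt_reg_r s); [lra|]. unfold Rdiv; rewrite Rmult_assoc, Rinv_l by lra.
    unfold s; lra.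
Qed.

Lemma summable_of_convergent (a : nat -> quat) :
  (forall q, unit_ball q -> exists l, is_qseries a q l) -> summable a.
Proof.
  intros H. apply summable_of_bounded. intros r Hr.
  destruct (H (qreal r)) as [l Hl]; [apply unit_ball_real; rewrite Rabs_pos_eq; lra|].
  apply is_series_terms_bounded in Hl. destruct Hl as [C HC]. exists C. intro m.
  eapply Rle_trans; [|apply (HC m)]. rewrite qnorm_mul, qnorm_pow, qnorm_real, (Rabs_pos_eq r) by lra.
  lra.
Qed.

(** At real points the functionals [qdot c] give real power series, for which
    uniqueness is known.  Only real points are involved, so this compares
    expansions obtained on different slices. *)
Lemma is_qseries_coeffs_unique (a b : nat -> quat) (f : quat -> quat) (d : R) :
  0 < d ->
  (forall x, Rabs x < d -> is_qseries a (qreal x) (f (qreal x))) ->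
  (forall x, Rabs x < d -> is_qseries b (qreal x) (f (qreal x))) -> a = b.
Proof.
  intros Hd Ha Hb. apply functional_extensionality; intro n. apply qdot_ext; intro c.
  assert (P : forall a, (forall x, Rabs x < d -> is_qseries a (qreal x) (f (qreal x))) ->
    forall x, Rabs x < d -> is_pseries (fun m => qdot c (a m)) x (qdot c (f (qreal x)))).
  { intros a' Ha' x Hx. specialize (Ha' x Hx). apply (is_series_qdot c) in Ha'.
    eapply is_series_ext; [|exact Ha']. intro m. cbn beta.
    rewrite qpow_real, qdot_real_mul, <- (pow_n_pow x m). reflexivity. }
  assert (RR : forall a, (forall x, Rabs x < d -> is_qseries a (qreal x) (f (qreal x))) ->
    Rbar_lt 0 (CV_radius (fun m => qdot c (a m)))).
  { intros a' Ha'. apply Rbar_lt_le_trans with (d / 2); [cbn; lra|].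
    apply Rbar_not_lt_le. intro Hlt.
    apply (CV_disk_outside (fun m => qdot c (a' m)) (d / 2)); [rewrite Rabs_pos_eq by lra; exact Hlt|].
    assert (E : ex_pseries (fun m => qdot c (a' m)) (d / 2)).
    { eexists. apply P; [exact Ha'|]. rewrite Rabs_pos_eq; lra. }
    apply ex_series_lim_0 in E. eapply is_lim_seq_ext; [|exact E].
    intro m. rewrite <- (pow_n_pow (d / 2) m). apply Rmult_comm. }
  apply (PSeries_ext_recip (fun m => qdot c (a m)) (fun m => qdot c (b m))); auto.
  exists (mkposreal d Hd). intros x Hx.
  assert (Hx' : Rabs x < d).
  { unfold ball in Hx; cbn in Hx; unfold AbsRing_ball, abs, minus, plus, opp in Hx; cbn in Hx.
    now rewrite Ropp_0, Rplus_0_r in Hx. }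
  rewrite (is_pseries_unique _ _ _ (P a Ha x Hx')).
  now rewrite (is_pseries_unique _ _ _ (P b Hb x Hx')).
Qed.

Lemma coeffs_eq (f : quat -> quat) (a : nat -> quat) :
  (forall q, unit_ball q -> is_qseries a q (f q)) -> coeffs f = a.
Proof.
  intros Ha. unfold coeffs.
  assert (H := epsilon_spec (inhabits (fun _ : nat => qreal 0))
    (fun a => forall q, unit_ball q -> is_qseries a q (f q)) (ex_intro _ a Ha)).
  cbv beta in H. apply (is_qseries_coeffs_unique _ _ f 1 Rlt_0_1); intros x Hx.
  - apply H; now apply unit_ball_real.
  - apply Ha; now apply unit_ball_real.
Qed.

(** Partial sums of a convolution are convolutions with partial sums. *)
Lemma qsum_triangle (F : nat -> nat -> quat) (n : nat) :
  qsum (fun m => qsum (fun l => F l (m - l)%nat) m) n =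
  qsum (fun l => qsum (F l) (n - l)) n.
Proof.
  induction n as [|n IH].
  - now rewrite !qsum_0.
  - rewrite qsum_S, IH, (qsum_S _ n), (qsum_S (fun l => qsum (F l) _)).
    rewrite Nat.sub_diag, qsum_0.
    rewrite (qsum_ext (fun l => qsum (F l) (S n - l)) (fun l => qsum (F l) (n - l) + F l (S n - l)%nat)%quat).
    + rewrite qsum_plus. apply plus_assoc.
    + intros k Hk. rewrite Nat.sub_succ_l by easy. apply qsum_S.
Qed.

Lemma rsum_triangle (F : nat -> nat -> R) (n : nat) :
  rsum (fun m => rsum (fun l => F l (m - l)%nat) m) n =
  rsum (fun l => rsum (F l) (n - l)) n.
Proof.
  induction n as [|n IH].
  - now rewrite !rsum_0.
  - rewrite rsum_S, IH, (rsum_S _ n), (rsum_S (fun l => rsum (F l) _)).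
    rewrite Nat.sub_diag, rsum_0.
    rewrite (rsum_ext (fun l => rsum (F l) (S n - l)) (fun l => rsum (F l) (n - l) + F l (S n - l)%nat)).
    + rewrite rsum_plus. ring.
    + intros k Hk. rewrite Nat.sub_succ_l by easy. apply rsum_S.
Qed.

(** The expression is the difference between the product of [X] with a partial sum
    of [y] and a partial sum of the Cauchy product; both have the same limit. *)
Lemma tail_conv_lim (x y : nat -> R) (X : R) :
  (forall n, 0 <= x n) -> (forall n, 0 <= y n) -> is_series x X -> ex_series y ->
  is_lim_seq (fun n => rsum (fun l => y l * (X - rsum x (n - l))) n) 0.
Proof.
  intros Hx Hy HX [Y HY].
  assert (HC : is_series (fun n => sum_f_R0 (fun k => y k * x (n - k)%nat) n) (Y * X)).
  { apply is_series_mult; auto.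
    - exists Y. eapply is_series_ext; [|exact HY]. intro n. now rewrite Rabs_pos_eq.
    - exists X. eapply is_series_ext; [|exact HX]. intro n. now rewrite Rabs_pos_eq. }
  apply is_lim_seq_ext with
    (fun n => X * rsum y n - rsum (fun m => sum_f_R0 (fun k => y k * x (m - k)%nat) m) n).
  - intro n.
    rewrite (rsum_ext (fun m => sum_f_R0 (fun k => y k * x (m - k)%nat) m)
      (fun m => rsum (fun l => y l * x (m - l)%nat) m))
      by (intros m _; symmetry; apply (sum_n_Reals (fun l => y l * x (m - l)%nat))).
    rewrite (rsum_triangle (fun l j => y l * x j)).
    rewrite (rsum_ext (fun l => y l * (X - rsum x (n - l)))
      (fun l => X * y l + (-1) * rsum (fun j => y l * x j) (n - l))).
    + rewrite rsum_plus, !rsum_mul_l. ring.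
    + intros k _. rewrite rsum_mul_l. ring.
  - replace (Finite 0) with (Finite (X * Y - Y * X)) by (f_equal; ring).
    apply is_lim_seq_minus'.
    + replace (Finite (X * Y)) with (Rbar_mult X Y) by reflexivity.
      apply is_lim_seq_scal_l. exact HY.
    + exact HC.
Qed.

Lemma qnorm_series_tail (u : nat -> quat) (l : quat) (L : R) (n : nat) :
  is_series u l -> is_series (fun k => qnorm (u k)) L ->
  qnorm (l - qsum u n)%quat <= L - rsum (fun k => qnorm (u k)) n.
Proof.
  intros Hu HL. apply is_series_qlim in Hu.
  apply (qlim_bound (fun m => qsum u m - qsum u n)%quat _
    (fun m => rsum (fun k => qnorm (u k)) m - rsum (fun k => qnorm (u k)) n)).
  - apply qlim_plus; [exact Hu|apply qlim_const].
  - apply is_lim_seq_minus'; [exact HL|apply is_lim_seq_const].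
  - exists n. intros m Hm. induction Hm as [|m Hm IH].
    + replace (qsum u n - qsum u n)%quat with (qreal 0) by qring.
      rewrite qnorm_real, Rabs_R0. lra.
    + rewrite qsum_S, rsum_S.
      replace (qsum u m + u (S m) - qsum u n)%quat with ((qsum u m - qsum u n) + u (S m))%quat
        by (generalize (qsum u m) (qsum u n); qring).
      eapply Rle_trans; [apply qnorm_triangle|]. lra.
Qed.

Lemma qpow_plus (q : quat) (m n : nat) : qpow q (m + n) = (qpow q m * qpow q n)%quat.
Proof.
  induction m as [|m IH]; cbn [Nat.add qpow].
  - now rewrite qmul_1l.
  - now rewrite IH, qmul_assoc.
Qed.

(** Star multiplication is not pointwise: the value [A] of the left factor has to
    be inserted between [p^l] and [b_l]. *)
Lemma conv_eval (a b : nat -> quat) (p A v : quat) :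
  summable a -> summable b -> unit_ball p -> is_qseries a p A ->
  is_series (fun l => qpow p l * (A * b l))%quat v ->
  is_qseries (conv a b) p v.
Proof.
  intros Ha Hb Hp HA Hv. apply is_series_qlim in Hv. apply is_series_qlim.
  set (x := fun j => (qpow p j * a j)%quat).
  assert (E : forall n, qsum (fun m => qpow p m * conv a b m)%quat n =
    qsum (fun l => qpow p l * (qsum x (n - l) * b l))%quat n).
  { intro n.
    rewrite (qsum_ext (fun l => qpow p l * (qsum x (n - l) * b l))%quat
      (fun l => qsum (fun j => qpow p l * (x j * b l))%quat (n - l))).
    - rewrite <- (qsum_triangle (fun l j => qpow p l * (x j * b l))%quat).
      apply qsum_ext. intros m _. unfold conv. rewrite <- qsum_mul_l.
      apply qsum_ext. intros l Hl. unfold x.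
      replace m with (l + (m - l))%nat at 1 by lia.
      now rewrite qpow_plus, !qmul_assoc.
    - intros l _. now rewrite qsum_mul_l, qsum_mul_r. }
  destruct (summable_abs a p Ha Hp) as [X HX].
  assert (Hy : ex_series (fun l => qnorm (qpow p l) * qnorm (b l))).
  { eapply ex_series_ext; [|apply (summable_abs b p Hb Hp)]. intro l; cbn beta. apply qnorm_mul. }
  assert (T := tail_conv_lim _ _ X (fun n => qnorm_ge0 _)
    (fun n => Rmult_le_pos _ _ (qnorm_ge0 (qpow p n)) (qnorm_ge0 (b n))) HX Hy).
  apply qlim_near with (2 := Hv).
  apply (is_lim_seq_squeeze0 _ _) with (2 := T).
  intro n; split; [apply qnorm_ge0|]. rewrite E.
  replace (qsum (fun l => qpow p l * (A * b l)) n - qsum (fun l => qpow p l * (qsum x (n - l) * b l)) n)%quat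
    with (qsum (fun l => qpow p l * ((A - qsum x (n - l)) * b l))%quat n).
  - eapply Rle_trans; [apply qnorm_qsum|]. apply rsum_le. intros l Hl. cbn beta.
    rewrite !qnorm_mul.
    assert (HT := qnorm_series_tail _ _ _ (n - l) HA HX). cbn beta in HT. fold x in HT.
    assert (P1 := qnorm_ge0 (qpow p l)). assert (P2 := qnorm_ge0 (b l)).
    assert (P3 := Rmult_le_pos _ _ P1 P2). unfold x in *. nra.
  - clear. unfold x; clear x. set (x := (fun j : nat => (qpow p j * a j)%quat)).
    replace (qsum (fun l => qpow p l * (A * b l))%quat n) with
      (qsum (fun l => qpow p l * ((A - qsum x (n - l)) * b l) + qpow p l * (qsum x (n - l) * b l))%quat n).
    + rewrite qsum_plus. set (u := qsum _ n). set (w := qsum _ n). clearbody u w. clear. qring.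
    + apply qsum_ext. intros l _. clear. qring.
Qed.

Lemma summable_conv (a b : nat -> quat) : summable a -> summable b -> summable (conv a b).
Proof.
  intros Ha Hb r Hr. destruct (Ha r Hr) as [X HX], (Hb r Hr) as [Y HY].
  assert (P : forall c m, 0 <= qnorm (c m) * r ^ m).
  { intros c m. apply Rmult_le_pos; [apply qnorm_ge0|apply pow_le; lra]. }
  assert (HC : is_series (fun n => sum_f_R0 (fun k => (qnorm (b k) * r ^ k) * (qnorm (a (n - k)%nat) * r ^ (n - k))) n) (Y * X)).
  { apply (is_series_mult (fun k => qnorm (b k) * r ^ k) (fun k => qnorm (a k) * r ^ k)); auto.
    - exists Y. eapply is_series_ext; [|exact HY]. intro n; cbn beta. rewrite Rabs_pos_eq; [easy|apply (P b)].
    - exists X. eapply is_series_ext; [|exact HX]. intro n; cbn beta. rewrite Rabs_pos_eq; [easy|apply (P a)]. }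
  eapply (ex_series_le (V := R_CompleteNormedModule)); [|eexists; exact HC].
  intro m. change (Rabs (qnorm (conv a b m) * r ^ m) <= 
    sum_f_R0 (fun k => (qnorm (b k) * r ^ k) * (qnorm (a (m - k)%nat) * r ^ (m - k))) m).
  rewrite Rabs_pos_eq by apply P. rewrite <- sum_n_Reals.
  change (qnorm (conv a b m) * r ^ m <=
    rsum (fun k => (qnorm (b k) * r ^ k) * (qnorm (a (m - k)%nat) * r ^ (m - k))) m).
  unfold conv. rewrite Rmult_comm.
  eapply Rle_trans; [apply Rmult_le_compat_l; [apply pow_le; lra|apply qnorm_qsum]|].
  rewrite <- rsum_mul_l. apply rsum_le. intros k Hk. rewrite qnorm_mul.
  replace m with (k + (m - k))%nat at 1 by lia. rewrite pow_add.
  apply Req_le. ring.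
Qed.

Lemma summable_conjs (a : nat -> quat) : summable a -> summable (conjs a).
Proof.
  intros Ha r Hr. eapply ex_series_ext; [|apply (Ha r Hr)].
  intro m. unfold conjs. now rewrite qnorm_conj.
Qed.

(** * Functions given by power series *)

Definition has_coeffs (f : quat -> quat) (a : nat -> quat) : Prop :=
  forall q, unit_ball q -> is_qseries a q (f q).

Lemma has_coeffs_summable (f : quat -> quat) (a : nat -> quat) : has_coeffs f a -> summable a.
Proof. intros H. apply summable_of_convergent. intros q Hq. exists (f q). now apply H. Qed.

Lemma has_coeffs_qseries (a : nat -> quat) : summable a -> has_coeffs (qseries a) a.
Proof. intros Ha q Hq. now apply qseries_correct. Qed.

Lemma has_coeffs_ext (f g : quat -> quat) (a : nat -> quat) :
  (forall q, unit_ball q -> f q = g q) -> has_coeffs f a -> has_coeffs g a.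
Proof. intros E H q Hq. rewrite <- E by easy. now apply H. Qed.

Lemma star_has_coeffs (f g : quat -> quat) (a b : nat -> quat) :
  has_coeffs f a -> has_coeffs g b -> has_coeffs (star f g) (conv a b).
Proof.
  intros Ha Hb. unfold star. rewrite (coeffs_eq f a Ha), (coeffs_eq g b Hb).
  apply has_coeffs_qseries, summable_conv; eapply has_coeffs_summable; eassumption.
Qed.

Lemma regular_conj_has_coeffs (f : quat -> quat) (a : nat -> quat) :
  has_coeffs f a -> has_coeffs (regular_conj f) (conjs a).
Proof.
  intros Ha. unfold regular_conj. rewrite (coeffs_eq f a Ha).
  apply has_coeffs_qseries, summable_conjs. eapply has_coeffs_summable; eassumption.
Qed.

Lemma plus_has_coeffs (f g : quat -> quat) (a b : nat -> quat) :
  has_coeffs f a -> has_coeffs g b ->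
  has_coeffs (fun q => f q + g q)%quat (fun m => a m + b m)%quat.
Proof.
  intros Ha Hb q Hq. unfold is_qseries. apply is_series_qlim.
  specialize (Ha q Hq). specialize (Hb q Hq). apply is_series_qlim in Ha, Hb.
  eapply qlim_ext; [|exact (qlim_plus _ _ _ _ Ha Hb)].
  intro n. cbn beta. rewrite <- qsum_plus. apply qsum_ext. intros m _. symmetry. apply qmul_plus_r.
Qed.

Lemma affine_has_coeffs (c d : quat) : has_coeffs (fun q => c + q * d)%quat (affine c d).
Proof.
  intros q Hq. apply is_series_qlim.
  apply (qlim_near (fun _ => c + q * d)%quat); [|apply qlim_const].
  apply is_lim_seq_incr_1.
  apply is_lim_seq_ext with (fun _ => 0); [|apply is_lim_seq_const].
  intro n.
  replace (qsum (fun m => qpow q m * affine c d m)%quat (S n)) with (c + q * d)%quat.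
  - replace (c + q * d - (c + q * d))%quat with (qreal 0) by (clear; qring).
    now rewrite qnorm_real, Rabs_R0.
  - induction n as [|n IH].
    + rewrite qsum_S, qsum_0. cbn [qpow affine]. clear. qring.
    + rewrite qsum_S, <- IH. cbn [affine]. rewrite qmul_0r. clear. qring.
Qed.

(** Real coefficients are central; comparing with the conjugate of the convolution
    exchanges the factors. *)
Lemma conv_real_comm (s b : nat -> quat) :
  (forall m, exists x, s m = qreal x) -> conv s b = conv b s.
Proof.
  intros Rs.
  transitivity (conjs (conv s (conjs b))).
  - apply functional_extensionality; intro m. unfold conjs, conv.
    assert (C : forall u n, qconj (qsum u n) = qsum (fun k => qconj (u k)) n).
    { intros u n. induction n as [|n IH]; [now rewrite !qsum_0|].
      now rewrite !qsum_S, qconj_plus, IH. }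
    rewrite C. apply qsum_ext. intros k _. destruct (Rs (m - k)%nat) as [x ->].
    now rewrite qconj_mul, qconj_invol, qconj_real, qmul_real.
  - rewrite conv_conj. f_equal; apply functional_extensionality; intro m; unfold conjs.
    + apply qconj_invol.
    + destruct (Rs m) as [x ->]. apply qconj_real.
Qed.

(** For [s] the coefficients of the symmetrization, [s * e = conj(a)] and
    [s * (e * conj(e)) = 1].  As [s] is real, star multiplication by [s] is
    pointwise, so the second equation shows that the symmetrization has no zeros
    in the ball and the first one that [e] gives the reciprocal. *)
Lemma star_inv_has_coeffs (f : quat -> quat) (a e : nat -> quat) :
  has_coeffs f a -> summable e -> conv a e = delta -> conv e a = delta ->
  has_coeffs (star_inv f) e.
Proof.
  intros Ha He Hae Hea.
  assert (Ba := has_coeffs_summable _ _ Ha).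
  set (s := conv a (conjs a)).
  assert (Bs : summable s) by now apply summable_conv, summable_conjs.
  assert (Hs : has_coeffs (symmetrization f) s).
  { exact (star_has_coeffs f (regular_conj f) a (conjs a) Ha (regular_conj_has_coeffs f a Ha)). }
  (* [s] is its own conjugate *)
  assert (Rs : forall m, exists x, s m = qreal x).
  { intro m. assert (Es : conjs s m = s m).
    { unfold s. rewrite conv_conj. f_equal. apply functional_extensionality; intro.
      apply qconj_invol. }
    unfold conjs in Es. destruct (s m) as [[x1 x2] [x3 x4]]. cbn in Es.
    exists x1. unfold qreal. injection Es. intros. repeat f_equal; lra. }
  assert (Hca : conv (conjs e) (conjs a) = delta).
  { rewrite <- conv_conj, Hae. apply functional_extensionality; intros [|[|m]]; unfold conjs; apply qconj_real. }
  assert (Hac : conv (conjs a) (conjs e) = delta).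
  { rewrite <- conv_conj, Hea. apply functional_extensionality; intros [|[|m]]; unfold conjs; apply qconj_real. }
  assert (Eval : forall b q, unit_ball q -> summable b ->
    is_qseries (conv s b) q (symmetrization f q * qseries b q)%quat).
  { intros b q Hq Bb. apply conv_eval with (symmetrization f q); auto.
    assert (C : forall l, (qpow q l * symmetrization f q = symmetrization f q * qpow q l)%quat).
    { intro l. assert (H1 := Hs q Hq). unfold is_qseries in H1. apply is_series_qlim in H1.
      apply (qlim_unique (fun n => qpow q l * qsum (fun m => qpow q m * s m)%quat n)%quat).
      - now apply qlim_mul_l.
      - apply (qlim_ext (fun n => qsum (fun m => qpow q m * s m)%quat n * qpow q l)%quat);
          [|now apply qlim_mul_r].
        intro n. rewrite <- qsum_mul_l, <- qsum_mul_r.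
        apply qsum_ext. intros k _. destruct (Rs k) as [x ->]. rewrite !qmul_assoc, <- qpow_plus, Nat.add_comm, qpow_plus.
          rewrite <- !qmul_assoc, <- qmul_real. reflexivity. }
    apply is_series_qlim.
    assert (H1 := qseries_correct b q Bb Hq). unfold is_qseries in H1. apply is_series_qlim in H1.
    apply (qlim_mul_l (symmetrization f q)) in H1.
    eapply qlim_ext; [|exact H1]. intro n. cbn beta.
    rewrite <- qsum_mul_l. apply qsum_ext. intros k _. now rewrite !qmul_assoc, C. }
  assert (Hse : conv s e = conjs a).
  { rewrite conv_real_comm by exact Rs. unfold s. now rewrite <- conv_assoc, Hea, conv_delta_l. }
  assert (Hsee : conv s (conv e (conjs e)) = delta) by now rewrite <- conv_assoc, Hse.
  intros q Hq.
  assert (E1 : (symmetrization f q * qseries e q = regular_conj f q)%quat).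
  { assert (H1 := Eval e q Hq He). rewrite Hse in H1.
    assert (H2 := regular_conj_has_coeffs f a Ha q Hq).
    apply is_qseries_unique in H1, H2. congruence. }
  assert (E2 : (symmetrization f q * qseries (conv e (conjs e)) q = qreal 1)%quat).
  { assert (H1 := Eval _ q Hq (summable_conv _ _ He (summable_conjs _ He))). rewrite Hsee in H1.
    assert (H2 := affine_has_coeffs (qreal 1) (qreal 0) q Hq).
    apply is_qseries_unique in H1, H2. rewrite <- H1. unfold delta, const. rewrite H2.
    clear; qring. }
  unfold star_inv. rewrite <- E1, qmul_assoc, qinv_l, qmul_1l.
  - now apply qseries_correct.
  - intros E0. rewrite E0, qmul_0l in E2. injection E2. lra.
Qed.

Lemma mul_l_has_coeffs_real (x : R) (f : quat -> quat) (a : nat -> quat) :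
  has_coeffs f a -> has_coeffs (fun q => qreal x * f q)%quat (fun m => qreal x * a m)%quat.
Proof.
  intros Ha q Hq. specialize (Ha q Hq). unfold is_qseries in *.
  apply is_series_qlim in Ha. apply is_series_qlim.
  apply (qlim_mul_l (qreal x)) in Ha. eapply qlim_ext; [|exact Ha].
  intro n. cbn beta. rewrite <- qsum_mul_l. apply qsum_ext. intros m _.
  now rewrite !qmul_assoc, qmul_real.
Qed.

(** * Schur sequences *)

Definition sqsum (c : nat -> quat) (n : nat) : R := rsum (fun m => qnsq (c m)) n.

(** Contractivity of the lower triangular Toeplitz matrices of [a], that is, of star
    multiplication by [a] on the Hardy space. *)
Definition schur (a : nat -> quat) : Prop :=
  forall c n, sqsum (conv a c) n <= sqsum c n.

Lemma sqsum_0 (c : nat -> quat) : sqsum c 0 = qnsq (c 0%nat).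
Proof. apply rsum_0. Qed.

Lemma sqsum_S (c : nat -> quat) (n : nat) : sqsum c (S n) = sqsum c n + qnsq (c (S n)).
Proof. apply rsum_S. Qed.

Lemma sqsum_ge_term (c : nat -> quat) (n : nat) : qnsq (c n) <= sqsum c n.
Proof.
  destruct n as [|n]; [rewrite sqsum_0; lra|]. rewrite sqsum_S.
  assert (0 <= sqsum c n) by (apply rsum_ge0; intro; apply qnsq_ge0). lra.
Qed.

Lemma sqsum_delta (n : nat) : sqsum delta n = 1.
Proof.
  induction n as [|n IH].
  - rewrite sqsum_0. cbn. ring.
  - rewrite sqsum_S, IH. replace (delta (S n)) with (qreal 0) by (now destruct n).
    rewrite qnsq_real. ring.
Qed.

Lemma sqsum_incr (c : nat -> quat) (n m : nat) : (n <= m)%nat -> sqsum c n <= sqsum c m.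
Proof.
  induction 1 as [|m Hm IH]; [lra|]. rewrite sqsum_S. generalize (qnsq_ge0 (c (S m))). lra.
Qed.

Lemma schur_le1 (a : nat -> quat) : schur a -> qnorm (a 0%nat) <= 1.
Proof.
  intros H. assert (H0 := H delta 0%nat). rewrite conv_delta_r, sqsum_delta, sqsum_0 in H0.
  rewrite qnorm_qnsq, <- sqrt_1. now apply sqrt_le_1_alt.
Qed.

Lemma geom_sum_le (x : R) (n : nat) : 0 <= x < 1 -> rsum (fun m => x ^ m) n <= / (1 - x).
Proof.
  intros Hx. unfold rsum. rewrite sum_n_Reals, tech3 by lra. unfold Rdiv.
  rewrite <- (Rmult_1_l (/ (1 - x))) at 2.
  apply Rmult_le_compat_r; [left; apply Rinv_0_lt_compat; lra|].
  assert (0 <= x ^ S n) by (apply pow_le; lra). lra.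
Qed.

Lemma qpow_comm (q : quat) (n : nat) : (q * qpow q n = qpow q n * q)%quat.
Proof.
  induction n as [|n IH]; cbn [qpow].
  - now rewrite qmul_1l, qmul_1r.
  - now rewrite IH, qmul_assoc, <- IH.
Qed.

Lemma qpow_conj (q : quat) (n : nat) : qpow (qconj q) n = qconj (qpow q n).
Proof.
  induction n as [|n IH].
  - symmetry; apply qconj_real.
  - cbn [qpow]. rewrite IH, <- qconj_mul. f_equal. symmetry. apply qpow_comm.
Qed.

Lemma qnsq_pow (q : quat) (n : nat) : qnsq (qpow q n) = qnsq q ^ n.
Proof.
  induction n as [|n IH]; cbn [qpow pow].
  - rewrite qnsq_real. ring.
  - now rewrite qnsq_mul, IH.
Qed.

(** Bounds the square norm of a kernel [sum_m q^m conj(p)^m], multiplied by [v] and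
    perturbed by [k] in its first entry. *)
Lemma sqsum_geom_le (k v p : quat) (n : nat) : unit_ball p ->
  sqsum (fun m => const k m + v * qpow (qconj p) m)%quat n <=
  qnsq (k + v)%quat - qnsq v + qnsq v * / (1 - qnsq p).
Proof.
  intros Hp. assert (Hp' := unit_ball_qnsq p Hp).
  assert (E : sqsum (fun m => const k m + v * qpow (qconj p) m)%quat n =
    qnsq (k + v)%quat - qnsq v + qnsq v * rsum (fun m => qnsq p ^ m) n).
  { induction n as [|n IH].
    - rewrite sqsum_0, rsum_0. cbn [const affine qpow pow]. rewrite qmul_1r. ring.
    - rewrite sqsum_S, rsum_S, IH.
      replace (const k (S n)) with (qreal 0) by (now destruct n).
      replace (qreal 0 + v * qpow (qconj p) (S n))%quat with (v * qpow (qconj p) (S n))%quat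
        by (clear; qring).
      rewrite qnsq_mul, qnsq_pow, qnsq_conj. ring. }
  rewrite E. assert (G := geom_sum_le (qnsq p) n Hp'). assert (Hv := qnsq_ge0 v). nra.
Qed.

(** Positivity of the Pick matrix at the points [0] and [p].  For the multiplication
    [T] by [g], the adjoint maps [x], a combination of the kernels of [0] and [p],
    to the explicit sequence [c], so [<x, T c> = |c|^2]; with
    [2 <x, T c> <= |x|^2 + |T c|^2 <= |x|^2 + |c|^2] this gives [|c|^2 <= |x|^2]. *)
Lemma schur_form (g : nat -> quat) (p v k : quat) :
  schur g -> summable g -> unit_ball p -> is_qseries g p v ->
  qnsq (g 0%nat) * qnsq k + 2 * qdot (qreal 1) (v * qconj (g 0%nat) * k)%quat + qnsq v * / (1 - qnsq p)
  <= qnsq k + 2 * qdot (qreal 1) k + / (1 - qnsq p).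
Proof.
  intros Hg Bg Hp Hv.
  assert (Hp' := unit_ball_qnsq p Hp).
  set (k' := (qconj (g 0%nat) * k)%quat).
  set (c := fun m => (const k' m + qconj v * qpow (qconj p) m)%quat).
  set (x := fun m => (const k m + qreal 1 * qpow (qconj p) m)%quat).
  set (y := conv g c).
  assert (Bc : summable c).
  { apply summable_of_bounded. intros r Hr. exists (qnorm k' + qnorm (qconj v)). intro m.
    assert (H1 : qnorm (const k' m) * r ^ m <= qnorm k').
    { destruct m as [|[|m]]; cbn [const affine pow];
        rewrite ?qnorm_real, ?Rabs_R0; generalize (qnorm_ge0 k'); lra. }
    assert (H2 : qnorm (qconj v * qpow (qconj p) m) * r ^ m <= qnorm (qconj v)).
    { rewrite qnorm_mul, qnorm_pow, !qnorm_conj, Rmult_assoc, <- Rpow_mult_distr.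
      rewrite <- (Rmult_1_r (qnorm v)) at 2.
      apply Rmult_le_compat_l; [apply qnorm_ge0|].
      rewrite <- (pow1 m). apply pow_incr. unfold unit_ball in Hp. generalize (qnorm_ge0 p). nra. }
    unfold c. assert (H3 := qnorm_triangle (const k' m) (qconj v * qpow (qconj p) m)%quat).
    assert (0 <= r ^ m) by (apply pow_le; lra). nra. }
  assert (Hy : is_qseries y p (v * k' + qreal (qnsq v * / (1 - qnsq p)))%quat).
  { apply conv_eval with v; auto. apply is_series_qlim.
    apply (qlim_ext (fun n => v * k' + qreal (qnsq v * rsum (fun m => qnsq p ^ m) n))%quat).
    - induction n as [|n IH].
      + rewrite qsum_0, rsum_0. unfold c. cbn [const affine qpow pow].
        clear. generalize k'. qring.
      + rewrite qsum_S, <- IH, rsum_S. unfold c.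
        replace (const k' (S n)) with (qreal 0) by (now destruct n).
        replace (qreal 0 + qconj v * qpow (qconj p) (S n))%quat with (qconj v * qpow (qconj p) (S n))%quat
          by (clear; qring).
        rewrite (qmul_assoc v), qmul_conj_r, qpow_conj, qmul_assoc, qmul_real, <- qmul_assoc, qmul_conj_r.
        rewrite qreal_mul, qnsq_pow, <- plus_assoc.
        f_equal. transitivity (qreal (qnsq v * rsum (fun m : nat => qnsq p ^ m) n + qnsq v * qnsq p ^ S n)).
        * f_equal. ring.
        * symmetry. apply qreal_plus.
    - apply qlim_plus; [apply qlim_const|].
      apply (is_lim_seq_squeeze0 _ (fun n => qnsq v * Rabs (rsum (fun m => qnsq p ^ m) n - / (1 - qnsq p)))).
      + intro n; split; [apply qnorm_ge0|].
        assert (D : forall x y z, (qreal (x * y) - qreal (x * z) = qreal (x * (y - z)))%quat)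
          by (clear; qring).
        rewrite D, qnorm_real, Rabs_mult, (Rabs_pos_eq (qnsq v)) by apply qnsq_ge0. lra.
      + replace (Finite 0) with (Rbar_mult (qnsq v) 0) by (cbn; f_equal; ring).
        apply is_lim_seq_scal_l. apply -> is_lim_seq_abs_0.
        replace (Finite 0) with (Finite (/ (1 - qnsq p) - / (1 - qnsq p))) by (f_equal; ring).
        apply is_lim_seq_minus'; [|apply is_lim_seq_const].
        apply (is_series_geom (qnsq p)). rewrite Rabs_pos_eq; lra. }
  set (X := qnsq (k + qreal 1)%quat - qnsq (qreal 1) + qnsq (qreal 1) * / (1 - qnsq p)).
  set (C := qnsq (k' + qconj v)%quat - qnsq (qconj v) + qnsq (qconj v) * / (1 - qnsq p)).
  assert (Hfin : forall n, 2 * (qdot k (y 0%nat) + qdot (qreal 1) (qsum (fun m => qpow p m * y m)%quat n)) <= X + C).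
  { intro n.
    assert (E : qdot k (y 0%nat) + qdot (qreal 1) (qsum (fun m => qpow p m * y m)%quat n) = rsum (fun m => qdot (x m) (y m)) n).
    { induction n as [|n IH].
      - rewrite qsum_0, rsum_0. unfold x. cbn [const affine qpow]. generalize (y 0%nat). clear. qring.
      - rewrite qsum_S, rsum_S, <- IH. unfold x. 
        replace (const k (S n)) with (qreal 0) by (now destruct n).
        rewrite qpow_conj.
        generalize (qsum (fun m : nat => (qpow p m * y m)%quat) n) (y (S n)) (y 0%nat) (qpow p (S n)).
        clear. qring. }
    rewrite E.
    assert (H1 : 2 * rsum (fun m => qdot (x m) (y m)) n <= sqsum x n + sqsum y n).
    { unfold sqsum. rewrite <- rsum_plus, <- rsum_mul_l. apply rsum_le. intros m _.
      generalize (qnsq_ge0 (x m - y m)%quat).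
      replace (qnsq (x m - y m)%quat) with (qnsq (x m) + qnsq (y m) - 2 * qdot (x m) (y m)); [lra|].
      generalize (x m) (y m). clear. qring. }
    assert (H2 := Hg c n). fold y in H2.
    assert (H3 := sqsum_geom_le k (qreal 1) p n Hp). assert (H4 := sqsum_geom_le k' (qconj v) p n Hp).
    fold X in H3; fold C in H4; fold x in H3; fold c in H4. lra. }
  assert (Hlim : 2 * (qdot k (y 0%nat) + qdot (qreal 1) (v * k' + qreal (qnsq v * / (1 - qnsq p)))%quat) <= X + C).
  { apply is_series_qlim in Hy. apply (qlim_qdot (qreal 1)) in Hy.
    apply (is_lim_seq_le (fun n => 2 * (qdot k (y 0%nat) + qdot (qreal 1) (qsum (fun m => qpow p m * y m)%quat n)))
      (fun _ => X + C) (2 * (qdot k (y 0%nat) + qdot (qreal 1) (v * k' + qreal (qnsq v * / (1 - qnsq p)))%quat)) (X + C));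
      [exact Hfin| |apply is_lim_seq_const].
    apply (is_lim_seq_scal_l _ 2 (Finite _)). apply is_lim_seq_plus'; [apply is_lim_seq_const|exact Hy]. }
  assert (Ey : y 0%nat = (g 0%nat * (k' + qconj v))%quat).
  { unfold y, c. rewrite conv_0. cbn [const affine qpow]. now rewrite qmul_1r. }
  rewrite Ey in Hlim. unfold X, C, k' in Hlim. clear -Hlim.
  revert Hlim. generalize (g 0%nat) (/ (1 - qnsq p)). intros g0 s.
  replace (qdot k (g0 * (qconj g0 * k + qconj v))%quat) with
    (qnsq g0 * qnsq k + qdot (qreal 1) (v * qconj g0 * k)) by (clear; qring).
  replace (qdot (qreal 1) (v * (qconj g0 * k) + qreal (qnsq v * s))%quat) with
    (qdot (qreal 1) (v * qconj g0 * k) + qnsq v * s) by (clear; qring).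
  replace (qnsq (qconj g0 * k + qconj v)%quat) with
    (qnsq g0 * qnsq k + qnsq v + 2 * qdot (qreal 1) (v * qconj g0 * k)) by (clear; qring).
  replace (qnsq (k + qreal 1)%quat) with (qnsq k + 2 * qdot (qreal 1) k + 1) by (clear; qring).
  rewrite qnsq_conj, qnsq_real. intros. lra.
Qed.

(** The Pick condition for the points [0] and [p], after minimizing the quadratic
    form of [schur_form] in [k]. *)
Lemma schur_growth (g : nat -> quat) (p v : quat) :
  schur g -> summable g -> unit_ball p -> is_qseries g p v ->
  qnorm v <= (qnorm (g 0%nat) + qnorm p) / (1 + qnorm (g 0%nat) * qnorm p).
Proof.
  intros Hg Bg Hp Hv.
  assert (F := fun k => schur_form g p v k Hg Bg Hp Hv).
  set (A := qnorm (g 0%nat)). set (B := qnorm v). set (r := qnorm p).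
  assert (HA : 0 <= A <= 1) by (split; [apply qnorm_ge0|now apply schur_le1]).
  assert (HB : 0 <= B) by apply qnorm_ge0.
  assert (Hr : 0 <= r < 1) by (split; [apply qnorm_ge0|exact Hp]).
  assert (Hs : 0 < / (1 - qnsq p)).
  { apply Rinv_0_lt_compat. rewrite <- qnorm_sq. fold r. nra. }
  assert (HB1 : B <= 1).
  { assert (F0 := F (qreal 0)). rewrite qmul_0r, qnsq_real in F0.
    replace (qdot (qreal 1) (qreal 0)) with 0 in F0 by (cbn; ring).
    rewrite <- (qnorm_sq v) in F0. fold B in F0.
    assert (B ^ 2 <= 1).
    { apply (Rmult_le_reg_r (/ (1 - qnsq p))); lra. }
    nra. }
  assert (Hden : 0 < 1 + A * r) by nra.
  apply (Rmult_le_reg_r (1 + A * r)); [easy|].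
  unfold Rdiv; rewrite Rmult_assoc, Rinv_l, Rmult_1_r by lra.
  destruct (Req_dec A 1) as [E1|N1]; [rewrite E1 in *; nra|].
  set (w := (qreal 1 - v * qconj (g 0%nat))%quat).
  assert (HW : (1 - A * B) ^ 2 <= qnsq w).
  { rewrite <- qnorm_sq. apply pow_incr. split; [nra|].
    assert (T := qnorm_triangle w (v * qconj (g 0%nat))%quat).
    replace (w + v * qconj (g 0%nat))%quat with (qreal 1) in T by (unfold w; clear; qring).
    rewrite qnorm_mul, qnorm_conj, qnorm_real, Rabs_R1 in T. fold A B in T. lra. }
  set (t := / (1 - A ^ 2)).
  assert (Ht : 0 < 1 - A ^ 2) by nra.
  (* the minimizer of the quadratic form *)
  assert (F1 := F (qreal (- t) * qconj w)%quat).
  assert (E : t * qnsq w * (1 - qnsq p) <= 1 - B ^ 2).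
  { apply (Rmult_le_reg_r (/ (1 - qnsq p))); [easy|].
    rewrite Rmult_assoc, Rinv_r, Rmult_1_r
      by (intro Z; rewrite Z, Rinv_0 in Hs; lra).
    replace (qdot (qreal 1) (v * qconj (g 0%nat) * (qreal (- t) * qconj w))%quat) with
      (qdot (qreal 1) (qreal (- t) * qconj w)%quat + t * qnsq w) in F1.
    2:{ replace (v * qconj (g 0%nat))%quat with (qreal 1 - w)%quat by (unfold w; clear; qring).
        clear. generalize w t. qring. }
    rewrite qnsq_mul, qnsq_conj, qnsq_real in F1.
    rewrite <- (qnorm_sq (g 0%nat)), <- (qnorm_sq v) in F1. fold A B in F1.
    assert (T : (1 - A ^ 2) * ((- t) ^ 2 * qnsq w) = t * qnsq w) by (unfold t; field; lra).
    lra. }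
  rewrite <- (qnorm_sq p) in E. fold r in E.
  assert (E2 : (1 - A * B) ^ 2 * (1 - r ^ 2) <= (1 - A ^ 2) * (1 - B ^ 2)).
  { apply Rle_trans with (qnsq w * (1 - r ^ 2)); [apply Rmult_le_compat_r; nra|].
    apply (Rmult_le_compat_l (1 - A ^ 2)) in E; [|lra].
    replace ((1 - A ^ 2) * (t * qnsq w * (1 - r ^ 2))) with (qnsq w * (1 - r ^ 2)) in E
      by (unfold t; field; lra). exact E. }
  (* (1 - A B)^2 - (B - A)^2 = (1 - A^2) (1 - B^2) *)
  assert (E3 : (B - A) ^ 2 <= (r * (1 - A * B)) ^ 2).
  { replace ((B - A) ^ 2) with ((1 - A * B) ^ 2 - (1 - A ^ 2) * (1 - B ^ 2)) by ring.
    rewrite Rpow_mult_distr. nra. }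
  assert (E4 : 0 <= r * (1 - A * B)) by (apply Rmult_le_pos; nra).
  destruct (Rle_dec (B - A) (r * (1 - A * B))); [lra|nra].
Qed.

(** * The hyperbolic difference quotient of a Schur sequence *)

(** On the unit circle [|1 - q conj(p)| = |q - p|]; on a finite segment the two
    square norms differ by a boundary term. *)
Lemma blaschke_sqsum (p : quat) (u : nat -> quat) (n : nat) :
  sqsum (conv (affine (qreal 1) (- qconj p)%quat) u) n =
  sqsum (conv (affine (- p)%quat (qreal 1)) u) n + (1 - qnsq p) * qnsq (u n).
Proof.
  induction n as [|n IH].
  - rewrite !sqsum_0, !conv_0. cbn [affine]. qring.
  - rewrite !sqsum_S, IH, !conv_affine_S. qring.
Qed.

(** The identity
    [|1 - conj(a) z|^2 = |z - a|^2 + (1 - |a|^2) (1 - |z|^2)]. *)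
Lemma moebius_sqsum (a : quat) (x y : nat -> quat) (n : nat) :
  sqsum (fun m => x m - qconj a * y m)%quat n =
  sqsum (fun m => y m - a * x m)%quat n + (1 - qnsq a) * (sqsum x n - sqsum y n).
Proof.
  induction n as [|n IH].
  - rewrite !sqsum_0. qring.
  - rewrite !sqsum_S, IH. qring.
Qed.

(** Solving the recurrence forwards expresses [x m] by later values of [y] up to a
    remainder [k^j x (m + j)], which vanishes because [x] grows more slowly than
    [k^(-m)]. *)
Lemma backward_decay (x y : nat -> R) (k r D : R) :
  0 <= k < r -> r < 1 -> (forall m, 0 <= x m) -> (forall m, x m <= y m + k * x (S m)) ->
  is_lim_seq y 0 -> (forall m, x m * r ^ m <= D) -> is_lim_seq x 0.
Proof.
  intros Hk Hr Hx Hrec Hy HD.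
  assert (Hbound : forall eps M, 0 <= eps -> (forall m, (M <= m)%nat -> y m <= eps) ->
    forall m, (M <= m)%nat -> x m <= eps / (1 - k)).
  { intros eps M He HM m Hm.
    assert (It : forall j m, (M <= m)%nat -> x m <= eps / (1 - k) + k ^ j * x (m + j)%nat).
    { induction j as [|j IH]; intros i Hi.
      - rewrite Nat.add_0_r. cbn [pow].
        assert (0 <= eps / (1 - k)) by (apply Rdiv_le_0_compat; lra). lra.
      - specialize (IH (S i) ltac:(lia)). specialize (Hrec i). specialize (HM i Hi).
        replace (i + S j)%nat with (S i + j)%nat by lia. cbn [pow].
        apply Rle_trans with (eps + k * (eps / (1 - k) + k ^ j * x (S i + j)%nat)).
        + nra.
        + apply Req_le. field. lra. }
    assert (L : is_lim_seq (fun j => eps / (1 - k) + D / r ^ m * (k / r) ^ j) (eps / (1 - k) + D / r ^ m * 0)).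
    { apply is_lim_seq_plus'; [apply is_lim_seq_const|].
      apply (is_lim_seq_scal_l _ (D / r ^ m) (Finite 0)). apply is_lim_seq_geom.
      rewrite Rabs_pos_eq by (apply Rdiv_le_0_compat; lra).
      apply (Rmult_lt_reg_r r); [lra|]. unfold Rdiv; rewrite Rmult_assoc, Rinv_l by lra. lra. }
    rewrite Rmult_0_r, Rplus_0_r in L.
    apply (is_lim_seq_le (fun _ => x m) _ (x m) (eps / (1 - k))) with (2 := is_lim_seq_const _) (3 := L).
    intro j. eapply Rle_trans; [apply (It j m Hm)|]. apply Rplus_le_compat_l.
    assert (Hrm : 0 < r ^ m) by (apply pow_lt; lra). assert (Hrj : 0 < r ^ j) by (apply pow_lt; lra).
    specialize (HD (m + j)%nat). rewrite pow_add in HD.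
    apply (Rmult_le_reg_r (r ^ m * r ^ j)); [nra|].
    replace (D / r ^ m * (k / r) ^ j * (r ^ m * r ^ j)) with (k ^ j * D).
    - rewrite Rmult_assoc. apply Rmult_le_compat_l; [apply pow_le; lra|exact HD].
    - unfold Rdiv. rewrite Rpow_mult_distr, pow_inv. field. lra. }
  apply is_lim_seq_spec. intros eps. apply is_lim_seq_spec in Hy.
  assert (He : 0 < eps * (1 - k) / 2) by (destruct eps as [e Pe]; cbn; nra).
  destruct (Hy (mkposreal _ He)) as [M HM]. cbn in HM.
  exists M. intros m Hm. rewrite Rminus_0_r, Rabs_pos_eq by apply Hx.
  apply Rle_lt_trans with (eps * (1 - k) / 2 / (1 - k)).
  - apply (Hbound _ M); [lra| |exact Hm]. intros i Hi. specialize (HM i Hi).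
    rewrite Rminus_0_r in HM. apply Rlt_le. eapply Rle_lt_trans; [apply Rle_abs|exact HM].
  - destruct eps as [e Pe]; cbn. unfold Rdiv.
    replace (e * (1 - k) * / 2 * / (1 - k)) with (e / 2) by (field; lra). lra.
Qed.

Lemma sqsum_bounded_lim (w : nat -> quat) (K : R) :
  (forall n, sqsum w n <= K) -> is_lim_seq (fun n => qnorm (w n)) 0.
Proof.
  intros H.
  assert (E : ex_series (fun m => qnsq (w m))).
  { destruct (ex_finite_lim_seq_incr (sqsum w) K) as [l Hl].
    - intro n. apply sqsum_incr. lia.
    - exact H.
    - exists l. exact Hl. }
  apply ex_series_lim_0 in E.
  apply is_lim_seq_ext with (fun n => sqrt (qnsq (w n))).
  - intro n. symmetry. apply qnorm_qnsq.
  - rewrite <- sqrt_0. apply is_lim_seq_continuous; [|exact E].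
    apply continuity_pt_sqrt. lra.
Qed.

Lemma summable_sqsum_bounded (e : nat -> quat) (K : R) :
  (forall n, sqsum e n <= K) -> summable e.
Proof.
  intros H. apply summable_of_bounded. intros r Hr. exists (1 + K). intro m.
  assert (H1 := H m). assert (H2 := sqsum_ge_term e m). rewrite <- qnorm_sq in H2.
  assert (P := qnorm_ge0 (e m)).
  assert (r ^ m <= 1) by (rewrite <- (pow1 m); apply pow_incr; lra).
  assert (0 <= r ^ m) by (apply pow_le; lra). nra.
Qed.

(** From [e = 1 + conj(A) a * e] and the contractivity of [a], the square norm of
    [e] satisfies a linear inequality with factor [(1 + h) |A|^2 < 1]. *)
Lemma geom_summable (a : nat -> quat) (A : quat) :
  schur a -> a 0%nat = qreal 0 -> unit_ball A ->
  summable (geom (fun m => qconj A * a m)%quat).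
Proof.
  intros Ha a0 HA. set (b := (fun m => qconj A * a m)%quat).
  assert (Hb : b 0%nat = qreal 0) by (unfold b; rewrite a0; apply qmul_0r).
  set (k := qnsq A). assert (Hk : 0 <= k < 1) by exact (unit_ball_qnsq A HA).
  set (h := (1 - k) / 2). assert (Hh : 0 < h) by (unfold h; lra).
  assert (Hhk : (1 + h) * k < 1) by (unfold h; nra).
  apply (summable_sqsum_bounded _ ((1 + / h) / (1 - (1 + h) * k))). intro n.
  assert (E : sqsum (geom b) n <= (1 + / h) * sqsum delta n + (1 + h) * (k * sqsum (conv a (geom b)) n)).
  { unfold sqsum. rewrite <- !rsum_mul_l, <- rsum_plus. apply rsum_le. intros m _.
    replace (geom b m) with (delta m + qconj A * conv a (geom b) m)%quat
      by (rewrite <- conv_mul_l; symmetry; exact (equal_f (geom_eq b Hb) m)).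
    replace (k * qnsq (conv a (geom b) m)) with (qnsq (qconj A * conv a (geom b) m)%quat)
      by (now rewrite qnsq_mul, qnsq_conj).
    generalize (delta m) (qconj A * conv a (geom b) m)%quat. intros x y.
    (* |x + y|^2 <= (1 + 1/h) |x|^2 + (1 + h) |y|^2 *)
    assert (P := qnsq_ge0 (x - qreal h * y)%quat).
    apply (Rmult_le_reg_l h); [easy|].
    replace (h * ((1 + / h) * qnsq x + (1 + h) * qnsq y)) with
      (h * qnsq (x + y)%quat + qnsq (x - qreal h * y)%quat); [lra|].
    replace (h * ((1 + / h) * qnsq x + (1 + h) * qnsq y)) with
      ((h + 1) * qnsq x + h * (1 + h) * qnsq y) by (field; lra).
    clear. generalize h. qring. }
  rewrite sqsum_delta, Rmult_1_r in E.
  assert (F := Ha (geom b) n).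
  apply (Rmult_le_reg_r (1 - (1 + h) * k)); [lra|].
  unfold Rdiv. rewrite Rmult_assoc, Rinv_l, Rmult_1_r by lra.
  assert (0 <= (1 + h) * k) by nra. nra.
Qed.

(** With [d = e * c] for the inverse [e] of [1 - conj(A) a], the input is
    [c = d - conj(A) a * d], while [(q - p) * rho * d = a * d - A d].  The Moebius
    identity compares their norms and the Blaschke identity replaces [q - p] by
    [1 - q conj(p)].  Its boundary term vanishes only in the limit, so the input is
    cut off at [n] and the output is followed beyond [n]. *)
Lemma quotient_schur (a rho : nat -> quat) (A p : quat) :
  schur a -> a 0%nat = qreal 0 -> unit_ball A -> unit_ball p -> summable rho ->
  conv (affine (- p)%quat (qreal 1)) rho = (fun m => a m - const A m)%quat ->
  schur (conv (conv (affine (qreal 1) (- qconj p)%quat) rho)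
    (geom (fun m => qconj A * a m)%quat)).
Proof.
  intros Ha a0 HA Hp Brho Hrho.
  assert (Be := geom_summable a A Ha a0 HA).
  set (b := (fun m => qconj A * a m)%quat) in *.
  assert (Hb : b 0%nat = qreal 0) by (unfold b; rewrite a0; apply qmul_0r).
  assert (HGe := geom_inv_r b Hb). set (e := geom b) in *.
  intros c n. rewrite !conv_assoc.
  (* entries beyond n do not influence the output up to n *)
  set (c' := fun m => if (m <=? n)%nat then c m else qreal 0).
  assert (Hc' : forall m, (m <= n)%nat -> c m = c' m).
  { intros m Hm. unfold c'. now rewrite (proj2 (Nat.leb_le m n) Hm). }
  assert (Sc' : forall m, sqsum c' m <= sqsum c n).
  { intro m. induction m as [|m IH].
    - rewrite sqsum_0, <- Hc' by lia. eapply Rle_trans; [apply sqsum_ge_term|apply sqsum_incr; lia].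
    - destruct (Compare_dec.le_lt_dec (S m) n) as [Hm|Hm].
      + replace (sqsum c' (S m)) with (sqsum c (S m)); [now apply sqsum_incr|].
        apply rsum_ext. intros i Hi. rewrite Hc' by lia. reflexivity.
      + rewrite sqsum_S. unfold c' at 2. rewrite (proj2 (Nat.leb_gt (S m) n) Hm), qnsq_real. lra. }
  assert (Bc' : summable c') by exact (summable_sqsum_bounded _ _ Sc').
  set (B := affine (qreal 1) (- qconj p)%quat).
  replace (sqsum (conv B (conv rho (conv e c))) n) with (sqsum (conv B (conv rho (conv e c'))) n).
  2:{ apply rsum_ext. intros m Hm. f_equal.
      repeat (apply conv_ext_le; [reflexivity|intros ? ?]). symmetry. apply Hc'. lia. }
  set (d := conv e c'). set (u := conv rho d).
  assert (Bu : summable u) by (apply summable_conv; [easy|now apply summable_conv]).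
  assert (Hc'd : c' = (fun m => d m - qconj A * conv a d m)%quat).
  { rewrite <- (conv_delta_l c'), <- HGe, conv_assoc. fold d.
    apply functional_extensionality; intro m.
    transitivity (conv delta d m + conv (fun k => qreal (-1) * b k)%quat d m)%quat.
    - rewrite <- conv_plus_l. f_equal. apply functional_extensionality; intro i. qring.
    - rewrite conv_delta_l, conv_mul_l. unfold b. rewrite conv_mul_l. qring. }
  assert (Hw : conv (affine (- p)%quat (qreal 1)) u = (fun m => conv a d m - A * d m)%quat).
  { unfold u. rewrite <- conv_assoc, Hrho. apply functional_extensionality; intro m.
    transitivity (conv a d m + conv (fun k => qreal (-1) * const A k)%quat d m)%quat.
    - rewrite <- conv_plus_l. f_equal. apply functional_extensionality; intro i. qring.
    - rewrite conv_mul_l, conv_const_l. qring. }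
  assert (Hle : forall m, sqsum (conv (affine (- p)%quat (qreal 1)) u) m <= sqsum c n).
  { intro m. eapply Rle_trans; [|apply (Sc' m)]. rewrite Hw, Hc'd, moebius_sqsum.
    assert (F := Ha d m).
    assert (HA' := unit_ball_qnsq A HA). nra. }
  (* the boundary term of the Blaschke identity vanishes in the limit *)
  assert (Hu : is_lim_seq (fun m => qnorm (u m)) 0).
  { assert (Hpr : 0 <= qnorm p < 1) by (split; [apply qnorm_ge0|exact Hp]).
    assert (Hr : 0 <= (1 + qnorm p) / 2 < 1) by lra.
    destruct (is_series_terms_bounded (fun m => qpow (qreal ((1 + qnorm p) / 2)) m * u m)%quat
      (qseries u (qreal ((1 + qnorm p) / 2)))) as [D HD].
    { apply qseries_correct; [easy|]. apply unit_ball_real. rewrite Rabs_pos_eq; lra. }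
    apply (backward_decay _ (fun m => qnorm (conv (affine (- p)%quat (qreal 1)) u (S m))) (qnorm p) ((1 + qnorm p) / 2) D).
    - lra.
    - lra.
    - intro; apply qnorm_ge0.
    - intro m. rewrite conv_affine_S, <- qnorm_mul.
      replace (u m) with ((- p * u (S m) + qreal 1 * u m) + p * u (S m))%quat at 1 by qring.
      apply qnorm_triangle.
    - apply (is_lim_seq_incr_1 (fun m => qnorm (conv (affine (- p)%quat (qreal 1)) u m))).
      eapply sqsum_bounded_lim. exact Hle.
    - intro m. specialize (HD m). rewrite qnorm_mul, qnorm_pow, qnorm_real, Rabs_pos_eq in HD by lra.
      rewrite Rmult_comm. exact HD. }
  assert (Lim : is_lim_seq (fun m => sqsum c n + (1 - qnsq p) * (qnorm (u m) * qnorm (u m))) (sqsum c n + (1 - qnsq p) * (0 * 0))).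
  { apply is_lim_seq_plus'; [apply is_lim_seq_const|].
    apply (is_lim_seq_scal_l _ (1 - qnsq p) (Finite (0 * 0))). now apply is_lim_seq_mult'. }
  rewrite !Rmult_0_r, Rplus_0_r in Lim.
  apply (is_lim_seq_le_loc (fun _ => sqsum (conv B u) n) _ (sqsum (conv B u) n) (sqsum c n))
    with (2 := is_lim_seq_const _) (3 := Lim).
  exists n. intros m Hm. eapply Rle_trans; [apply (sqsum_incr _ n m Hm)|].
  unfold B. rewrite blaschke_sqsum. specialize (Hle m). rewrite <- (qnorm_sq (u m)). lra.
Qed.

(** * Power series are slice regular *)

Lemma summable_bounded (a : nat -> quat) (r : R) :
  summable a -> 0 <= r < 1 -> exists C, 0 <= C /\ forall m, qnorm (a m) * r ^ m <= C.
Proof.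
  intros Ha Hr.
  destruct (is_series_terms_bounded (fun m => qpow (qreal r) m * a m)%quat (qseries a (qreal r))) as [C HC].
  { apply qseries_correct; [easy|]. apply unit_ball_real. rewrite Rabs_pos_eq; lra. }
  exists C. split.
  - eapply Rle_trans; [apply qnorm_ge0|apply (HC 0%nat)].
  - intro m. specialize (HC m). rewrite qnorm_mul, qnorm_pow, qnorm_real, Rabs_pos_eq in HC by lra. lra.
Qed.

(** Each of the [m + 1] terms of [1 + x + ... + x^m] is at least [x^m]. *)
Lemma mul_pow_bounded (x : R) (m : nat) : 0 <= x < 1 -> INR m * x ^ m <= / (1 - x).
Proof.
  intros Hx.
  apply Rle_trans with (rsum (fun k => x ^ k) m); [|now apply geom_sum_le].
  apply Rle_trans with (INR (S m) * x ^ m).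
  - rewrite S_INR. assert (0 <= x ^ m) by (apply pow_le; lra). nra.
  - assert (H : forall n, (n <= m)%nat -> INR (S n) * x ^ m <= rsum (fun k => x ^ k) n).
    { induction n as [|n IH]; intros Hn.
      - rewrite rsum_0. cbn [INR pow]. rewrite Rmult_1_l. rewrite <- (pow1 m) . apply pow_incr; lra.
      - rewrite rsum_S, S_INR. specialize (IH ltac:(lia)).
        assert (x ^ m <= x ^ S n); [|lra].
        replace m with (S n + (m - S n))%nat at 1 by lia. rewrite pow_add.
        rewrite <- (Rmult_1_r (x ^ S n)) at 2. apply Rmult_le_compat_l; [apply pow_le; lra|].
        rewrite <- (pow1 (m - S n)). apply pow_incr; lra. }
    now apply H.
Qed.

Lemma summable_mul_INR (a : nat -> quat) : summable a -> summable (fun m => qreal (INR m) * a m)%quat.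
Proof.
  intros Ha. apply summable_of_bounded. intros r Hr. set (s := (1 + r) / 2).
  assert (Hs : 0 < s < 1) by (unfold s; lra).
  destruct (summable_bounded a s Ha) as [C [C0 HC]]; [lra|].
  assert (Hx : 0 <= r / s < 1).
  { split; [apply Rdiv_le_0_compat; lra|]. apply (Rmult_lt_reg_r s); [lra|].
    unfold Rdiv; rewrite Rmult_assoc, Rinv_l by lra. unfold s; lra. }
  exists (/ (1 - r / s) * C). intro m.
  rewrite qnorm_mul, qnorm_real, Rabs_pos_eq by apply pos_INR.
  replace (INR m * qnorm (a m) * r ^ m) with ((INR m * (r / s) ^ m) * (qnorm (a m) * s ^ m)).
  - apply Rmult_le_compat.
    + apply Rmult_le_pos; [apply pos_INR|apply pow_le; lra].
    + apply Rmult_le_pos; [apply qnorm_ge0|apply pow_le; lra].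
    + now apply mul_pow_bounded.
    + apply HC.
  - unfold Rdiv. rewrite Rpow_mult_distr, pow_inv. field. apply pow_nonzero. lra.
Qed.

Lemma summable_tail (a : nat -> quat) (k : nat) : summable a -> summable (fun j => a (k + j)%nat).
Proof.
  intros Ha. apply summable_of_bounded. intros r Hr. set (s := (1 + r) / 2).
  assert (Hs : 0 < s < 1) by (unfold s; lra).
  destruct (summable_bounded a s Ha) as [C [C0 HC]]; [lra|].
  exists (C / s ^ k). intro m. assert (Hk : 0 < s ^ k) by (apply pow_lt; lra).
  apply (Rmult_le_reg_r (s ^ k)); [easy|].
  unfold Rdiv. rewrite (Rmult_assoc C), Rinv_l, Rmult_1_r by lra.
  eapply Rle_trans; [|apply (HC (k + m)%nat)]. rewrite pow_add.
  assert (r ^ m <= s ^ m) by (apply pow_incr; unfold s; lra).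
  rewrite Rmult_assoc. apply Rmult_le_compat_l; [apply qnorm_ge0|]. nra.
Qed.

Definition derivs (a : nat -> quat) (m : nat) : quat := (qreal (INR (S m)) * a (S m))%quat.

Lemma summable_derivs (a : nat -> quat) : summable a -> summable (derivs a).
Proof. intros Ha. exact (summable_tail _ 1 (summable_mul_INR a Ha)). Qed.

(** The derivative [m z^(m-1)] of the power function on a slice. *)
Definition dpow (z : quat) (m : nat) : quat :=
  match m with O => qreal 0 | S k => (qreal (INR m) * qpow z k)%quat end.

Lemma qpow_commute (z h : quat) (m : nat) : (z * h = h * z)%quat -> (qpow z m * h = h * qpow z m)%quat.
Proof.
  intros H. induction m as [|m IH]; cbn [qpow].
  - now rewrite qmul_1l, qmul_1r.
  - rewrite <- qmul_assoc, IH, !qmul_assoc, H. reflexivity.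
Qed.

(** The remainder satisfies [E_(m+1) = (z + h) E_m + m z^(m-1) h^2], and
    [m^2 + m <= (m + 1)^2]. *)
Lemma qpow_taylor (z h : quat) (s : R) (m : nat) :
  (z * h = h * z)%quat -> 0 < s -> qnorm z <= s -> qnorm (z + h)%quat <= s ->
  qnorm (qpow (z + h) m - qpow z m - h * dpow z m)%quat <= qnorm h ^ 2 * (INR m ^ 2 * s ^ m / s ^ 2).
Proof.
  intros C Hs Hz Hzh. induction m as [|m IH].
  - cbn [qpow dpow]. replace (_ - _ - _)%quat with (qreal 0) by (clear; qring).
    rewrite qnorm_real, Rabs_R0. cbn [INR]. rewrite pow_i by lia. unfold Rdiv. lra.
  - set (E := (qpow (z + h) m - qpow z m - h * dpow z m)%quat) in *.
    assert (R1 : (qpow (z + h) (S m) - qpow z (S m) - h * dpow z (S m) =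
      (z + h) * E + h * (h * dpow z m))%quat).
    { assert (D : (dpow z (S m) = z * dpow z m + qpow z m)%quat).
      { destruct m as [|m]; cbn [dpow qpow].
        - cbn [INR]. clear; qring.
        - rewrite (S_INR (S m)), <- qreal_plus. cbn [qpow].
          generalize (INR (S m)) (qpow z m). clear. qring. }
      rewrite D. unfold E. cbn [qpow]. generalize (qpow (z + h) m) (dpow z m) (qpow z m).
      intros u v w.
      transitivity ((z + h) * u - z * w - h * w - h * z * v)%quat; [clear; qring|].
      rewrite <- C. clear. qring. }
    rewrite R1. eapply Rle_trans; [apply qnorm_triangle|]. rewrite !qnorm_mul.
    assert (HD : qnorm (dpow z m) <= INR m * s ^ m / s).
    { destruct m as [|m]; cbn [dpow].
      - rewrite qnorm_real, Rabs_R0. cbn [INR]. unfold Rdiv. lra.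
      - rewrite qnorm_mul, qnorm_pow, qnorm_real, Rabs_pos_eq by apply pos_INR.
        replace (INR (S m) * s ^ S m / s) with (INR (S m) * s ^ m) by (cbn [pow]; field; lra).
        apply Rmult_le_compat_l; [apply pos_INR|]. apply pow_incr. split; [apply qnorm_ge0|easy]. }
    assert (Hh := qnorm_ge0 h).
    apply Rle_trans with (s * (qnorm h ^ 2 * (INR m ^ 2 * s ^ m / s ^ 2)) + qnorm h * (qnorm h * (INR m * s ^ m / s))).
    + apply Rplus_le_compat.
      * apply Rmult_le_compat; try apply qnorm_ge0; easy.
      * apply Rmult_le_compat_l; [easy|]. now apply Rmult_le_compat_l.
    + rewrite S_INR. assert (P := pos_INR m). assert (0 < s ^ m) by (apply pow_lt; lra).
      replace (s * (qnorm h ^ 2 * (INR m ^ 2 * s ^ m / s ^ 2)) + qnorm h * (qnorm h * (INR m * s ^ m / s)))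
        with (qnorm h ^ 2 * (s ^ m / s) * (INR m ^ 2 + INR m)) by (field; lra).
      replace (qnorm h ^ 2 * ((INR m + 1) ^ 2 * s ^ S m / s ^ 2))
        with (qnorm h ^ 2 * (s ^ m / s) * (INR m + 1) ^ 2) by (cbn [pow]; field; lra).
      apply Rmult_le_compat_l; [|nra].
      apply Rmult_le_pos; [nra|]. apply Rdiv_le_0_compat; lra.
Qed.

(** A remainder of second order, uniform on a smaller ball, yields the
    derivatives along a slice as well as their continuity. *)
Lemma series_taylor (a : nat -> quat) (s : R) :
  summable a -> 0 < s < 1 -> exists K, 0 <= K /\ forall z h : quat,
    (z * h = h * z)%quat -> qnorm z <= s -> qnorm (z + h)%quat <= s ->
    qnorm (qseries a (z + h)%quat - qseries a z - h * qseries (derivs a) z)%quat <= K * qnorm h ^ 2.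
Proof.
  intros Ha Hs.
  assert (B2 := summable_mul_INR _ (summable_mul_INR a Ha)).
  destruct (B2 s) as [S0 HS]; [lra|].
  assert (P0 : forall n, 0 <= qnorm (qreal (INR n) * (qreal (INR n) * a n))%quat * s ^ n).
  { intro n. apply Rmult_le_pos; [apply qnorm_ge0|apply pow_le; lra]. }
  assert (Hpart : forall n, rsum (fun m => qnorm (qreal (INR m) * (qreal (INR m) * a m))%quat * s ^ m) n <= S0).
  { apply is_lim_seq_incr_compare; [exact HS|]. intro n.
    change (rsum (fun m => qnorm (qreal (INR m) * (qreal (INR m) * a m))%quat * s ^ m) n <=
      rsum (fun m => qnorm (qreal (INR m) * (qreal (INR m) * a m))%quat * s ^ m) (S n)).
    rewrite rsum_S. specialize (P0 (S n)). lra. }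
  assert (HS0 : 0 <= S0).
  { eapply Rle_trans; [|apply (Hpart 0%nat)]. now apply rsum_ge0. }
  exists (S0 / s ^ 2). split; [apply Rdiv_le_0_compat; [easy|nra]|].
  intros z h C Hz Hzh.
  assert (Uz : unit_ball z) by (unfold unit_ball; lra).
  assert (Uzh : unit_ball (z + h)%quat) by (unfold unit_ball; lra).
  assert (Q1 := qseries_correct a _ Ha Uzh). assert (Q2 := qseries_correct a _ Ha Uz).
  assert (Q3 := qseries_correct _ _ (summable_derivs a Ha) Uz).
  unfold is_qseries in *. apply is_series_qlim in Q1, Q2, Q3.
  assert (Q3' : qlim (qsum (fun m => dpow z m * a m)%quat) (qseries (derivs a) z)).
  { unfold qlim. apply is_lim_seq_incr_1. eapply is_lim_seq_ext; [|exact Q3]. intro n. cbn beta.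
    do 2 f_equal. rewrite qsum_S_first. cbn [dpow].
    rewrite (qsum_ext (fun k => (qreal (INR (S k)) * qpow z k) * a (S k))%quat (fun m => qpow z m * derivs a m)%quat).
    - clear. qring.
    - intros k _. unfold derivs. rewrite !qmul_assoc. now rewrite qmul_real. }
  assert (L := qlim_plus _ _ _ _ Q1 (qlim_plus _ _ _ _ (qlim_mul_l (qreal (-1)) _ _ Q2)
     (qlim_mul_l (qreal (-1)) _ _ (qlim_mul_l h _ _ Q3')))).
  cbv beta in L.
  replace (qseries a (z + h)%quat - qseries a z - h * qseries (derivs a) z)%quat with
    (qseries a (z + h)%quat + (qreal (-1) * qseries a z + qreal (-1) * (h * qseries (derivs a) z)))%quat
    by (generalize (qseries a (z + h)%quat) (qseries a z) (qseries (derivs a) z); clear; qring).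
  apply (qlim_bound _ _ (fun _ => S0 / s ^ 2 * qnorm h ^ 2)) with (1 := L); [apply is_lim_seq_const|].
  exists 0%nat. intros n _.
  replace (_ + _)%quat with (qsum (fun m => (qpow (z + h) m - qpow z m - h * dpow z m) * a m)%quat n).
  - eapply Rle_trans; [apply qnorm_qsum|].
    apply Rle_trans with (qnorm h ^ 2 / s ^ 2 * rsum (fun m => qnorm (qreal (INR m) * (qreal (INR m) * a m))%quat * s ^ m) n).
    + rewrite <- rsum_mul_l. apply rsum_le. intros m _.
      rewrite !qnorm_mul, qnorm_real, Rabs_pos_eq by apply pos_INR.
      assert (T := qpow_taylor z h s m C (proj1 Hs) Hz Hzh).
      apply (Rmult_le_compat_r (qnorm (a m))) in T; [|apply qnorm_ge0].
      eapply Rle_trans; [exact T|]. apply Req_le. field. lra.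
    + apply Rle_trans with (qnorm h ^ 2 / s ^ 2 * S0).
      * apply Rmult_le_compat_l; [apply Rdiv_le_0_compat; nra|apply Hpart].
      * apply Req_le. field. lra.
  - rewrite <- !qsum_mul_l, <- !qsum_plus. apply qsum_ext. intros m _.
    generalize (qpow (z + h) m) (qpow z m) (dpow z m) (a m). clear. qring.
Qed.

Lemma imag_unit_norm (I : quat) : imag_unit I -> qnorm I = 1.
Proof.
  unfold imag_unit. intros H. apply (f_equal qnorm) in H.
  rewrite qnorm_mul, qnorm_real in H. rewrite Rabs_left in H by lra.
  generalize (qnorm_ge0 I). nra.
Qed.

(** As [|I| = 1], both [conj(I)] and [- I] are inverse to [I]. *)
Lemma imag_unit_conj (I : quat) : imag_unit I -> qconj I = (- I)%quat.
Proof.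
  intros H. assert (N := imag_unit_norm I H).
  assert (E : (qconj I * (I * I) = I)%quat).
  { rewrite qmul_assoc, qmul_conj_l, <- qnorm_sq, N.
    replace (1 ^ 2) with 1 by ring. apply qmul_1l. }
  rewrite H in E.
  transitivity (- (qconj I * qreal (-1)))%quat; [clear; qring|now rewrite E].
Qed.

Lemma imag_unit_re (I : quat) : imag_unit I -> fst (fst I) = 0.
Proof.
  intros H. apply imag_unit_conj in H. destruct I as [[a b] [c d]].
  injection H. cbn. intros. lra.
Qed.

Lemma qnsq_slice (I : quat) (x y : R) : imag_unit I -> qnsq (slice_point I x y) = x ^ 2 + y ^ 2.
Proof.
  intros H. assert (N := imag_unit_norm I H). assert (Re := imag_unit_re I H).
  assert (N2 : qnsq I = 1) by (rewrite <- qnorm_sq, N; ring).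
  transitivity (x ^ 2 + y ^ 2 * qnsq I + 2 * x * y * fst (fst I)).
  - clear. unfold slice_point. destruct I as [[a b] [c d]]. cbn -[pow].
    change (qnsq (qreal x + qreal y * (a, b, (c, d)))%quat = x ^ 2 + y ^ 2 * (a ^ 2 + b ^ 2 + c ^ 2 + d ^ 2) + 2 * x * y * a).
    qreduce. ring.
  - rewrite N2, Re. ring.
Qed.

Lemma slice_point_diff (I : quat) (x y x' y' : R) :
  slice_point I x' y' = (slice_point I x y + slice_point I (x' - x) (y' - y))%quat.
Proof. unfold slice_point. qring. Qed.

Lemma slice_point_comm (I : quat) (x y x' y' : R) :
  (slice_point I x y * slice_point I x' y' = slice_point I x' y' * slice_point I x y)%quat.
Proof. unfold slice_point. qring. Qed.

Lemma qnorm_slice_le (I : quat) (x y : R) : imag_unit I ->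
  qnorm (slice_point I x y) <= Rabs x + Rabs y.
Proof.
  intros H. unfold slice_point. eapply Rle_trans; [apply qnorm_triangle|].
  rewrite qnorm_mul, !qnorm_real, (imag_unit_norm I H). lra.
Qed.

Lemma is_derive_quadratic (F : R -> quat) (x : R) (l : quat) (K delta : R) :
  0 <= K -> 0 < delta ->
  (forall t, Rabs (t - x) < delta -> qnorm (F t - F x - qreal (t - x) * l)%quat <= K * (t - x) ^ 2) ->
  is_derive F x l.
Proof.
  intros HK Hd H. split.
  - apply is_linear_scal_l.
  - intros x' Hx'. assert (E : x = x').
    { apply (is_filter_lim_locally_unique (K := R_AbsRing) (V := R_NormedModule)). exact Hx'. }
    subst x'. intros eps.
    assert (He : 0 < Rmin delta (eps / (K + 1))).
    { apply Rmin_glb_lt; [easy|]. apply Rdiv_lt_0_compat; [apply eps|lra]. }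
    exists (mkposreal _ He). intros t Ht.
    assert (Ht' : Rabs (t - x) < Rmin delta (eps / (K + 1))) by exact Ht.
    change (norm (minus (minus (F t) (F x)) (scal (t - x) l) : qmodule) <= eps * Rabs (t - x)).
    rewrite qnorm_norm, scal_qreal.
    assert (H1 := Rmin_l delta (eps / (K + 1))). assert (H2 := Rmin_r delta (eps / (K + 1))).
    eapply Rle_trans; [apply H; lra|].
    rewrite <- pow2_abs. simpl pow. rewrite Rmult_1_r, <- Rmult_assoc.
    apply Rmult_le_compat_r; [apply Rabs_pos|].
    assert (A := Rabs_pos (t - x)).
    apply Rle_trans with ((K + 1) * (eps / (K + 1))); [|apply Req_le; field; lra].
    apply Rmult_le_compat; lra.
Qed.

(** On a slice the increment of the argument commutes with the argument, so the
    derivative in [x] is the derived series [D], and the derivative in [y] is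
    [I D]. *)
Lemma qseries_slice_regular (a : nat -> quat) : summable a -> slice_regular (qseries a).
Proof.
  intros Ha I HI.
  assert (Hball : forall x y, unit_ball (slice_point I x y) -> exists s delta,
    0 < s < 1 /\ 0 < delta /\ qnorm (slice_point I x y) <= s /\ forall x' y',
    Rabs (x' - x) + Rabs (y' - y) < delta -> qnorm (slice_point I x' y') <= s).
  { intros x y H. exists ((1 + qnorm (slice_point I x y)) / 2), ((1 - qnorm (slice_point I x y)) / 2).
    unfold unit_ball in H. assert (N := qnorm_ge0 (slice_point I x y)).
    repeat split; try lra. intros x' y' Hd. rewrite (slice_point_diff I x y).
    eapply Rle_trans; [apply qnorm_triangle|].
    assert (T := qnorm_slice_le I (x' - x) (y' - y) HI). lra. }
  assert (Bd := summable_derivs a Ha).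
  exists (fun z => qseries (derivs a) (slice_point I (fst z) (snd z))).
  exists (fun z => I * qseries (derivs a) (slice_point I (fst z) (snd z)))%quat.
  intros x y Hxy. destruct (Hball x y Hxy) as [s [d [Hs [Hd [Hz Hnear]]]]]. cbn [fst snd].
  destruct (series_taylor a s Ha Hs) as [K [HK T]].
  assert (Cont : forall b, summable b -> continuous (fun z : R * R => qseries b (slice_point I (fst z) (snd z))) (x, y)).
  { intros b Hb. destruct (series_taylor b s Hb Hs) as [Kb [HKb Tb]].
    apply (filterlim_locally_ball_norm (K := R_AbsRing) (U := qmodule)
      (fun z : R * R => qseries b (slice_point I (fst z) (snd z)))).
    intros eps. set (D := qnorm (qseries (derivs b) (slice_point I x y))).
    assert (HD : 0 <= D) by apply qnorm_ge0.
    assert (He : 0 < Rmin (d / 2) (eps / (2 * (D + Kb * d + 1)))).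
    { apply Rmin_glb_lt; [lra|]. apply Rdiv_lt_0_compat; [apply eps|nra]. }
    exists (mkposreal _ He). intros [x' y'] [Hx' Hy'].
    assert (H1 := Rmin_l (d / 2) (eps / (2 * (D + Kb * d + 1)))).
    assert (H2 := Rmin_r (d / 2) (eps / (2 * (D + Kb * d + 1)))).
    assert (Hx : Rabs (x' - x) < Rmin (d / 2) (eps / (2 * (D + Kb * d + 1)))) by exact Hx'.
    assert (Hy : Rabs (y' - y) < Rmin (d / 2) (eps / (2 * (D + Kb * d + 1)))) by exact Hy'.
    cbn [fst snd]. unfold ball_norm. rewrite qnorm_norm.
    specialize (Tb (slice_point I x y) (slice_point I (x' - x) (y' - y)) (slice_point_comm _ _ _ _ _) Hz).
    rewrite <- slice_point_diff in Tb. specialize (Tb (Hnear x' y' ltac:(lra))).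
    assert (Hh := qnorm_slice_le I (x' - x) (y' - y) HI).
    set (h := slice_point I (x' - x) (y' - y)) in *. assert (Hh0 := qnorm_ge0 h).
    assert (G : qnorm (qseries b (slice_point I x' y') - qseries b (slice_point I x y))%quat <=
      Kb * qnorm h ^ 2 + qnorm h * D).
    { replace (qseries b (slice_point I x' y') - qseries b (slice_point I x y))%quat with
       ((qseries b (slice_point I x' y') - qseries b (slice_point I x y) - h * qseries (derivs b) (slice_point I x y))
         + h * qseries (derivs b) (slice_point I x y))%quat.
      - eapply Rle_trans; [apply qnorm_triangle|]. rewrite qnorm_mul. fold D. lra.
      - generalize (qseries b (slice_point I x' y')) (qseries b (slice_point I x y)) (qseries (derivs b) (slice_point I x y)) h.
        clear. qring. }
    eapply Rle_lt_trans; [exact G|].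
    assert (Q : 0 < 2 * (D + Kb * d + 1)) by nra.
    assert (H3 : qnorm h < eps / (D + Kb * d + 1)).
    { apply Rle_lt_trans with (Rabs (x' - x) + Rabs (y' - y)); [easy|].
      replace (eps / (D + Kb * d + 1)) with (eps / (2 * (D + Kb * d + 1)) + eps / (2 * (D + Kb * d + 1))) by (field; nra).
      lra. }
    apply Rle_lt_trans with (qnorm h * (D + Kb * d + 1)).
    - assert (qnorm h <= d) by lra. assert (0 <= Kb * qnorm h) by nra. nra.
    - apply (Rmult_lt_compat_r (D + Kb * d + 1)) in H3; [|nra].
      replace (eps / (D + Kb * d + 1) * (D + Kb * d + 1)) with (pos eps) in H3 by (field; nra). exact H3. }
  assert (CD := Cont _ Bd).
  refine (conj _ (conj _ (conj CD (conj _ _)))); cbn [fst snd].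
  - apply (is_derive_quadratic (fun t => qseries a (slice_point I t y)) x _ K d); [easy|easy|]. intros t Ht.
    specialize (T (slice_point I x y) (slice_point I (t - x) (y - y)) (slice_point_comm _ _ _ _ _) Hz).
    rewrite <- slice_point_diff in T.
    assert (Y : Rabs (y - y) = 0) by (rewrite Rminus_diag, Rabs_R0; reflexivity).
    specialize (T (Hnear t y ltac:(lra))).
    replace (slice_point I (t - x) (y - y)) with (qreal (t - x)) in T by (unfold slice_point; clear; qring).
    rewrite qnorm_real, pow2_abs in T. exact T.
  - apply (is_derive_quadratic (fun t => qseries a (slice_point I x t)) y _ K d); [easy|easy|]. intros t Ht.
    specialize (T (slice_point I x y) (slice_point I (x - x) (t - y)) (slice_point_comm _ _ _ _ _) Hz).
    rewrite <- slice_point_diff in T.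
    assert (X : Rabs (x - x) = 0) by (rewrite Rminus_diag, Rabs_R0; reflexivity).
    specialize (T (Hnear x t ltac:(lra))).
    replace (slice_point I (x - x) (t - y)) with (qreal (t - y) * I)%quat in T by (unfold slice_point; clear; qring).
    rewrite qnorm_mul, (imag_unit_norm I HI), Rmult_1_r, qnorm_real, pow2_abs in T.
    rewrite <- qmul_assoc in T. exact T.
  - assert (CD' := proj1 (filterlim_locally_ball_norm (K := R_AbsRing) (U := qmodule)
      (fun z : R * R => qseries (derivs a) (slice_point I (fst z) (snd z)))
      (qseries (derivs a) (slice_point I x y))) CD).
    apply (filterlim_locally_ball_norm (K := R_AbsRing) (U := qmodule)
      (fun z : R * R => I * qseries (derivs a) (slice_point I (fst z) (snd z)))%quat).
    intros eps. eapply filter_imp; [|exact (CD' eps)]. intros [x' y']. unfold ball_norm.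
    rewrite !qnorm_norm. cbn [fst snd].
    assert (E : forall u v, qnorm (I * u - I * v)%quat = qnorm (u - v)%quat).
    { intros u v. rewrite <- qmul_minus_r, qnorm_mul, (imag_unit_norm I HI). ring. }
    intros Hlt. eapply Rle_lt_trans; [|exact Hlt]. apply Req_le. apply E.
  - rewrite qmul_assoc, HI. generalize (qseries (derivs a) (slice_point I x y)). clear. qring.
Qed.

(** * Existence of the difference quotient *)

(** Comparing coefficients in [f(q) - f(p) = (q - p) * R(q)] leads to
    [R_m = sum_j p^j a_(m+1+j)]. *)
Definition quotient_coeffs (a : nat -> quat) (p : quat) (m : nat) : quat :=
  qseries (fun j => a (S m + j)%nat) p.

Lemma is_qseries_S (a : nat -> quat) (p v : quat) :
  is_qseries (shift a) p v -> is_qseries a p (a 0%nat + p * v)%quat.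
Proof.
  intros H. unfold is_qseries in *. apply is_series_qlim in H. apply is_series_qlim.
  unfold qlim. apply is_lim_seq_incr_1.
  apply (qlim_mul_l p) in H.
  assert (H' := qlim_plus _ _ _ _ (qlim_const (a 0%nat)) H).
  eapply is_lim_seq_ext; [|exact H']. intro n. cbn beta. do 2 f_equal.
  rewrite qsum_S_first. cbn [qpow]. rewrite qmul_1l. f_equal.
  rewrite <- qsum_mul_l. apply qsum_ext. intros k _. apply qmul_assoc.
Qed.

Lemma quotient_coeffs_conv (a : nat -> quat) (p v : quat) :
  summable a -> unit_ball p -> is_qseries a p v ->
  conv (affine (- p)%quat (qreal 1)) (quotient_coeffs a p) = (fun m => a m - const v m)%quat.
Proof.
  intros Ha Hp Hv.
  assert (Rec : forall k, qseries (fun j => a (k + j)%nat) p = (a k + p * quotient_coeffs a p k)%quat).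
  { intro k. apply is_qseries_unique.
    assert (H := qseries_correct _ p (summable_tail a (S k) Ha) Hp).
    fold (quotient_coeffs a p k) in H.
    replace (fun j => a (S k + j)%nat) with (shift (fun j => a (k + j)%nat)) in H
      by (apply functional_extensionality; intro j; unfold shift; f_equal; lia).
    apply is_qseries_S in H. cbv beta in H. rewrite Nat.add_0_r in H. exact H. }
  apply functional_extensionality; intros [|m].
  - rewrite conv_0. cbn [affine const].
    assert (R0 := Rec 0%nat). change (fun j => a (0 + j)%nat) with a in R0.
    rewrite (is_qseries_unique _ _ _ Hv) in R0. rewrite R0. qring.
  - rewrite conv_affine_S. replace (const v (S m)) with (qreal 0) by (now destruct m).
    unfold quotient_coeffs at 2. rewrite Rec. qring.
Qed.

Lemma quotient_coeffs_summable (a : nat -> quat) (p : quat) :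
  summable a -> unit_ball p -> summable (quotient_coeffs a p).
Proof.
  intros Ha Hp. apply summable_of_bounded. intros r Hr.
  assert (Hp' : 0 <= qnorm p < 1) by (split; [apply qnorm_ge0|exact Hp]).
  set (s := (1 + Rmax r (qnorm p)) / 2).
  assert (M1 := Rmax_l r (qnorm p)). assert (M2 := Rmax_r r (qnorm p)).
  assert (M3 : Rmax r (qnorm p) < 1) by (apply Rmax_lub_lt; lra).
  assert (Hs : 0 < s < 1) by (unfold s; lra).
  assert (Hrs : r <= s) by (unfold s; lra). assert (Hps : qnorm p < s) by (unfold s; lra).
  clearbody s.
  destruct (summable_bounded a s Ha) as [C [C0 HC]]; [lra|].
  assert (Hx : 0 <= qnorm p / s < 1).
  { split; [apply Rdiv_le_0_compat; lra|]. apply (Rmult_lt_reg_r s); [lra|].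
    unfold Rdiv; rewrite Rmult_assoc, Rinv_l by lra. lra. }
  assert (Hx' : 0 < / (1 - qnorm p / s)) by (apply Rinv_0_lt_compat; lra).
  exists (C / s * / (1 - qnorm p / s)). intro m.
  assert (Hsm : 0 < s ^ m) by (apply pow_lt; lra).
  assert (B : qnorm (quotient_coeffs a p m) <= C / s ^ S m * / (1 - qnorm p / s)).
  { assert (H := qseries_correct _ p (summable_tail a (S m) Ha) Hp).
    fold (quotient_coeffs a p m) in H. unfold is_qseries in H. apply is_series_qlim in H.
    apply (qlim_bound _ _ (fun _ => C / s ^ S m * / (1 - qnorm p / s))) with (1 := H);
      [apply is_lim_seq_const|].
    exists 0%nat. intros n _. eapply Rle_trans; [apply qnorm_qsum|].
    apply Rle_trans with (rsum (fun j => C / s ^ S m * (qnorm p / s) ^ j) n).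
    - apply rsum_le. intros j _. rewrite qnorm_mul, qnorm_pow.
      specialize (HC (S m + j)%nat). rewrite pow_add in HC.
      assert (Hsj : 0 < s ^ j) by (apply pow_lt; lra).
      assert (HsS : 0 < s ^ S m) by (apply pow_lt; lra).
      assert (Q : qnorm (a (S m + j)%nat) <= C / (s ^ S m * s ^ j)).
      { apply (Rmult_le_reg_r (s ^ S m * s ^ j)); [nra|].
        unfold Rdiv. rewrite (Rmult_assoc C), Rinv_l by nra. lra. }
      apply (Rmult_le_compat_l (qnorm p ^ j)) in Q; [|apply pow_le; lra].
      eapply Rle_trans; [exact Q|]. apply Req_le. unfold Rdiv.
      rewrite Rpow_mult_distr, pow_inv. field. lra.
    - rewrite rsum_mul_l. apply Rmult_le_compat_l; [|now apply geom_sum_le].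
      apply Rdiv_le_0_compat; [easy|apply pow_lt; lra]. }
  apply Rle_trans with (C / s ^ S m * / (1 - qnorm p / s) * s ^ m).
  - apply Rmult_le_compat; [apply qnorm_ge0|apply pow_le; lra|exact B|apply pow_incr; lra].
  - apply Req_le. cbn [pow]. field. repeat split; lra.
Qed.

Lemma minus_has_coeffs (p : quat) : has_coeffs (fun z => z - p)%quat (affine (- p)%quat (qreal 1)).
Proof.
  apply has_coeffs_ext with (fun q => - p + q * qreal 1)%quat; [|apply affine_has_coeffs].
  intros q _. qring.
Qed.

(** The chosen difference quotient has its defining property, because the series
    with coefficients [quotient_coeffs a p] is a witness. *)
Lemma diff_quotient_spec (f : quat -> quat) (a : nat -> quat) (p : quat) :
  has_coeffs f a -> unit_ball p ->
  slice_regular (diff_quotient f p) /\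
  forall q : quat, unit_ball q ->
    f q = (f p + star (fun z => z - p)%quat (diff_quotient f p) q)%quat.
Proof.
  intros Hf Hp. assert (Ba := has_coeffs_summable f a Hf).
  apply (epsilon_spec (inhabits (fun _ : quat => qreal 0))
    (fun g => slice_regular g /\ forall q : quat, unit_ball q ->
      f q = (f p + star (fun z => z - p)%quat g q)%quat)).
  exists (qseries (quotient_coeffs a p)).
  assert (Bq := quotient_coeffs_summable a p Ba Hp).
  split; [now apply qseries_slice_regular|].
  assert (H := star_has_coeffs _ _ _ _ (minus_has_coeffs p) (has_coeffs_qseries _ Bq)).
  rewrite (quotient_coeffs_conv a p (f p) Ba Hp (Hf p Hp)) in H.
  assert (H' := plus_has_coeffs _ _ _ _ (affine_has_coeffs (f p) (qreal 0)) H).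
  assert (E : (fun m => affine (f p) (qreal 0) m + (a m - const (f p) m))%quat = a).
  { apply functional_extensionality; intro m. fold (const (f p)). generalize (const (f p) m). clear. qring. }
  cbv beta in H'. rewrite E in H'. intros q Hq. specialize (H' q Hq). assert (H1 := Hf q Hq).
  apply is_qseries_unique in H1, H'. rewrite H1 in H'. rewrite H'.
  generalize (star (fun z => z - p)%quat (qseries (quotient_coeffs a p)) q) (f p). clear. qring.
Qed.

(** The defining equation fixes the coefficients, whichever witness was chosen. *)
Lemma diff_quotient_coeffs (f : quat -> quat) (a rho : nat -> quat) (p : quat) :
  has_coeffs f a -> unit_ball p -> has_coeffs (diff_quotient f p) rho ->
  conv (affine (- p)%quat (qreal 1)) rho = (fun m => a m - const (f p) m)%quat.
Proof.
  intros Hf Hp Hrho. destruct (diff_quotient_spec f a p Hf Hp) as [_ H].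
  assert (H1 := star_has_coeffs _ _ _ _ (minus_has_coeffs p) Hrho).
  rewrite <- (coeffs_eq _ _ H1). apply coeffs_eq.
  assert (H2 := plus_has_coeffs _ _ _ _ Hf (affine_has_coeffs (- f p)%quat (qreal 0))).
  replace (fun m => a m - const (f p) m)%quat with (fun m => a m + affine (- f p) (qreal 0) m)%quat.
  - eapply has_coeffs_ext; [|exact H2]. intros q Hq. cbv beta. rewrite (H q Hq).
    generalize (star (fun z => z - p)%quat (diff_quotient f p) q) (f p). clear. qring.
  - apply functional_extensionality; intros [|[|m]]; cbn [affine const]; clear; qring.
Qed.

(** * Cauchy's formula on a slice *)

Lemma qdot_conj_mul (c q r : quat) : qdot c (q * r) = qdot (qconj q * c) r.
Proof. qring. Qed.

Lemma qdot_slice (c I q : quat) (x y : R) :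
  qdot c (slice_point I x y * q) = x * qdot c q + y * qdot (qconj I * c) q.
Proof. unfold slice_point. qring. Qed.

Lemma is_linear_qdot (c : quat) :
  is_linear (K := R_AbsRing) (U := qmodule) (V := R_NormedModule) (qdot c).
Proof.
  split.
  - assert (H : forall x y, qdot c (x + y)%quat = qdot c x + qdot c y) by qring. exact H.
  - assert (H : forall (k : R) (x : quat), qdot c (scal k x) = k * qdot c x).
    { intros k x. rewrite scal_qreal. apply qdot_real_mul. }
    exact H.
  - exists (qnorm c + 1). split; [generalize (qnorm_ge0 c); lra|].
    intro x. change (Rabs (qdot c x) <= (qnorm c + 1) * norm (x : qmodule)). rewrite qnorm_norm.
    eapply Rle_trans; [apply qdot_bound|]. generalize (qnorm_ge0 x). nra.
Qed.

Lemma is_derive_qdot (c : quat) (F : R -> quat) (x : R) (l : quat) :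
  is_derive F x l -> is_derive (fun t => qdot c (F t)) x (qdot c l).
Proof.
  intros H.
  assert (H' := filterdiff_comp' (K := R_AbsRing) (U := AbsRing_NormedModule R_AbsRing) (V := qmodule) (W := R_NormedModule)
    F (qdot c) x (fun y => scal y l) (qdot c) H (filterdiff_linear _ (is_linear_qdot c))).
  eapply filterdiff_ext_lin; [exact H'|]. intro y. apply (linear_scal _ (is_linear_qdot c)).
Qed.

Lemma continuous_qdot (c : quat) {U : UniformSpace} (F : U -> quat) (x : U) :
  continuous F x -> continuous (fun t => qdot c (F t)) x.
Proof.
  intros H. apply (continuous_comp F (qdot c)); [exact H|].
  exact (filterdiff_continuous (U := qmodule) (V := R_NormedModule) (qdot c) (F x)
    (ex_intro _ (qdot c) (filterdiff_linear _ (is_linear_qdot c)))).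
Qed.

Lemma slice_ball_open (I : quat) (x y : R) : imag_unit I -> unit_ball (slice_point I x y) ->
  exists d : posreal, forall x' y', Rabs (x' - x) < d -> Rabs (y' - y) < d ->
    unit_ball (slice_point I x' y').
Proof.
  intros HI H.
  assert (Hd : 0 < (1 - qnorm (slice_point I x y)) / 2) by (unfold unit_ball in H; lra).
  exists (mkposreal _ Hd). cbn [pos]. intros x' y' Hx Hy. unfold unit_ball.
  rewrite (slice_point_diff I x y). eapply Rle_lt_trans; [apply qnorm_triangle|].
  assert (T := qnorm_slice_le I (x' - x) (y' - y) HI). lra.
Qed.

(** Holomorphy on the slice with derivative [D], expressed through real-valued
    functionals, so that the calculus of real functions of two variables applies. *)
Definition slice_holomorphic (I : quat) (F D : R -> R -> quat) : Prop :=
  forall x y, unit_ball (slice_point I x y) -> forall c,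
    filterdiff (fun u : R * R => qdot c (F (fst u) (snd u))) (locally (x, y))
      (fun u : R * R => qdot c (slice_point I (fst u) (snd u) * D x y)) /\
    continuous (fun u : R * R => qdot c (D (fst u) (snd u))) (x, y).

(** The Cauchy-Riemann equation says [dy = I dx], and continuous partial
    derivatives give differentiability. *)
Lemma slice_regular_holomorphic (f : quat -> quat) (I : quat) :
  slice_regular f -> imag_unit I ->
  exists D, slice_holomorphic I (fun x y => f (slice_point I x y)) D.
Proof.
  intros Hf HI. destruct (Hf I HI) as [dx [dy H]]. exists (fun x y => dx (x, y)).
  intros x y Hxy c. destruct (H x y Hxy) as [H1 [H2 [H3 [H4 H5]]]].
  assert (Edy : dy (x, y) = (I * dx (x, y))%quat).
  { assert (E : (dx (x, y) = - (I * dy (x, y)))%quat).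
    { clear -H5. revert H5. generalize (dx (x, y)) (I * dy (x, y))%quat. intros u v H.
      transitivity (qreal 2 * (qreal (1 / 2) * (u + v)) - v)%quat.
      - transitivity (qreal (2 * (1 / 2)) * (u + v) - v)%quat.
        + replace (2 * (1 / 2)) with 1 by field. clear. qring.
        + rewrite qmul_assoc, qreal_mul. reflexivity.
      - rewrite H. clear. qring. }
    rewrite E. transitivity (- (I * I * dy (x, y)))%quat.
    - rewrite HI. clear. generalize (dy (x, y)). qring.
    - clear. generalize (dy (x, y)). qring. }
  split.
  - destruct (slice_ball_open I x y HI Hxy) as [d Hd].
    assert (L : locally (x, y) (fun u : R * R => unit_ball (slice_point I (fst u) (snd u)))).
    { exists d. intros [x' y'] [A B]. now apply Hd. }
    assert (FD := is_derive_filterdiff (fun u v => qdot c (f (slice_point I u v))) x y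
      (fun u v => qdot c (dx (u, v))) (qdot c (dy (x, y)))).
    eapply filterdiff_ext_lin; [apply FD|].
    + eapply filter_imp; [|exact L]. intros [u v] Huv. cbn [fst snd] in *.
      apply (is_derive_qdot c (fun t => f (slice_point I t v))). now apply H.
    + apply (is_derive_qdot c (fun t => f (slice_point I x t))). exact H2.
    + apply (continuous_qdot c (fun u : R * R => dx (fst u, snd u))).
      apply (continuous_ext dx); [now intros [u v]|exact H3].
    + intros [u v]. cbn [fst snd]. rewrite qdot_slice, Edy, qdot_conj_mul. reflexivity.
  - apply (continuous_qdot c (fun u : R * R => dx (fst u, snd u))).
    apply (continuous_ext dx); [now intros [u v]|exact H3].
Qed.

(** Chain rule along a curve: the derivative is the velocity, seen in the slice,
    times [D]. *)
Lemma slice_chain (I : quat) (F D : R -> R -> quat) (X Y : R -> R) (t dX dY : R) (c : quat) :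
  slice_holomorphic I F D -> unit_ball (slice_point I (X t) (Y t)) ->
  is_derive X t dX -> is_derive Y t dY ->
  is_derive (fun s => qdot c (F (X s) (Y s))) t (qdot c (slice_point I dX dY * D (X t) (Y t))).
Proof.
  intros HF Hb HX HY. destruct (HF _ _ Hb c) as [FD _].
  assert (H := filterdiff_comp'_2 (K := R_AbsRing) (T := AbsRing_NormedModule R_AbsRing)
    (U := R_NormedModule) (V := R_NormedModule) (W := R_NormedModule) X Y
    (fun u v => qdot c (F u v)) t (fun s => scal s dX) (fun s => scal s dY)
    (fun u v => qdot c (slice_point I u v * D (X t) (Y t))%quat) HX HY FD).
  eapply filterdiff_ext_lin; [exact H|]. intro s. cbn [fst snd].
  change (qdot c (slice_point I (s * dX) (s * dY) * D (X t) (Y t)) =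
    s * qdot c (slice_point I dX dY * D (X t) (Y t))).
  rewrite !qdot_slice. ring.
Qed.

(** The exponential [e^(I t)]. *)
Definition expi (I : quat) (t : R) : quat := slice_point I (cos t) (sin t).

Lemma qnorm_expi (I : quat) (t : R) : imag_unit I -> qnorm (expi I t) = 1.
Proof.
  intros HI. rewrite qnorm_qnsq. unfold expi. rewrite qnsq_slice by easy.
  replace (cos t ^ 2 + sin t ^ 2) with 1; [apply sqrt_1|].
  generalize (sin2_cos2 t). unfold Rsqr. lra.
Qed.

(** The segments from [z] to the circle stay in the ball, with some room at both
    ends. *)
Lemma homotopy_in_ball (I : quat) (z1 z2 rho : R) : imag_unit I ->
  0 < rho < 1 -> qnorm (slice_point I z1 z2) < rho ->
  exists d, 0 < d /\ forall s t, - d < s < 1 + d ->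
    unit_ball (slice_point I (z1 + s * (rho * cos t - z1)) (z2 + s * (rho * sin t - z2))).
Proof.
  intros HI Hr Hz. exists ((1 - rho) / (2 * rho)). split; [apply Rdiv_lt_0_compat; lra|].
  intros s t Hs.
  replace (slice_point I _ _) with
    (qreal (1 - s) * slice_point I z1 z2 + qreal (s * rho) * expi I t)%quat
    by (unfold expi, slice_point; clear; generalize (cos t) (sin t); qring).
  unfold unit_ball. eapply Rle_lt_trans; [apply qnorm_triangle|].
  rewrite !qnorm_mul, !qnorm_real, Rabs_mult, (Rabs_pos_eq rho) by lra.
  rewrite (qnorm_expi I t HI), Rmult_1_r.
  assert (Hd : (1 - rho) / (2 * rho) * rho = (1 - rho) / 2) by (field; lra).
  set (d := (1 - rho) / (2 * rho)) in *.
  assert (Hd0 : 0 < d) by (unfold d; apply Rdiv_lt_0_compat; lra).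
  assert (N := qnorm_ge0 (slice_point I z1 z2)).
  assert (A : Rabs (1 - s) + Rabs s < 1 + 2 * d).
  { unfold Rabs; destruct (Rcase_abs (1 - s)), (Rcase_abs s); lra. }
  assert (P1 := Rabs_pos (1 - s)). assert (P2 := Rabs_pos s).
  apply Rle_lt_trans with ((Rabs (1 - s) + Rabs s) * rho); [nra|].
  apply Rlt_le_trans with ((1 + 2 * d) * rho); [nra|]. lra.
Qed.

Lemma continuous_slice_comp (I : quat) (F D : R -> R -> quat) (X Y : R * R -> R) (u : R * R) (c : quat) :
  slice_holomorphic I F D -> unit_ball (slice_point I (X u) (Y u)) ->
  continuous X u -> continuous Y u ->
  continuous (fun v => qdot c (D (X v) (Y v))) u.
Proof.
  intros HF Hb HX HY. destruct (HF _ _ Hb c) as [_ CD].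
  apply (continuous_comp_2 (U := prod_UniformSpace R_UniformSpace R_UniformSpace)
    (V := R_UniformSpace) (W := R_UniformSpace) (X := R_UniformSpace) X Y (fun x y => qdot c (D x y)) u HX HY CD).
Qed.

(** Cauchy's formula in weak form.  Shrink the circle to the point [z] along
    [z + s (rho e^(I t) - z)].  The kernel [k = rho e^(I t) / (rho e^(I t) - z)]
    cancels the velocity, so the derivative of the integral in [s] is the integral
    of [rho e^(I t) D].  But [s rho e^(I t) D] is, up to the factor [I], the
    derivative in [t] of [F] along a closed curve, hence it has integral [0]. *)
Lemma cauchy_homotopy (I : quat) (F D : R -> R -> quat) (z1 z2 rho : R) (k1 k2 : R -> R) (c : quat) :
  imag_unit I -> slice_holomorphic I F D ->
  0 < rho < 1 -> qnorm (slice_point I z1 z2) < rho ->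
  (forall t, continuous k1 t) -> (forall t, continuous k2 t) ->
  (forall t, slice_point I (k1 t) (k2 t) * slice_point I (rho * cos t - z1) (rho * sin t - z2) =
     qreal rho * expi I t)%quat ->
  RInt (fun t => qdot c (slice_point I (k1 t) (k2 t) * F (rho * cos t) (rho * sin t))) 0 (2 * PI) =
  RInt (fun t => qdot c (slice_point I (k1 t) (k2 t) * F z1 z2)) 0 (2 * PI).
Proof.
  intros HI HF Hr Hz Ck1 Ck2 Hk.
  destruct (homotopy_in_ball I z1 z2 rho HI Hr Hz) as [d [Hd Hin]].
  set (X := fun s t => z1 + s * (rho * cos t - z1)).
  set (Y := fun s t => z2 + s * (rho * sin t - z2)).
  set (h := fun s t => qdot c (slice_point I (k1 t) (k2 t) * F (X s t) (Y s t))).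
  set (P := fun s t => qdot c (qreal rho * expi I t * D (X s t) (Y s t))).
  assert (Hin' : forall s t, - d < s < 1 + d -> unit_ball (slice_point I (X s t) (Y s t))) by exact Hin.
  assert (Dh : forall s t, - d < s < 1 + d -> is_derive (fun s => h s t) s (P s t)).
  { intros s t Hs. unfold h.
    apply (is_derive_ext (fun s => qdot (qconj (slice_point I (k1 t) (k2 t)) * c) (F (X s t) (Y s t)))).
    { intro s'. symmetry. apply qdot_conj_mul. }
    replace (P s t) with (qdot (qconj (slice_point I (k1 t) (k2 t)) * c)
      (slice_point I (rho * cos t - z1) (rho * sin t - z2) * D (X s t) (Y s t))%quat).
    - apply (slice_chain I F D (fun s => X s t) (fun s => Y s t)); [easy|now apply Hin'| |].
      + unfold X. auto_derive; [easy|ring].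
      + unfold Y. auto_derive; [easy|ring].
    - rewrite <- qdot_conj_mul, qmul_assoc, Hk. reflexivity. }
  assert (Dt : forall s t, - d < s < 1 + d ->
    is_derive (fun t => qdot (I * c) (F (X s t) (Y s t))) t (s * P s t)).
  { intros s t Hs.
    replace (s * P s t) with (qdot (I * c) (slice_point I (s * (rho * - sin t)) (s * (rho * cos t)) * D (X s t) (Y s t))%quat).
    - apply (slice_chain I F D (X s) (Y s)); [easy|now apply Hin'| |].
      + unfold X. auto_derive; [easy|ring].
      + unfold Y. auto_derive; [easy|ring].
    - unfold P.
      replace (slice_point I (s * (rho * - sin t)) (s * (rho * cos t))) with (I * (qreal s * (qreal rho * expi I t)))%quat.
      + rewrite <- qmul_assoc, (qdot_conj_mul (I * c)), qmul_assoc, qmul_conj_l, <- qnorm_sq, (imag_unit_norm I HI).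
        replace (1 ^ 2) with 1 by ring. rewrite qmul_1l, <- qmul_assoc. apply qdot_real_mul.
      + unfold expi, slice_point.
        transitivity (qreal (s * rho * sin t) * (I * I) + qreal (s * rho * cos t) * I)%quat;
          [clear; generalize (cos t) (sin t); qring|].
        rewrite HI. clear. generalize (cos t) (sin t). qring. }
  assert (CP : forall s t, - d < s < 1 + d -> continuous (fun u : R * R => P (fst u) (snd u)) (s, t)).
  { intros s t Hs.
    assert (Cc : continuous (fun u : R * R => rho * cos (snd u)) (s, t)).
    { apply (continuous_comp snd (fun v => rho * cos v)); [apply continuous_snd|].
      apply (ex_derive_continuous (V := R_NormedModule)). auto_derive. easy. }
    assert (Cs : continuous (fun u : R * R => rho * sin (snd u)) (s, t)).
    { apply (continuous_comp snd (fun v => rho * sin v)); [apply continuous_snd|].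
      apply (ex_derive_continuous (V := R_NormedModule)). auto_derive. easy. }
    assert (CX : continuous (fun u : R * R => X (fst u) (snd u)) (s, t)).
    { unfold X. apply (continuous_plus (K := R_AbsRing) (V := R_NormedModule)); [apply continuous_const|].
      apply (continuous_mult (K := R_AbsRing)); [apply continuous_fst|].
      apply (continuous_minus (K := R_AbsRing) (V := R_NormedModule)); [exact Cc|apply continuous_const]. }
    assert (CY : continuous (fun u : R * R => Y (fst u) (snd u)) (s, t)).
    { unfold Y. apply (continuous_plus (K := R_AbsRing) (V := R_NormedModule)); [apply continuous_const|].
      apply (continuous_mult (K := R_AbsRing)); [apply continuous_fst|].
      apply (continuous_minus (K := R_AbsRing) (V := R_NormedModule)); [exact Cs|apply continuous_const]. }
    assert (CD : forall c', continuous (fun u : R * R => qdot c' (D (X (fst u) (snd u)) (Y (fst u) (snd u)))) (s, t)).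
    { intro c'. apply (continuous_slice_comp I F D (fun u => X (fst u) (snd u)) (fun u => Y (fst u) (snd u))); auto. }
    apply (continuous_ext (fun u : R * R => rho * cos (snd u) * qdot c (D (X (fst u) (snd u)) (Y (fst u) (snd u))) +
      rho * sin (snd u) * qdot (qconj I * c) (D (X (fst u) (snd u)) (Y (fst u) (snd u))))).
    { intros [u v]. cbn [fst snd]. unfold P. rewrite <- qmul_assoc, qdot_real_mul. unfold expi. rewrite qdot_slice.
      match goal with |- ?a = ?b => change (@eq R a b) end. ring. }
    apply (continuous_plus (K := R_AbsRing) (V := R_NormedModule));
      apply (continuous_mult (K := R_AbsRing)); auto. }
  assert (Ch : forall s t, - d < s < 1 + d -> continuous (h s) t).
  { intros s t Hs. unfold h.
    apply (continuous_ext (fun t => k1 t * qdot c (F (X s t) (Y s t)) + k2 t * qdot (qconj I * c) (F (X s t) (Y s t)))).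
    { intro t'. symmetry. apply qdot_slice. }
    assert (CF : forall c', continuous (fun t => qdot c' (F (X s t) (Y s t))) t).
    { intro c'. apply (ex_derive_continuous (V := R_NormedModule)). eexists.
      apply (slice_chain I F D (X s) (Y s)); [easy|now apply Hin'| |].
      - unfold X. auto_derive; [easy|reflexivity].
      - unfold Y. auto_derive; [easy|reflexivity]. }
    apply (continuous_plus (K := R_AbsRing) (V := R_NormedModule));
      apply (continuous_mult (K := R_AbsRing)); auto. }
  assert (CPt : forall s t, - d < s < 1 + d -> continuous (P s) t).
  { intros s t Hs. apply (continuous_comp_2 (fun _ => s) (fun t => t) P t).
    - apply continuous_const.
    - apply continuous_id.
    - now apply CP. }
  assert (HP : 0 <= 2 * PI) by (generalize PI_RGT_0; lra).
  assert (I0 : forall s, - d < s < 1 + d -> s <> 0 -> RInt (P s) 0 (2 * PI) = 0).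
  { intros s Hs Ns.
    assert (E1 : is_RInt (fun t => s * P s t) 0 (2 * PI) (minus (qdot (I * c) (F (X s (2 * PI)) (Y s (2 * PI)))) (qdot (I * c) (F (X s 0) (Y s 0))))).
    { apply (is_RInt_derive (V := R_CompleteNormedModule) (fun t => qdot (I * c) (F (X s t) (Y s t)))).
      - intros t _. now apply Dt.
      - intros t _. apply (continuous_mult (K := R_AbsRing)); [apply continuous_const|now apply CPt]. }
    assert (EP : ex_RInt (P s) 0 (2 * PI)).
    { apply (ex_RInt_continuous (V := R_CompleteNormedModule)). intros t _. now apply CPt. }
    assert (E2 : X s (2 * PI) = X s 0 /\ Y s (2 * PI) = Y s 0).
    { unfold X, Y. now rewrite cos_2PI, cos_0, sin_2PI, sin_0. }
    destruct E2 as [EX EY]. rewrite EX, EY in E1.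
    apply (is_RInt_unique (V := R_CompleteNormedModule)) in E1.
    assert (E3 := RInt_scal (V := R_CompleteNormedModule) (P s) 0 (2 * PI) s EP).
    assert (E4 : s * RInt (P s) 0 (2 * PI) = 0).
    { etransitivity; [symmetry; exact E3|]. etransitivity; [exact E1|].
      unfold minus, plus, opp; cbn. ring. }
    apply Rmult_integral in E4. tauto. }
  assert (DH : forall s, - d < s < 1 + d -> is_derive (fun s => RInt (h s) 0 (2 * PI)) s (RInt (P s) 0 (2 * PI))).
  { intros s Hs.
    assert (He : 0 < Rmin (s + d) (1 + d - s)) by (apply Rmin_glb_lt; lra).
    assert (Near : forall u, Rabs (u - s) < Rmin (s + d) (1 + d - s) -> - d < u < 1 + d).
    { intros u Hu. assert (M1 := Rmin_l (s + d) (1 + d - s)). assert (M2 := Rmin_r (s + d) (1 + d - s)).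
      apply Rabs_def2 in Hu. lra. }
    replace (RInt (P s) 0 (2 * PI)) with (RInt (fun t => Derive (fun u => h u t) s) 0 (2 * PI)).
    2:{ apply RInt_ext. intros t _. apply is_derive_unique. now apply Dh. }
    apply (is_derive_RInt_param h 0 (2 * PI) s).
    - exists (mkposreal _ He). intros u Hu t _. exists (P u t). apply Dh. apply Near. exact Hu.
    - intros t _. apply (continuity_2d_pt_ext_loc P).
      + exists (mkposreal _ He). intros u v Hu _. symmetry. apply is_derive_unique. apply Dh. now apply Near.
      + apply continuity_2d_pt_filterlim. now apply CP.
    - exists (mkposreal _ He). intros u Hu.
      apply (ex_RInt_continuous (V := R_CompleteNormedModule)). intros t _. apply Ch. apply Near. exact Hu. }
  (* the derivative vanishes on the open interval, which avoids s = 0 *)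
  destruct (MVT_gen (fun s => RInt (h s) 0 (2 * PI)) 0 1 (fun _ => 0)) as [s0 [_ E]].
  - rewrite Rmin_left, Rmax_right by lra. intros s Hs. 
    assert (E0 := DH s ltac:(lra)). rewrite I0 in E0 by lra. exact E0.
  - rewrite Rmin_left, Rmax_right by lra. intros s Hs. apply continuity_pt_filterlim.
    apply (ex_derive_continuous (V := R_NormedModule) (fun s => RInt (h s) 0 (2 * PI))).
    eexists. apply DH. lra.
  - transitivity (RInt (h 1) 0 (2 * PI)).
    + apply RInt_ext. intros t _. unfold h, X, Y. do 3 f_equal; ring.
    + transitivity (RInt (h 0) 0 (2 * PI)); [lra|].
      apply RInt_ext. intros t _. unfold h, X, Y. do 3 f_equal; ring.
Qed.

(** * Power series expansion *)

Definition qcont (G : R -> quat) : Prop :=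
  forall c t, continuous (fun t => qdot c (G t)) t.

Definition qRInt (G : R -> quat) : quat :=
  ((RInt (fun t => qdot ((1, 0), (0, 0)) (G t)) 0 (2 * PI),
    RInt (fun t => qdot ((0, 1), (0, 0)) (G t)) 0 (2 * PI)),
   (RInt (fun t => qdot ((0, 0), (1, 0)) (G t)) 0 (2 * PI),
    RInt (fun t => qdot ((0, 0), (0, 1)) (G t)) 0 (2 * PI))).

Lemma qcont_ex (G : R -> quat) (c : quat) : qcont G -> ex_RInt (fun t => qdot c (G t)) 0 (2 * PI).
Proof.
  intros H. apply (ex_RInt_continuous (V := R_CompleteNormedModule)). intros t _. apply H.
Qed.

Lemma qdot_qRInt (G : R -> quat) (c : quat) : qcont G ->
  qdot c (qRInt G) = RInt (fun t => qdot c (G t)) 0 (2 * PI).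
Proof.
  intros H. symmetry. apply (is_RInt_unique (V := R_CompleteNormedModule)).
  assert (E : forall e, is_RInt (fun t => qdot e (G t)) 0 (2 * PI) (RInt (fun t => qdot e (G t)) 0 (2 * PI))).
  { intro e. apply (RInt_correct (V := R_CompleteNormedModule)). now apply qcont_ex. }
  destruct c as [[a b] [c d]].
  assert (L := is_RInt_plus (V := R_NormedModule) _ _ _ _ _ _
    (is_RInt_plus (V := R_NormedModule) _ _ _ _ _ _
      (is_RInt_plus (V := R_NormedModule) _ _ _ _ _ _
        (is_RInt_scal (V := R_NormedModule) _ _ _ a _ (E ((1, 0), (0, 0))))
        (is_RInt_scal (V := R_NormedModule) _ _ _ b _ (E ((0, 1), (0, 0)))))
      (is_RInt_scal (V := R_NormedModule) _ _ _ c _ (E ((0, 0), (1, 0)))))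
    (is_RInt_scal (V := R_NormedModule) _ _ _ d _ (E ((0, 0), (0, 1))))).
  refine (is_RInt_ext (V := R_NormedModule) _ _ _ _ _ _ L). intros t _.
  generalize (G t). intros [[x1 x2] [x3 x4]].
  transitivity (a * (1 * x1 + 0 * x2 + 0 * x3 + 0 * x4) + b * (0 * x1 + 1 * x2 + 0 * x3 + 0 * x4) +
    c * (0 * x1 + 0 * x2 + 1 * x3 + 0 * x4) + d * (0 * x1 + 0 * x2 + 0 * x3 + 1 * x4)); [reflexivity|].
  cbn [qdot]. match goal with |- ?u = ?v => change (@eq R u v) end. ring.
Qed.

Lemma qRInt_eq (G : R -> quat) (v : quat) : qcont G ->
  (forall c, RInt (fun t => qdot c (G t)) 0 (2 * PI) = qdot c v) -> qRInt G = v.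
Proof. intros HG H. apply qdot_ext. intro c. rewrite qdot_qRInt by easy. apply H. Qed.

Lemma qRInt_ext (G H : R -> quat) : (forall t, G t = H t) -> qRInt G = qRInt H.
Proof. intros E. f_equal. now apply functional_extensionality. Qed.

Lemma qcont_ext (G H : R -> quat) : (forall t, G t = H t) -> qcont G -> qcont H.
Proof. intros E. apply functional_extensionality in E. now subst. Qed.

Lemma qcont_plus (G H : R -> quat) : qcont G -> qcont H -> qcont (fun t => G t + H t)%quat.
Proof.
  intros HG HH c t. apply (continuous_ext (fun t => qdot c (G t) + qdot c (H t))).
  - intro s. assert (E : forall u v, qdot c u + qdot c v = qdot c (u + v)%quat) by qring. apply E.
  - apply (continuous_plus (K := R_AbsRing) (V := R_NormedModule)); [apply HG|apply HH].
Qed.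

Lemma qcont_mul_l (q : quat) (G : R -> quat) : qcont G -> qcont (fun t => q * G t)%quat.
Proof.
  intros HG c t. apply (continuous_ext (fun t => qdot (qconj q * c) (G t))).
  - intro s. symmetry. apply qdot_conj_mul.
  - apply HG.
Qed.

Lemma qcont_slice (I : quat) (x y : R -> R) (G : R -> quat) :
  (forall t, continuous x t) -> (forall t, continuous y t) ->
  qcont G -> qcont (fun t => slice_point I (x t) (y t) * G t)%quat.
Proof.
  intros Hx Hy HG c t.
  apply (continuous_ext (fun t => x t * qdot c (G t) + y t * qdot (qconj I * c) (G t))).
  - intro s. symmetry. apply qdot_slice.
  - apply (continuous_plus (K := R_AbsRing) (V := R_NormedModule));
      apply (continuous_mult (K := R_AbsRing)); auto; apply HG.
Qed.

Lemma qRInt_plus (G H : R -> quat) : qcont G -> qcont H ->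
  qRInt (fun t => G t + H t)%quat = (qRInt G + qRInt H)%quat.
Proof.
  intros HG HH. apply qRInt_eq; [now apply qcont_plus|]. intro c.
  assert (E : forall u v, qdot c (u + v)%quat = qdot c u + qdot c v) by qring.
  rewrite E, !qdot_qRInt by easy.
  transitivity (RInt (fun t => qdot c (G t) + qdot c (H t)) 0 (2 * PI)).
  - apply RInt_ext. intros t _. apply E.
  - apply (RInt_plus (V := R_CompleteNormedModule)); now apply qcont_ex.
Qed.

Lemma qRInt_mul_l (q : quat) (G : R -> quat) : qcont G ->
  qRInt (fun t => q * G t)%quat = (q * qRInt G)%quat.
Proof.
  intros HG. apply qRInt_eq; [now apply qcont_mul_l|]. intro c.
  rewrite qdot_conj_mul, qdot_qRInt by easy. apply RInt_ext. intros t _. apply qdot_conj_mul.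
Qed.

Lemma qnorm_le_qdot (v : quat) (B : R) : 0 <= B ->
  (forall c, Rabs (qdot c v) <= B * qnorm c) -> qnorm v <= B.
Proof.
  intros HB H. specialize (H v).
  replace (qdot v v) with (qnorm v ^ 2) in H by (rewrite qnorm_sq; clear; qring).
  assert (N := qnorm_ge0 v). rewrite Rabs_pos_eq in H by nra.
  destruct (Req_dec (qnorm v) 0) as [E|E]; [lra|].
  apply (Rmult_le_reg_r (qnorm v)); [lra|]. lra.
Qed.

Lemma qRInt_bound (G : R -> quat) (B : R) : 0 <= B -> qcont G ->
  (forall t, 0 <= t <= 2 * PI -> qnorm (G t) <= B) -> qnorm (qRInt G) <= 2 * PI * B.
Proof.
  intros HB HG H. assert (P := PI_RGT_0).
  apply qnorm_le_qdot; [nra|]. intro c. rewrite qdot_qRInt by easy.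
  replace (2 * PI * B * qnorm c) with ((2 * PI - 0) * (qnorm c * B)) by ring.
  apply abs_RInt_le_const; [lra|now apply qcont_ex|].
  intros t Ht. eapply Rle_trans; [apply qdot_bound|].
  apply Rmult_le_compat_l; [apply qnorm_ge0|now apply H].
Qed.

Lemma qcont_bounded (G : R -> quat) : qcont G ->
  exists M, 0 <= M /\ forall t, 0 <= t <= 2 * PI -> qnorm (G t) <= M.
Proof.
  intros HG.
  assert (Hc : forall c, exists C, forall t, 0 <= t <= 2 * PI -> Rabs (qdot c (G t)) <= C).
  { intro c. destruct (bounded_continuity (K := R_AbsRing) (V := R_NormedModule) (fun t => qdot c (G t)) 0 (2 * PI)) as [C HC].
    - intros t _. apply HG.
    - exists C. intros t Ht. left. now apply HC. }
  destruct (Hc ((1,0),(0,0))) as [C1 H1], (Hc ((0,1),(0,0))) as [C2 H2],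
   (Hc ((0,0),(1,0))) as [C3 H3], (Hc ((0,0),(0,1))) as [C4 H4].
  assert (P := PI_RGT_0).
  assert (Hb : forall t, 0 <= t <= 2 * PI -> qnorm (G t) <= C1 + C2 + C3 + C4).
  { intros t Ht. specialize (H1 t Ht); specialize (H2 t Ht); specialize (H3 t Ht); specialize (H4 t Ht).
    eapply Rle_trans; [apply qnorm_le_components|]. lra. }
  exists (C1 + C2 + C3 + C4). split; [|exact Hb].
  eapply Rle_trans; [apply qnorm_ge0|apply (Hb 0); lra].
Qed.

Lemma qpow_mul_comm (p q : quat) (n : nat) :
  (p * q = q * p)%quat -> qpow (p * q) n = (qpow p n * qpow q n)%quat.
Proof.
  intros H. induction n as [|n IH]; cbn [qpow].
  - now rewrite qmul_1l.
  - rewrite IH, <- !qmul_assoc. f_equal. rewrite !qmul_assoc. f_equal.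
    symmetry. now apply qpow_commute.
Qed.

Lemma qconj_slice (I : quat) (x y : R) : imag_unit I ->
  qconj (slice_point I x y) = slice_point I x (- y).
Proof.
  intros HI. unfold slice_point.
  rewrite qconj_plus, qconj_mul, !qconj_real, imag_unit_conj by easy. clear. qring.
Qed.

Lemma slice_mul (I : quat) (x y x' y' : R) : imag_unit I ->
  (slice_point I x y * slice_point I x' y' = slice_point I (x * x' - y * y') (x * y' + y * x'))%quat.
Proof.
  intros HI. unfold slice_point.
  transitivity (qreal (x * x') + qreal (y * y') * (I * I) + qreal (x * y' + y * x') * I)%quat; [clear; qring|].
  rewrite HI. clear. qring.
Qed.

(** De Moivre's formula. *)
Lemma qpow_expi (I : quat) (t : R) (n : nat) : imag_unit I ->
  qpow (expi I t) n = expi I (INR n * t).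
Proof.
  intros HI. induction n as [|n IH].
  - unfold expi. cbn [qpow INR]. rewrite Rmult_0_l, cos_0, sin_0. unfold slice_point. clear. qring.
  - cbn [qpow]. rewrite IH. unfold expi. rewrite slice_mul by easy.
    rewrite S_INR. replace ((INR n + 1) * t) with (t + INR n * t) by ring.
    rewrite cos_plus, sin_plus. f_equal. ring.
Qed.

(** Up to the factor [2 pi], the Taylor coefficient that Cauchy's formula gives
    from the values [G] on the circle of radius [rho]. *)
Definition fourier_coeff (I : quat) (rho : R) (G : R -> quat) (n : nat) : quat :=
  (qreal (/ rho ^ n) * qRInt (fun t => qpow (qconj (expi I t)) n * G t))%quat.

Lemma cos_is_continuous (t : R) : continuous cos t.
Proof. apply (ex_derive_continuous (V := R_NormedModule)). auto_derive. easy. Qed.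

Lemma sin_is_continuous (t : R) : continuous sin t.
Proof. apply (ex_derive_continuous (V := R_NormedModule)). auto_derive. easy. Qed.

Lemma qcont_expi_pow (I : quat) (G : R -> quat) (n : nat) : imag_unit I -> qcont G ->
  qcont (fun t => qpow (qconj (expi I t)) n * G t)%quat.
Proof.
  intros HI HG. induction n as [|n IH].
  - apply (qcont_ext G); [|easy]. intro t. symmetry. apply qmul_1l.
  - apply (qcont_ext (fun t => slice_point I (cos t) (- sin t) * (qpow (qconj (expi I t)) n * G t))%quat).
    + intro t. cbn [qpow]. unfold expi at 2. now rewrite qconj_slice, qmul_assoc by easy.
    + apply (qcont_slice I (fun t => cos t) (fun t => - sin t)); [apply cos_is_continuous| |exact IH].
      intro t. apply (continuous_opp (K := R_AbsRing) (V := R_NormedModule)). apply sin_is_continuous.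
Qed.

(** The kernel satisfies [k = 1 + zeta k] with [zeta = z / (rho e^(I t))].
    Iterating this produces the partial sums and the remainder [zeta^(n+1) k]. *)
Lemma kernel_expansion (I : quat) (z1 z2 rho : R) (k1 k2 : R -> R) (G : R -> quat) :
  imag_unit I -> 0 < rho -> qnorm (slice_point I z1 z2) < rho ->
  (forall t, continuous k1 t) -> (forall t, continuous k2 t) ->
  (forall t, slice_point I (k1 t) (k2 t) * slice_point I (rho * cos t - z1) (rho * sin t - z2) =
     qreal rho * expi I t)%quat ->
  qcont G ->
  is_qseries (fourier_coeff I rho G) (slice_point I z1 z2)
    (qRInt (fun t => slice_point I (k1 t) (k2 t) * G t)%quat).
Proof.
  intros HI Hr Hz Ck1 Ck2 Hk HG.
  set (z := slice_point I z1 z2) in *.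
  set (k := fun t => slice_point I (k1 t) (k2 t)).
  set (zeta := fun t => (z * (qreal (/ rho) * qconj (expi I t)))%quat).
  assert (CG : qcont (fun t => k t * G t)%quat) by now apply qcont_slice.
  assert (Comm : forall t, (z * qconj (expi I t) = qconj (expi I t) * z)%quat).
  { intro t. unfold z, expi. rewrite qconj_slice by easy. apply slice_point_comm. }
  assert (Rec : forall t, k t = (qreal 1 + zeta t * k t)%quat).
  { intro t. specialize (Hk t). fold (k t) in Hk.
    assert (E : slice_point I (rho * cos t - z1) (rho * sin t - z2) = (qreal rho * expi I t - z)%quat).
    { unfold z, expi, slice_point. clear. generalize (cos t) (sin t). qring. }
    rewrite E, qmul_minus_r in Hk.
    assert (Kz : (k t * z = z * k t)%quat) by apply slice_point_comm.
    assert (Kc : (k t * expi I t = expi I t * k t)%quat) by apply slice_point_comm.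
    rewrite Kz in Hk.
    assert (E2 : (qreal (/ rho) * qconj (expi I t) * (qreal rho * expi I t) = qreal 1)%quat).
    { transitivity (qreal (/ rho * rho) * (qconj (expi I t) * expi I t))%quat.
      - generalize (expi I t). clear. qring.
      - rewrite qmul_conj_l, <- qnorm_sq, qnorm_expi, Rinv_l by (easy || lra).
        replace (1 ^ 2) with 1 by ring. apply qmul_1l. }
    transitivity (qreal (/ rho) * qconj (expi I t) * (qreal rho * expi I t) * k t)%quat;
      [rewrite E2; symmetry; apply qmul_1l|].
    transitivity (qreal (/ rho) * qconj (expi I t) * (k t * (qreal rho * expi I t)))%quat.
    { rewrite <- !qmul_assoc. do 2 f_equal. rewrite (qmul_assoc (k t)), qmul_real, <- !qmul_assoc, Kc. reflexivity. }
    assert (E3 : (k t * (qreal rho * expi I t) = qreal rho * expi I t + z * k t)%quat).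
    { transitivity ((k t * (qreal rho * expi I t) - z * k t) + z * k t)%quat; [|now rewrite Hk].
      generalize (k t * (qreal rho * expi I t))%quat (z * k t)%quat. clear. qring. }
    rewrite E3.
    rewrite qmul_plus_r, E2. f_equal. unfold zeta. rewrite !qmul_assoc. f_equal.
    rewrite <- (qmul_assoc (qreal (/ rho))), <- Comm. rewrite !qmul_assoc, qmul_real. reflexivity. }
  assert (Cz : forall H, qcont H -> qcont (fun t => zeta t * H t)%quat).
  { intros H HH. apply (qcont_ext (fun t => z * (qreal (/ rho) * (qpow (qconj (expi I t)) 1 * H t)))%quat).
    - intro t. unfold zeta. cbn [qpow]. now rewrite qmul_1r, !qmul_assoc.
    - now do 2 apply qcont_mul_l; apply qcont_expi_pow. }
  assert (Czn : forall n H, qcont H -> qcont (fun t => qpow (zeta t) n * H t)%quat).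
  { intros n H HH. induction n as [|n IH].
    - apply (qcont_ext H); [|easy]. intro t. symmetry. apply qmul_1l.
    - apply (qcont_ext (fun t => zeta t * (qpow (zeta t) n * H t))%quat); [|now apply Cz].
      intro t. cbn [qpow]. apply qmul_assoc. }
  set (J := fun n => qRInt (fun t => qpow (zeta t) n * (k t * G t))%quat).
  assert (JS : forall n, J n = (qpow z n * fourier_coeff I rho G n + J (S n))%quat).
  { intro n. unfold J.
    transitivity (qRInt (fun t => qpow (zeta t) n * G t + qpow (zeta t) (S n) * (k t * G t))%quat).
    - apply qRInt_ext. intro t. rewrite (Rec t) at 1.
      rewrite qmul_plus_l, qmul_1l, qmul_plus_r. f_equal. cbn [qpow].
      now rewrite qpow_comm, !qmul_assoc.
    - rewrite qRInt_plus by now apply Czn. f_equal.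
      unfold fourier_coeff.
      rewrite <- !qRInt_mul_l by (try apply qcont_mul_l; now apply qcont_expi_pow).
      apply qRInt_ext. intro t. unfold zeta.
      rewrite qpow_mul_comm.
      + rewrite qpow_mul_comm, qpow_real, pow_inv by apply eq_sym, qmul_real. now rewrite !qmul_assoc.
      + rewrite qmul_assoc, qmul_real, <- !qmul_assoc, Comm. reflexivity. }
  assert (J0 : forall n, qRInt (fun t => k t * G t)%quat =
    (qsum (fun m => qpow z m * fourier_coeff I rho G m)%quat n + J (S n))%quat).
  { induction n as [|n IH].
    - rewrite qsum_0, <- JS. apply qRInt_ext. intro t. symmetry. apply qmul_1l.
    - rewrite IH, (JS (S n)), qsum_S. apply plus_assoc. }
  destruct (qcont_bounded _ CG) as [M [HM0 HM]].
  assert (Hz0 := qnorm_ge0 z).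
  assert (Hx : 0 <= qnorm z / rho < 1).
  { split; [apply Rdiv_le_0_compat; lra|]. apply (Rmult_lt_reg_r rho); [lra|].
    unfold Rdiv. rewrite Rmult_assoc, Rinv_l by lra. lra. }
  assert (JB : forall n, qnorm (J n) <= 2 * PI * M * (qnorm z / rho) ^ n).
  { intro n. rewrite Rmult_assoc. apply qRInt_bound.
    - apply Rmult_le_pos; [easy|]. now apply pow_le.
    - now apply Czn.
    - intros t Ht. rewrite qnorm_mul, qnorm_pow. unfold zeta.
      rewrite !qnorm_mul, qnorm_conj, qnorm_expi, Rmult_1_r, qnorm_real by easy.
      rewrite Rabs_pos_eq by (left; now apply Rinv_0_lt_compat).
      rewrite Rmult_comm. apply Rmult_le_compat_r; [now apply pow_le|].
      rewrite <- qnorm_mul. now apply HM. }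
  unfold is_qseries. apply is_series_qlim. unfold qlim.
  change (fun t => slice_point I (k1 t) (k2 t) * G t)%quat with (fun t => k t * G t)%quat.
  apply (is_lim_seq_squeeze0 _ (fun n => 2 * PI * M * (qnorm z / rho) ^ S n)).
  - intro n; split; [apply qnorm_ge0|]. rewrite (J0 n).
    match goal with |- qnorm (minus ?x (plus ?x ?y)) <= _ =>
      replace (x - (x + y))%quat with (- y)%quat by (generalize x y; clear; qring) end.
    rewrite qnorm_opp. apply JB.
  - replace (Finite 0) with (Rbar_mult (2 * PI * M) 0) by (cbn; f_equal; ring).
    apply is_lim_seq_scal_l. apply (is_lim_seq_incr_1 (fun n => (qnorm z / rho) ^ n)).
    apply is_lim_seq_geom. rewrite Rabs_pos_eq; lra.
Qed.

(** Applied to constant data, the expansion yields the integral of the Cauchy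
    kernel. *)
Lemma fourier_coeff_const (I : quat) (rho : R) (g : quat) : imag_unit I -> 0 < rho ->
  fourier_coeff I rho (fun _ => g) = const (qreal (2 * PI) * g)%quat.
Proof.
  intros HI Hr. apply functional_extensionality; intro n.
  assert (Cg : qcont (fun _ => g)) by (intros c t; apply continuous_const).
  assert (Cn := qcont_expi_pow I _ n HI Cg).
  destruct n as [|n].
  - unfold fourier_coeff. cbn [pow const affine]. rewrite Rinv_1, qmul_1l.
    apply qRInt_eq; [easy|]. intro c. rewrite qdot_real_mul.
    transitivity (RInt (fun _ => qdot c g) 0 (2 * PI)).
    + apply RInt_ext. intros t _. cbn [qpow]. now rewrite qmul_1l.
    + etransitivity; [apply (RInt_const (V := R_CompleteNormedModule))|].
      change ((2 * PI - 0) * qdot c g = 2 * PI * qdot c g). ring.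
  - unfold fourier_coeff. replace (const (qreal (2 * PI) * g)%quat (S n)) with (qreal 0) by (now destruct n).
    replace (qRInt _) with (qreal 0); [apply qmul_0r|]. symmetry.
    apply qRInt_eq; [easy|]. intro c. replace (qdot c (qreal 0)) with 0 by (clear; qring).
    set (N := INR (S n)). assert (HN : N <> 0) by (unfold N; apply not_0_INR; lia).
    set (al := qdot c g). set (be := qdot (qconj I * c) g).
    apply (is_RInt_unique (V := R_CompleteNormedModule)).
    replace 0 with (minus (sin (N * (2 * PI)) / N * al + cos (N * (2 * PI)) / N * be) (sin (N * 0) / N * al + cos (N * 0) / N * be)) at 2.
    + apply (is_RInt_ext (V := R_NormedModule) (fun t => cos (N * t) * al - sin (N * t) * be)).
      * intros t _. rewrite qpow_conj, qpow_expi by easy. unfold expi. rewrite qconj_slice, qdot_slice by easy.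
        fold N al be. match goal with |- ?a = ?b => change (@eq R a b) end. ring.
      * apply (is_RInt_derive (V := R_CompleteNormedModule) (fun t => sin (N * t) / N * al + cos (N * t) / N * be)).
        -- intros t _. auto_derive; [easy|]. field. easy.
        -- intros t _. apply (ex_derive_continuous (V := R_NormedModule)). auto_derive. easy.
    + replace (N * (2 * PI)) with (0 + 2 * INR (S n) * PI) by (unfold N; ring).
      rewrite sin_period, cos_period, Rmult_0_r. unfold minus, plus, opp; cbn. ring.
Qed.

(** Cauchy's formula on the circle of radius [rho], with the kernel written in real
    and imaginary parts [k1], [k2] to have its continuity at hand. *)
Lemma slice_series (f : quat -> quat) (I : quat) (rho : R) :
  slice_regular f -> imag_unit I -> 0 < rho < 1 ->
  exists a, forall x y, qnorm (slice_point I x y) < rho ->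
    is_qseries a (slice_point I x y) (f (slice_point I x y)).
Proof.
  intros Hf HI Hr. destruct (slice_regular_holomorphic f I Hf HI) as [D HD].
  set (F := fun x y => f (slice_point I x y)) in *.
  set (G := fun t => F (rho * cos t) (rho * sin t)).
  assert (CG : qcont G).
  { intros c t. apply (ex_derive_continuous (V := R_NormedModule)). eexists.
    apply (slice_chain I F D (fun t => rho * cos t) (fun t => rho * sin t)); [easy| | | ].
    - replace (slice_point I (rho * cos t) (rho * sin t)) with (qreal rho * expi I t)%quat
        by (unfold expi, slice_point; clear; generalize (cos t) (sin t); qring).
      unfold unit_ball. rewrite qnorm_mul, qnorm_expi, qnorm_real, Rabs_pos_eq by (easy || lra). lra.
    - auto_derive; [easy|reflexivity].
    - auto_derive; [easy|reflexivity]. }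
  assert (P := PI_RGT_0).
  exists (fun n => qreal (/ (2 * PI)) * fourier_coeff I rho G n)%quat. intros z1 z2 Hz.
  set (w1 := fun t => rho * cos t - z1). set (w2 := fun t => rho * sin t - z2).
  assert (Hw : forall t, w1 t ^ 2 + w2 t ^ 2 <> 0).
  { intros t E. rewrite <- (qnsq_slice I) in E by easy. apply qnsq_eq0 in E.
    assert (E' : slice_point I z1 z2 = (qreal rho * expi I t)%quat).
    { transitivity (qreal rho * expi I t - slice_point I (w1 t) (w2 t))%quat.
      - unfold expi, w1, w2, slice_point. clear. generalize (cos t) (sin t). qring.
      - rewrite E. clear. generalize (expi I t). qring. }
    rewrite E', qnorm_mul, qnorm_expi, qnorm_real, Rabs_pos_eq in Hz by (easy || lra). lra. }
  set (k1 := fun t => rho * (cos t * w1 t + sin t * w2 t) / (w1 t ^ 2 + w2 t ^ 2)).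
  set (k2 := fun t => rho * (sin t * w1 t - cos t * w2 t) / (w1 t ^ 2 + w2 t ^ 2)).
  assert (Ck1 : forall t, continuous k1 t).
  { intro t. apply (ex_derive_continuous (V := R_NormedModule)). unfold k1, w1, w2. auto_derive. 
    specialize (Hw t). unfold w1, w2 in Hw. simpl in Hw. simpl. tauto. }
  assert (Ck2 : forall t, continuous k2 t).
  { intro t. apply (ex_derive_continuous (V := R_NormedModule)). unfold k2, w1, w2. auto_derive. 
    specialize (Hw t). unfold w1, w2 in Hw. simpl in Hw. simpl. tauto. }
  assert (Hk : forall t, (slice_point I (k1 t) (k2 t) * slice_point I (rho * cos t - z1) (rho * sin t - z2) =
     qreal rho * expi I t)%quat).
  { intro t. rewrite slice_mul by easy. fold (w1 t) (w2 t).
    replace (qreal rho * expi I t)%quat with (slice_point I (rho * cos t) (rho * sin t))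
      by (unfold expi, slice_point; clear; generalize (cos t) (sin t); qring).
    specialize (Hw t). f_equal; unfold k1, k2; field; exact Hw. }
  assert (EG := kernel_expansion I z1 z2 rho k1 k2 G HI (proj1 Hr) Hz Ck1 Ck2 Hk CG).
  assert (Cf : qcont (fun _ => F z1 z2)) by (intros c t; apply continuous_const).
  assert (E1 := kernel_expansion I z1 z2 rho k1 k2 _ HI (proj1 Hr) Hz Ck1 Ck2 Hk Cf).
  rewrite fourier_coeff_const in E1 by (easy || lra).
  assert (Zb : unit_ball (slice_point I z1 z2)) by (unfold unit_ball; lra).
  assert (E2 := affine_has_coeffs (qreal (2 * PI) * F z1 z2)%quat (qreal 0) _ Zb).
  fold (const (qreal (2 * PI) * F z1 z2)%quat) in E2.
  apply is_qseries_unique in E1, E2. rewrite E1 in E2.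
  assert (E3 : qRInt (fun t => slice_point I (k1 t) (k2 t) * G t)%quat =
    qRInt (fun t => slice_point I (k1 t) (k2 t) * F z1 z2)%quat).
  { apply qdot_ext. intro c. rewrite !qdot_qRInt by now apply qcont_slice.
    exact (cauchy_homotopy I F D z1 z2 rho k1 k2 c HI HD Hr Hz Ck1 Ck2 Hk). }
  rewrite E3, E2 in EG. unfold is_qseries in *. apply is_series_qlim in EG. apply is_series_qlim.
  apply (qlim_mul_l (qreal (/ (2 * PI)))) in EG.
  replace (qreal (/ (2 * PI)) * (qreal (2 * PI) * F z1 z2 + slice_point I z1 z2 * qreal 0))%quat with (F z1 z2) in EG.
  - eapply qlim_ext; [|exact EG]. intro n. cbn beta. rewrite <- qsum_mul_l. apply qsum_ext. intros m _.
    rewrite !qmul_assoc, qmul_real. reflexivity.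
  - rewrite qmul_0r, qmul_plus_r, qmul_0r, qmul_assoc, qreal_mul, Rinv_l by lra.
    generalize (F z1 z2). clear. qring.
Qed.

Lemma slice_decomposition (q : quat) : exists I x y, imag_unit I /\ q = slice_point I x y.
Proof.
  destruct q as [[a b] [c d]]. set (v := sqrt (b ^ 2 + c ^ 2 + d ^ 2)).
  assert (Hv : v ^ 2 = b ^ 2 + c ^ 2 + d ^ 2) by (apply pow2_sqrt; nra).
  clearbody v. destruct (Req_dec v 0) as [E|E].
  - exists ((0, 1), (0, 0)), a, 0. split.
    + unfold imag_unit. qreduce. repeat match goal with |- (_, _) = (_, _) => f_equal end; ring.
    + rewrite E in Hv. unfold slice_point. qreduce. repeat match goal with |- (_, _) = (_, _) => f_equal end; nra.
  - exists ((0, b / v), (c / v, d / v)), a, v. split.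
    + unfold imag_unit. qreduce. repeat match goal with |- (_, _) = (_, _) => f_equal end; try (field; exact E).
      transitivity (- ((b ^ 2 + c ^ 2 + d ^ 2) / v ^ 2)); [field; exact E|].
      rewrite <- Hv. field. exact E.
    + unfold slice_point. qreduce. repeat match goal with |- (_, _) = (_, _) => f_equal end; field; exact E.
Qed.

(** The coefficients found on one slice serve all slices and all radii, as all
    these expansions agree at real points. *)
Lemma slice_regular_has_coeffs (f : quat -> quat) :
  slice_regular f -> exists a, has_coeffs f a.
Proof.
  intros Hf. set (I0 := ((0, 1), (0, 0)) : quat).
  assert (HI0 : imag_unit I0) by (unfold imag_unit, I0; qreduce; repeat match goal with |- (_, _) = (_, _) => f_equal end; ring).
  destruct (slice_series f I0 (1 / 2) Hf HI0) as [a Ha]; [lra|].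
  exists a. intros q Hq. destruct (slice_decomposition q) as [I [x [y [HI ->]]]].
  set (q := slice_point I x y) in *. assert (Nq := qnorm_ge0 q). unfold unit_ball in Hq.
  destruct (slice_series f I ((1 + qnorm q) / 2) Hf HI) as [b Hb]; [lra|].
  assert (Real : forall J t, qreal t = slice_point J t 0) by (intros J t; unfold slice_point; clear; qring).
  replace a with b.
  - apply Hb. fold q. lra.
  - apply (is_qseries_coeffs_unique b a f (1 / 2)); [lra| |]; intros t Ht.
    + rewrite (Real I). apply Hb. rewrite <- Real, qnorm_real. lra.
    + rewrite (Real I0). apply Ha. rewrite <- Real, qnorm_real. lra.
Qed.

(** * Self-maps of the ball have Schur coefficients *)

(** Left multiplication by [b + i s] on the complexified quaternions, applied to
    [x + i y].  The square of its norm is [|b|^2 + |s|^2 + |V|], where [V] is twice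
    the imaginary part of [b conj(s)], and the unit [J] in the direction of [V]
    attains this value as [|b + J s|^2]. *)
Lemma stem_contraction (b s x y : quat) (k : R) :
  (forall J, imag_unit J -> qnsq (b + J * s)%quat <= k) ->
  qnsq (b * x - s * y)%quat + qnsq (b * y + s * x)%quat <= k * (qnsq x + qnsq y).
Proof.
  intros H.
  set (V := (b * qconj s - s * qconj b)%quat). set (V1 := (qconj s * b - qconj b * s)%quat).
  assert (HV : qnsq b + qnsq s + qnorm V <= k).
  { destruct (Req_dec (qnorm V) 0) as [E|E].
    - set (J := ((0, 1), (0, 0)) : quat).
      assert (HJ : imag_unit J) by (unfold imag_unit, J; qreduce; repeat match goal with |- (_, _) = (_, _) => f_equal end; ring).
      eapply Rle_trans; [|apply (H J HJ)]. rewrite E.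
      replace (qnsq (b + J * s)%quat) with (qnsq b + qnsq s + qdot V J)
        by (unfold V, J; clear; qring).
      apply qnorm_eq0 in E. rewrite E. unfold J. cbn [qdot qreal]. lra.
    - set (J := (qreal (/ qnorm V) * V)%quat).
      assert (HJ : imag_unit J).
      { unfold imag_unit, J.
        transitivity (qreal (/ qnorm V ^ 2) * (V * V))%quat.
        - rewrite <- pow_inv. generalize (/ qnorm V) V. clear. qring.
        - replace (V * V)%quat with (qreal (- qnsq V)) by (unfold V; clear; qring).
          rewrite qreal_mul, <- qnorm_sq. f_equal. field. exact E. }
      eapply Rle_trans; [|apply (H J HJ)].
      replace (qnsq (b + J * s)%quat) with (qnsq b + qnsq s + / qnorm V * qnsq V).
      + apply Req_le. rewrite <- (qnorm_sq V). field. exact E.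
      + transitivity (qnsq b + qnsq J * qnsq s + qdot V J).
        * rewrite <- (qnorm_sq J), (imag_unit_norm J HJ). unfold J.
          replace (qdot V (qreal (/ qnorm V) * V)) with (/ qnorm V * qnsq V); [ring|].
          generalize (/ qnorm V) V. clear. qring.
        * assert (E0 := imag_unit_re J HJ). clearbody J. unfold V. clear -E0.
          destruct J as [[j0 j1] [j2 j3]]. cbn in E0. subst j0. qring. }
  assert (EV : qnorm V1 = qnorm V).
  { rewrite !qnorm_qnsq. f_equal. unfold V, V1. clear. qring. }
  set (W := (y * qconj x - x * qconj y)%quat).
  replace (qnsq (b * x - s * y)%quat + qnsq (b * y + s * x)%quat) with
    ((qnsq b + qnsq s) * (qnsq x + qnsq y) - qdot V1 W) by (unfold V1, W; clear; qring).
  assert (HW : qnorm W <= qnsq x + qnsq y).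
  { unfold W. eapply Rle_trans; [apply qnorm_minus|]. rewrite !qnorm_mul, !qnorm_conj.
    rewrite <- (qnorm_sq x), <- (qnorm_sq y).
    assert (Q := pow2_ge_0 (qnorm x - qnorm y)). lra. }
  assert (B := qdot_bound V1 W). rewrite EV in B.
  assert (B2 : - qdot V1 W <= qnorm V * qnorm W).
  { eapply Rle_trans; [|exact B]. rewrite <- Rabs_Ropp. apply Rle_abs. }
  assert (N := qnorm_ge0 V). assert (X := qnsq_ge0 x). assert (Y := qnsq_ge0 y). nra.
Qed.

(** The angles of the [n + 1] equidistant points of the circle; a finite average over
    them replaces the integral in Parseval's identity. *)
Definition node (n k : nat) : R := 2 * PI * INR k / INR (S n).

(** Multiplication by [2 sin(x / 2)] makes the sum telescope. *)
Lemma cos_sum (x : R) (n : nat) :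
  2 * sin (x / 2) * rsum (fun k => cos (INR k * x)) n = sin (INR n * x + x / 2) + sin (x / 2).
Proof.
  induction n as [|n IH].
  - rewrite rsum_0. cbn [INR]. rewrite Rmult_0_l, cos_0, Rplus_0_l. ring.
  - rewrite rsum_S, Rmult_plus_distr_l, IH, S_INR.
    assert (E : sin ((INR n + 1) * x + x / 2) - sin (INR n * x + x / 2) = 2 * sin (x / 2) * cos ((INR n + 1) * x)).
    { replace (INR n * x + x / 2) with ((INR n + 1) * x - x / 2) by field.
      rewrite sin_plus, sin_minus. ring. }
    lra.
Qed.

Lemma node_orthogonal (n j : nat) : (0 < j <= n)%nat ->
  rsum (fun k => cos (INR j * node n k)) n = 0.
Proof.
  intros Hj. set (x := 2 * PI * INR j / INR (S n)).
  assert (Hn : 0 < INR (S n)) by (apply lt_0_INR; lia).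
  assert (HS := cos_sum x n).
  replace (INR n * x + x / 2) with (- (x / 2) + 2 * INR j * PI) in HS.
  2:{ unfold x. rewrite S_INR in *. field. lra. }
  rewrite sin_period, sin_neg in HS.
  assert (Hsin : 0 < sin (x / 2)).
  { assert (P := PI_RGT_0). assert (Hj0 : 0 < INR j) by (apply lt_0_INR; lia).
    assert (Hjn : INR j < INR (S n)) by (apply lt_INR; lia).
    replace (x / 2) with (PI * (INR j / INR (S n))) by (unfold x; field; lra).
    assert (R0 : 0 < INR j / INR (S n)) by (apply Rdiv_lt_0_compat; lra).
    assert (R1 : INR j / INR (S n) < 1).
    { apply (Rmult_lt_reg_r (INR (S n))); [lra|]. unfold Rdiv. rewrite Rmult_assoc, Rinv_l; lra. }
    apply sin_gt_0; nra. }
  rewrite (rsum_ext _ (fun k => cos (INR k * x))).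
  - nra.
  - intros k _. f_equal. unfold node, x. field. lra.
Qed.

Definition cos_poly (p : nat -> quat) (n : nat) (t : R) : quat :=
  qsum (fun m => qreal (cos (INR m * t)) * p m)%quat n.

Definition sin_poly (p : nat -> quat) (n : nat) (t : R) : quat :=
  qsum (fun m => qreal (sin (INR m * t)) * p m)%quat n.

Lemma rsum_swap (F : nat -> nat -> R) (m n : nat) :
  rsum (fun k => rsum (F k) m) n = rsum (fun l => rsum (fun k => F k l) n) m.
Proof. apply (sum_n_switch F n m). Qed.

Lemma rsum_const (c : R) (n : nat) : rsum (fun _ => c) n = INR (S n) * c.
Proof. apply (sum_n_const n c). Qed.

(** The cross terms that arise when a monomial [e^(iu) v] is added to a polynomial
    involve only differences of angles. *)
Lemma trig_poly_cross (p : nat -> quat) (n : nat) (t u : R) (v : quat) :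
  cos u * qdot (cos_poly p n t) v + sin u * qdot (sin_poly p n t) v =
  rsum (fun m => cos (u - INR m * t) * qdot (p m) v) n.
Proof.
  unfold cos_poly, sin_poly.
  assert (E : forall a b w, qdot (a + b)%quat w = qdot a w + qdot b w) by qring.
  assert (E2 : forall r a w, qdot (qreal r * a)%quat w = r * qdot a w) by qring.
  induction n as [|n IH].
  - rewrite !qsum_0, rsum_0, !E2, cos_minus. ring.
  - rewrite !qsum_S, rsum_S, !E, !E2, <- IH, cos_minus. ring.
Qed.

(** By induction on the degree; each new monomial is orthogonal to the previous
    ones as long as the degree does not exceed [d]. *)
Lemma discrete_parseval (p : nat -> quat) (d n : nat) : (n <= d)%nat ->
  rsum (fun k => qnsq (cos_poly p n (node d k)) + qnsq (sin_poly p n (node d k))) d =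
  INR (S d) * sqsum p n.
Proof.
  assert (E2 : forall r a, qnsq (qreal r * a)%quat = r ^ 2 * qnsq a) by qring.
  assert (CS : forall x, cos x ^ 2 + sin x ^ 2 = 1).
  { intro x. generalize (sin2_cos2 x). unfold Rsqr. lra. }
  intros Hn. induction n as [|n IH].
  - rewrite sqsum_0, <- rsum_const. apply rsum_ext. intros k _.
    unfold cos_poly, sin_poly. rewrite !qsum_0, !E2, <- Rmult_plus_distr_r, CS. ring.
  - rewrite sqsum_S, Rmult_plus_distr_l, <- IH by lia. clear IH.
    rewrite <- rsum_const.
    set (cross := fun k => rsum (fun m => cos (INR (S n) * node d k - INR m * node d k) * qdot (p m) (p (S n))) n).
    rewrite (rsum_ext _ (fun k => (qnsq (cos_poly p n (node d k)) + qnsq (sin_poly p n (node d k)))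
      + (qnsq (p (S n)) + 2 * cross k))).
    + rewrite !rsum_plus, rsum_mul_l.
      replace (rsum cross d) with 0; [ring|].
      unfold cross. rewrite rsum_swap.
      symmetry. rewrite (rsum_ext _ (fun _ => 0)); [rewrite rsum_const; ring|].
      intros m Hm.
      rewrite (rsum_ext _ (fun k => qdot (p m) (p (S n)) * cos (INR (S n - m) * node d k))).
      * rewrite rsum_mul_l, node_orthogonal by lia. ring.
      * intros k _. rewrite minus_INR by lia. rewrite Rmult_minus_distr_r. ring.
    + intros k _. unfold cross. rewrite <- trig_poly_cross.
      unfold cos_poly at 1, sin_poly at 1. rewrite !qsum_S. fold (cos_poly p n (node d k)) (sin_poly p n (node d k)).
      assert (E : forall a r b, qnsq (a + qreal r * b)%quat = qnsq a + r ^ 2 * qnsq b + 2 * (r * qdot a b)) by qring.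
      rewrite !E.
      transitivity (qnsq (cos_poly p n (node d k)) + qnsq (sin_poly p n (node d k)) +
        ((cos (INR (S n) * node d k) ^ 2 + sin (INR (S n) * node d k) ^ 2) * qnsq (p (S n)) +
        2 * (cos (INR (S n) * node d k) * qdot (cos_poly p n (node d k)) (p (S n)) +
        sin (INR (S n) * node d k) * qdot (sin_poly p n (node d k)) (p (S n))))); [ring|].
      rewrite CS. ring.
Qed.

Lemma qsum_support (u : nat -> quat) (n m : nat) :
  (forall k, (n < k)%nat -> u k = qreal 0) -> (n <= m)%nat -> qsum u m = qsum u n.
Proof.
  intros H. induction 1 as [|m Hm IH]; [easy|].
  rewrite qsum_S, IH, H by lia. generalize (qsum u n). clear. qring.
Qed.

(** At the point [e^(it)], with the central imaginary unit [i] of the complexified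
    quaternions, convolution becomes the pointwise product. *)
Lemma trig_poly_mul (a c : nat -> quat) (K N : nat) (t : R) :
  (forall k, (K < k)%nat -> a k = qreal 0) -> (forall k, (N < k)%nat -> c k = qreal 0) ->
  cos_poly (conv a c) (K + N) t =
    (cos_poly a K t * cos_poly c N t - sin_poly a K t * sin_poly c N t)%quat /\
  sin_poly (conv a c) (K + N) t =
    (cos_poly a K t * sin_poly c N t + sin_poly a K t * cos_poly c N t)%quat.
Proof.
  intros Ha Hc.
  assert (Tri : forall g : R -> R,
    qsum (fun m => qreal (g (INR m * t)%R) * conv a c m)%quat (K + N) =
    qsum (fun l => qsum (fun j => qreal (g (INR l * t + INR j * t)%R) * (a j * c l))%quat K) N).
  { intro g.
    rewrite (qsum_ext _ (fun m => qsum (fun l =>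
      (fun l j => qreal (g (INR l * t + INR j * t)%R) * (a j * c l))%quat l (m - l)%nat) m)).
    - rewrite (qsum_triangle (fun l j => qreal (g (INR l * t + INR j * t)%R) * (a j * c l))%quat).
      rewrite (qsum_support _ N).
      + apply qsum_ext. intros l Hl. apply qsum_support; [|lia].
        intros j Hj. rewrite Ha by easy. now rewrite qmul_0l, qmul_0r.
      + intros l Hl. rewrite Hc by easy.
        rewrite (qsum_ext _ (fun j => qreal 0 * qreal 0)%quat).
        * rewrite qsum_mul_l. apply qmul_0l.
        * intros j _. now rewrite !qmul_0r.
      + lia.
    - intros m _. unfold conv. rewrite <- qsum_mul_l. apply qsum_ext. intros l Hl. cbv beta.
      replace (INR m * t) with (INR l * t + INR (m - l) * t); [reflexivity|].
      rewrite minus_INR by easy. ring. }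
  assert (Prod : forall g h : R -> R,
    (qsum (fun j => qreal (g (INR j * t)%R) * a j)%quat K * qsum (fun l => qreal (h (INR l * t)%R) * c l)%quat N =
    qsum (fun l => qsum (fun j => qreal (g (INR j * t)%R * h (INR l * t)%R) * (a j * c l))%quat K) N)%quat).
  { intros g h. rewrite <- qsum_mul_l. apply qsum_ext. intros l _.
    rewrite <- qsum_mul_r. apply qsum_ext. intros j _. rewrite <- qreal_mul.
    generalize (a j) (c l) (g (INR j * t)%R) (h (INR l * t)%R). clear. qring. }
  assert (Neg : forall u v : quat, (u - v = u + qreal (-1) * v)%quat) by qring.
  unfold cos_poly, sin_poly. rewrite !Tri, !Prod. split.
  - rewrite Neg, <- qsum_mul_l, <- qsum_plus. apply qsum_ext. intros l _.
    rewrite <- qsum_mul_l, <- qsum_plus. apply qsum_ext. intros j _.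
    rewrite cos_plus. generalize (a j * c l)%quat (cos (INR j * t)) (cos (INR l * t)) (sin (INR j * t)) (sin (INR l * t)).
    clear. qring.
  - rewrite <- qsum_plus. apply qsum_ext. intros l _. rewrite <- qsum_plus. apply qsum_ext. intros j _.
    rewrite sin_plus. generalize (a j * c l)%quat (cos (INR j * t)) (cos (INR l * t)) (sin (INR j * t)) (sin (INR l * t)).
    clear. qring.
Qed.

(** The Taylor polynomial of order [K] of [f(rho q)]. *)
Definition truncate (K : nat) (rho : R) (a : nat -> quat) (m : nat) : quat :=
  if (m <=? K)%nat then (qreal (rho ^ m) * a m)%quat else qreal 0.

Lemma truncate_le (K : nat) (rho : R) (a : nat -> quat) (m : nat) :
  (m <= K)%nat -> truncate K rho a m = (qreal (rho ^ m) * a m)%quat.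
Proof. intros H. unfold truncate. now rewrite (proj2 (Nat.leb_le m K) H). Qed.

Lemma truncate_gt (K : nat) (rho : R) (a : nat -> quat) (m : nat) :
  (K < m)%nat -> truncate K rho a m = qreal 0.
Proof. intros H. unfold truncate. now rewrite (proj2 (Nat.leb_gt m K) H). Qed.

(** At the point [rho e^(J t)] of the ball, the partial sum differs from the value
    of [f] by at most the tail of the series of norms. *)
Lemma partial_sum_bound (f : quat -> quat) (a : nat -> quat) (rho eps : R) (K : nat) (J : quat) (t : R) :
  has_coeffs f a -> (forall q, unit_ball q -> unit_ball (f q)) -> 0 <= rho < 1 ->
  Series (fun m => qnorm (a m) * rho ^ m) - rsum (fun m => qnorm (a m) * rho ^ m) K <= eps ->
  imag_unit J ->
  qnorm (cos_poly (truncate K rho a) K t + J * sin_poly (truncate K rho a) K t)%quat <= 1 + eps.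
Proof.
  intros Ha Hf Hr Heps HJ. set (q := (qreal rho * expi J t)%quat).
  assert (Nq : qnorm q = rho).
  { unfold q. rewrite qnorm_mul, qnorm_expi, qnorm_real, Rabs_pos_eq by (easy || lra). ring. }
  assert (Bq : unit_ball q) by (unfold unit_ball; lra).
  assert (Bs : ex_series (fun m => qnorm (a m) * rho ^ m)) by (apply (has_coeffs_summable f a Ha); lra).
  assert (En : forall m, qnorm (a m) * rho ^ m = qnorm (qpow q m * a m)%quat).
  { intro m. rewrite qnorm_mul, qnorm_pow, Nq. ring. }
  assert (HS : is_series (fun m => qnorm (qpow q m * a m)%quat) (Series (fun m => qnorm (a m) * rho ^ m))).
  { eapply is_series_ext; [|apply Series_correct, Bs]. exact En. }
  assert (T := qnorm_series_tail _ _ _ K (Ha q Bq) HS). cbv beta in T.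
  rewrite <- (rsum_ext _ _ K (fun k _ => En k)) in T.
  replace (cos_poly _ K t + J * sin_poly _ K t)%quat with (qsum (fun m => qpow q m * a m)%quat K).
  - assert (F := Hf q Bq). unfold unit_ball in F.
    replace (qsum (fun m => qpow q m * a m)%quat K) with (f q - (f q - qsum (fun m => qpow q m * a m)%quat K))%quat
      by (generalize (f q) (qsum (fun m => qpow q m * a m)%quat K); clear; qring).
    eapply Rle_trans; [apply qnorm_minus|]. lra.
  - unfold cos_poly, sin_poly. rewrite <- qsum_mul_l, <- qsum_plus. apply qsum_ext. intros m Hm.
    rewrite truncate_le by easy. unfold q. rewrite qpow_mul_comm, qpow_real, qpow_expi by (easy || apply eq_sym, qmul_real).
    unfold expi, slice_point. generalize (rho ^ m) (a m) (cos (INR m * t)) (sin (INR m * t)). clear. qring.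
Qed.

Lemma sqsum_ext (u v : nat -> quat) (n : nat) :
  (forall k, (k <= n)%nat -> u k = v k) -> sqsum u n = sqsum v n.
Proof. intros H. apply rsum_ext. intros k Hk. now rewrite H. Qed.

Lemma conv_scaled (a c : nat -> quat) (rho : R) (m : nat) :
  conv (fun k => qreal (rho ^ k) * a k)%quat (fun k => qreal (rho ^ k) * c k)%quat m =
  (qreal (rho ^ m) * conv a c m)%quat.
Proof.
  unfold conv. rewrite <- qsum_mul_l. apply qsum_ext. intros l Hl.
  replace (rho ^ m) with (rho ^ (m - l) * rho ^ l) by (rewrite <- pow_add; f_equal; lia).
  generalize (rho ^ (m - l)) (rho ^ l) (a (m - l)%nat) (c l). clear. qring.
Qed.

(** On the nodes, [stem_contraction] bounds the product of the truncated polynomials,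
    and Parseval's identity sums these bounds.  The truncation order is sent to
    infinity first, then the radius to [1]. *)
Lemma self_map_schur (f : quat -> quat) (a : nat -> quat) :
  has_coeffs f a -> (forall q, unit_ball q -> unit_ball (f q)) -> schur a.
Proof.
  intros Ha Hf c N.
  assert (S1 : forall rho K, 0 <= rho < 1 -> (N <= K)%nat ->
    sqsum (fun m => qreal (rho ^ m) * conv a c m)%quat N <=
    (1 + (Series (fun m => qnorm (a m) * rho ^ m) - rsum (fun m => qnorm (a m) * rho ^ m) K)) ^ 2 * sqsum c N).
  { intros rho K Hr HK. set (eps := Series _ - _).
    set (al := truncate K rho a). set (ga := truncate N rho c). set (p := conv al ga). set (d := (K + N)%nat).
    assert (Pt : forall t, qnsq (cos_poly p d t) + qnsq (sin_poly p d t) <=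
      (1 + eps) ^ 2 * (qnsq (cos_poly ga N t) + qnsq (sin_poly ga N t))).
    { intro t. destruct (trig_poly_mul al ga K N t) as [E1 E2];
        [intros; now apply truncate_gt|intros; now apply truncate_gt|].
      unfold p, d. rewrite E1, E2. apply stem_contraction. intros J HJ.
      rewrite <- qnorm_sq. apply pow_incr. split; [apply qnorm_ge0|].
      apply (partial_sum_bound f); auto. apply Rle_refl. }
    assert (Sum : INR (S d) * sqsum p d <= INR (S d) * ((1 + eps) ^ 2 * sqsum ga N)).
    { rewrite <- discrete_parseval by lia.
      rewrite <- Rmult_assoc, (Rmult_comm (INR (S d))), Rmult_assoc, <- discrete_parseval by (unfold d; lia).
      rewrite <- rsum_mul_l. apply rsum_le. intros k _. apply Pt. }
    apply Rmult_le_reg_l in Sum; [|apply lt_0_INR; lia].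
    apply Rle_trans with (sqsum p d).
    - replace (sqsum (fun m => qreal (rho ^ m) * conv a c m)%quat N) with (sqsum p N); [apply sqsum_incr; unfold d; lia|].
      apply sqsum_ext. intros m Hm. rewrite <- conv_scaled. apply conv_ext_le; intros k Hk; apply truncate_le; lia.
    - eapply Rle_trans; [exact Sum|]. apply Rmult_le_compat_l; [apply pow2_ge_0|].
      apply rsum_le. intros k Hk. unfold ga. rewrite truncate_le, qnsq_mul, qnsq_real by easy.
      assert (0 <= rho ^ k <= 1).
      { split; [apply pow_le; lra|]. rewrite <- (pow1 k). apply pow_incr. lra. }
      assert (Q := qnsq_ge0 (c k)). revert H. generalize (rho ^ k). intros x Hx.
      assert (x ^ 2 <= 1) by nra. nra. }
  (* the tail eps of the series of norms tends to 0 *)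
  assert (S2 : forall rho, 0 <= rho < 1 -> sqsum (fun m => qreal (rho ^ m) * conv a c m)%quat N <= sqsum c N).
  { intros rho Hr. set (L := Series (fun m => qnorm (a m) * rho ^ m)).
    assert (HL : is_lim_seq (rsum (fun m => qnorm (a m) * rho ^ m)) L).
    { apply Series_correct. apply (has_coeffs_summable f a Ha). lra. }
    assert (Lim : is_lim_seq (fun K => (1 + (L - rsum (fun m => qnorm (a m) * rho ^ m) K)) ^ 2 * sqsum c N)
      ((1 + (L - L)) * ((1 + (L - L)) * 1) * sqsum c N)).
    { apply is_lim_seq_mult'; [|apply is_lim_seq_const]. cbn [pow].
      assert (L1 : is_lim_seq (fun K => 1 + (L - rsum (fun m => qnorm (a m) * rho ^ m) K)) (1 + (L - L))).
      { apply is_lim_seq_plus'; [apply is_lim_seq_const|].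
        apply is_lim_seq_minus'; [apply is_lim_seq_const|exact HL]. }
      apply is_lim_seq_mult'; [exact L1|]. apply is_lim_seq_mult'; [exact L1|apply is_lim_seq_const]. }
    replace ((1 + (L - L)) * ((1 + (L - L)) * 1) * sqsum c N) with (sqsum c N) in Lim by ring.
    apply (is_lim_seq_le_loc (fun _ => sqsum (fun m => qreal (rho ^ m) * conv a c m)%quat N) _
      (sqsum (fun m => qreal (rho ^ m) * conv a c m)%quat N) (sqsum c N)) with (2 := is_lim_seq_const _) (3 := Lim).
    exists N. intros K HK. now apply S1. }
  assert (S3 : forall i, (1 - / INR (S (S i))) ^ (2 * N) * sqsum (conv a c) N <= sqsum c N).
  { intro i. set (rho := 1 - / INR (S (S i))).
    assert (Hi : 1 < INR (S (S i))) by (apply (lt_INR 1); lia).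
    assert (Hr : 0 <= rho < 1).
    { unfold rho. assert (0 < / INR (S (S i))) by (apply Rinv_0_lt_compat; lra).
      assert (/ INR (S (S i)) < 1) by (rewrite <- Rinv_1; apply Rinv_lt_contravar; lra). lra. }
    eapply Rle_trans; [|apply (S2 rho Hr)].
    unfold sqsum. rewrite <- rsum_mul_l. apply rsum_le. intros m Hm.
    rewrite qnsq_mul, qnsq_real. apply Rmult_le_compat_r; [apply qnsq_ge0|].
    rewrite <- pow_mult, (Nat.mul_comm m 2).
    replace (2 * N)%nat with (2 * m + 2 * (N - m))%nat by lia. rewrite pow_add.
    rewrite <- (Rmult_1_r (rho ^ (2 * m))) at 2.
    apply Rmult_le_compat_l; [apply pow_le; lra|]. rewrite <- (pow1 (2 * (N - m))). apply pow_incr. lra. }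
  assert (L0 : is_lim_seq (fun i => 1 - / INR (S (S i))) 1).
  { replace (Finite 1) with (Finite (1 - 0)) by (f_equal; ring).
    apply is_lim_seq_minus'; [apply is_lim_seq_const|].
    apply (is_lim_seq_incr_1 (fun i => / INR (S i))). apply (is_lim_seq_incr_1 (fun i => / INR i)).
    apply (is_lim_seq_inv INR p_infty); [apply is_lim_seq_INR|easy]. }
  assert (L1 : is_lim_seq (fun i => (1 - / INR (S (S i))) ^ (2 * N) * sqsum (conv a c) N) (1 ^ (2 * N) * sqsum (conv a c) N)).
  { apply (is_lim_seq_continuous (fun x => x ^ (2 * N) * sqsum (conv a c) N) _ 1); [|exact L0].
    apply derivable_continuous_pt. apply ex_derive_Reals_0. auto_derive. easy. }
  rewrite pow1, Rmult_1_l in L1.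
  apply (is_lim_seq_le _ (fun _ => sqsum c N) (sqsum (conv a c) N) (sqsum c N) S3 L1). apply is_lim_seq_const.
Qed.

(** * Dieudonne's bound *)

(** The factors of the hyperbolic difference quotient have coefficients
    [1 - q conj(p)], [rho] and the inverse of [1 - conj(f(p)) a]. *)
Lemma hyp_diff_quotient_coeffs (f : quat -> quat) (a rho : nat -> quat) (p : quat) :
  has_coeffs f a -> schur a -> a 0%nat = qreal 0 -> unit_ball (f p) ->
  has_coeffs (diff_quotient f p) rho ->
  has_coeffs (hyp_diff_quotient f p)
    (conv (conv (affine (qreal 1) (- qconj p)%quat) rho) (geom (fun m => qconj (f p) * a m)%quat)).
Proof.
  intros Ha Sa a0 Hfp Hrho. unfold hyp_diff_quotient.
  set (b := (fun m => qconj (f p) * a m)%quat).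
  assert (Hb : b 0%nat = qreal 0) by (unfold b; rewrite a0; apply qmul_0r).
  apply star_has_coeffs.
  - apply star_has_coeffs; [|exact Hrho].
    apply has_coeffs_ext with (fun q => qreal 1 + q * - qconj p)%quat; [|apply affine_has_coeffs].
    intros q _. qring.
  - apply (star_inv_has_coeffs _ (fun m => delta m - b m)%quat).
    + assert (Hc : has_coeffs (fun _ => qconj (f p)) (const (qconj (f p)))).
      { eapply has_coeffs_ext; [|apply (affine_has_coeffs (qconj (f p)) (qreal 0))].
        intros q _. cbv beta. rewrite qmul_0r. generalize (qconj (f p)). clear. qring. }
      assert (H1 := star_has_coeffs _ _ _ _ Hc Ha). rewrite conv_const_l in H1. fold b in H1.
      assert (H2 := plus_has_coeffs _ _ _ _ (affine_has_coeffs (qreal 1) (qreal 0))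
        (mul_l_has_coeffs_real (-1) _ _ H1)).
      replace (fun m => delta m - b m)%quat with
        (fun m => affine (qreal 1) (qreal 0) m + qreal (-1) * b m)%quat.
      * eapply has_coeffs_ext; [|exact H2]. intros q _. cbv beta. rewrite qmul_0r.
        generalize (star (fun _ => qconj (f p)) f q). clear. qring.
      * apply functional_extensionality; intro m. unfold delta, const. qring.
    + now apply geom_summable.
    + now apply geom_inv_r.
    + now apply geom_inv_l.
Qed.

(** The growth estimate for the hyperbolic difference quotient [g], with
    [s = |g(0)|].  At [q = 0] the last factor of [g] equals [1], since
    [f(0) = 0], so [g(0)] is the value of the difference quotient there. *)
Lemma hyp_derivative_bound (f : quat -> quat) (p : quat) :
  slice_regular f -> (forall q, unit_ball q -> unit_ball (f q)) -> f (qreal 0) = qreal 0 ->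
  unit_ball p -> exists s, 0 <= s <= 1 /\ qnorm (f p) = s * qnorm p /\
    qnorm (hyp_derivative f p) <= (s + qnorm p) / (1 + s * qnorm p).
Proof.
  intros Hf Hb f0 Hp.
  destruct (slice_regular_has_coeffs f Hf) as [a Ha].
  assert (Sa := self_map_schur f a Ha Hb).
  assert (Ba := has_coeffs_summable f a Ha).
  assert (B0 : unit_ball (qreal 0)) by (apply unit_ball_real; rewrite Rabs_R0; lra).
  assert (a0 : a 0%nat = qreal 0).
  { rewrite <- f0. assert (H0 := qseries_correct (shift a) _ (summable_tail a 1 Ba) B0).
    apply is_qseries_S in H0. apply is_qseries_unique in H0.
    assert (H1 := Ha _ B0). apply is_qseries_unique in H1. rewrite <- H1, H0, qmul_0l.
    clear. qring. }
  destruct (diff_quotient_spec f a p Ha Hp) as [Rreg _].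
  destruct (slice_regular_has_coeffs _ Rreg) as [rho Hrho].
  assert (Brho := has_coeffs_summable _ _ Hrho).
  assert (Hq := diff_quotient_coeffs f a rho p Ha Hp Hrho).
  assert (Hg := hyp_diff_quotient_coeffs f a rho p Ha Sa a0 (Hb p Hp) Hrho).
  assert (Sg := quotient_schur a rho (f p) p Sa a0 (Hb p Hp) Hp Brho Hq).
  set (g := conv _ (geom _)) in *.
  assert (Grow := schur_growth g p _ Sg (has_coeffs_summable _ _ Hg) Hp (Hg p Hp)).
  exists (qnorm (g 0%nat)). split; [split; [apply qnorm_ge0|now apply schur_le1]|].
  split; [|exact Grow].
  assert (g0 : g 0%nat = rho 0%nat).
  { unfold g. rewrite !conv_0. cbn [affine]. change (geom _ 0%nat) with (qreal 1). now rewrite qmul_1l, qmul_1r. }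
  assert (E := equal_f Hq 0%nat). cbv beta in E. rewrite conv_0, a0 in E. cbn [affine const] in E.
  rewrite g0, Rmult_comm, <- qnorm_mul.
  f_equal. transitivity (- (qreal 0 - f p))%quat; [generalize (f p); clear; qring|].
  rewrite <- E. clear. qring.
Qed.

Theorem corollary3p6 (f : quat -> quat)
  (f_regular : slice_regular f)
  (f_ball : forall q : quat, unit_ball q -> unit_ball (f q))
  (f0 : f (qreal 0) = qreal 0)
  (q0 : quat) (q0_ball : unit_ball q0) :
  (qnorm q0 <= sqrt 2 - 1 ->
     qnorm (hyp_derivative f q0) <= / alpha f q0) /\
  (sqrt 2 - 1 < qnorm q0 < 1 ->
     qnorm (hyp_derivative f q0) <=
       / alpha f q0 *
       ((1 + qnorm q0 ^ 2) ^ 2 / (4 * qnorm q0 * (1 - qnorm q0 ^ 2)))).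
Proof.
  destruct (hyp_derivative_bound f q0 f_regular f_ball f0 q0_ball) as [s [Hs [Hfs Hd]]].
  assert (Hr : 0 <= qnorm q0 < 1) by (split; [apply qnorm_ge0|exact q0_ball]).
  assert (Ealpha : / alpha f q0 = (1 - qnorm q0 ^ 2) / (1 - (s * qnorm q0) ^ 2)).
  { unfold alpha. rewrite Hfs. set (r := qnorm q0) in *.
    field. split; [|nra]. assert (0 <= s * r < 1) by nra. nra. }
  rewrite Ealpha. set (r := qnorm q0) in *.
  assert (Hsr : 0 <= s * r < 1) by nra.
  assert (D1 : 0 < 1 - (s * r) ^ 2) by nra.
  assert (R2 : sqrt 2 * sqrt 2 = 2) by (apply sqrt_sqrt; lra).
  assert (R0 : 0 < sqrt 2) by (apply sqrt_lt_R0; lra).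
  (* the two cases compare (s + r)(1 - s r) with its maximum over 0 <= s <= 1 *)
  assert (Key : forall M, (s + r) * (1 - s * r) <= (1 - r ^ 2) * M ->
    qnorm (hyp_derivative f q0) <= (1 - r ^ 2) / (1 - (s * r) ^ 2) * M).
  { intros M HM. eapply Rle_trans; [exact Hd|].
    apply (Rmult_le_reg_r (1 - (s * r) ^ 2)); [easy|].
    replace ((s + r) / (1 + s * r) * (1 - (s * r) ^ 2)) with ((s + r) * (1 - s * r)) by (field; lra).
    replace ((1 - r ^ 2) / (1 - (s * r) ^ 2) * M * (1 - (s * r) ^ 2)) with ((1 - r ^ 2) * M) by (field; lra).
    exact HM. }
  split; intros H.
  - rewrite <- (Rmult_1_r (_ / _)). apply Key.
    (* 1 - r^2 - (s + r)(1 - s r) = (1 - s) (1 - r - s r - r^2) *)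
    assert (r ^ 2 + 2 * r <= 1) by nra.
    assert (0 <= (1 - s) * (1 - r - s * r - r ^ 2)) by (apply Rmult_le_pos; nra). lra.
  - assert (Hr0 : 0 < r) by nra. apply Key.
    replace ((1 - r ^ 2) * ((1 + r ^ 2) ^ 2 / (4 * r * (1 - r ^ 2)))) with ((1 + r ^ 2) ^ 2 / (4 * r))
      by (field; split; nra).
    apply (Rmult_le_reg_r (4 * r)); [lra|].
    replace ((1 + r ^ 2) ^ 2 / (4 * r) * (4 * r)) with ((1 + r ^ 2) ^ 2) by (field; lra).
    (* AM-GM for r s + r^2 and 1 - s r, whose sum is 1 + r^2 *)
    assert (0 <= (s * r + r ^ 2 - (1 - s * r)) ^ 2) by apply pow2_ge_0. nra.
Qed.
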